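(* Let $N\ge 1$ and let $$g(t)=\sum_{k=1}^N \frac{a_k}{t-iw_k},\qquad a_k>0,\ w_k>0 \ (k=1,\dots,N).$$ Then the frame set of $g$ is $$\mathcal{F}(g)=\{(\alpha,\beta):\ \alpha>0,\ \beta>0,\ \alpha\beta\le 1\}.$$
   Context: For $g\in L^2(\mathbb{R})$ and $\alpha,\beta>0$ the Gabor system is $\mathcal{G}(g;\alpha,\beta)=\{e^{2\pi i\beta n t}g(t-\alpha m)\}_{m,n\in\mathbb{Z}}$. It is a frame in $L^2(\mathbb{R})$ if there are constants $0<A\le B<\infty$ with $A\|f\|^2\le\sum_{m,n}|\langle f, e^{2\pi i\beta n\cdot}g(\cdot-\alpha m)\rangle|^2\le B\|f\|^2$ for all $f\in L^2(\mathbb{R})$. The frame set is $\mathcal{F}(g)=\{(\alpha,\beta):\alpha,\beta>0,\ \mathcal{G}(g;\alpha,\beta)\text{ is a frame in }L^2(\mathbb{R})\}$. *)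

(* Defs.v *)
From HB Require Import structures.
From mathcomp Require Import all_boot all_order all_algebra.
From mathcomp Require Import all_classical all_reals all_analysis.
From mathcomp Require Import complex.
Set Implicit Arguments. Unset Strict Implicit. Unset Printing Implicit Defensive.
Import Order.TTheory GRing.Theory Num.Theory.
Local Open Scope classical_set_scope.
Local Open Scope ring_scope.

Section Gabor.
Variable R : realType.
Local Notation C := R[i].
Local Notation mu := (@lebesgue_measure R).

Definition cabs2 (z : C) : R := complex.Re z ^+ 2 + complex.Im z ^+ 2.

Definition cexpi (theta : R) : C := Complex (cos theta) (sin theta).

Definition L2 (f : R -> C) : Prop :=
  measurable_fun setT (fun t => complex.Re (f t)) /\
  measurable_fun setT (fun t => complex.Im (f t)) /\
  (\int[mu]_t (cabs2 (f t))%:E < +oo)%E.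

Definition L2norm2 (f : R -> C) : \bar R := (\int[mu]_t (cabs2 (f t))%:E)%E.

Definition inner (f h : R -> C) : C :=
  Complex (Rintegral mu setT (fun t => complex.Re (f t * conjc (h t))))
          (Rintegral mu setT (fun t => complex.Im (f t * conjc (h t)))).

Definition gabor_atom (g : R -> C) (alpha beta : R) (m n : int) : R -> C :=
  fun t => cexpi (2 * pi * beta * n%:~R * t) * g (t - alpha * m%:~R).

Definition is_frame (g : R -> C) (alpha beta : R) : Prop :=
  exists A B : R, 0 < A /\ A <= B /\
    forall f : R -> C, L2 f ->
      (A%:E * L2norm2 f <=
         \esum_(mn in [set: int * int])
            (cabs2 (inner f (gabor_atom g alpha beta mn.1 mn.2)))%:E)%E /\
      (\esum_(mn in [set: int * int])
            (cabs2 (inner f (gabor_atom g alpha beta mn.1 mn.2)))%:E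
         <= B%:E * L2norm2 f)%E.

Definition frame_set (g : R -> C) : set (R * R) :=
  [set ab | 0 < ab.1 /\ 0 < ab.2 /\ is_frame g ab.1 ab.2].

Definition rat_window (N : nat) (a w : 'I_N -> R) : R -> C :=
  fun t => \sum_(k < N) (Complex (a k) 0) / (Complex t 0 - Complex 0 1 * Complex (w k) 0).

End Gabor.

(* Main.v *)
(** Write [p = 1 / alpha], [om_k = 2 pi w_k], [A_k = 2 pi a_k], and let [F] be
    the Fourier transform of a compactly supported [f].  Summing the
    geometric series of [e^(- om_k p) e^(2 i pi p t)] gives bounded functions
    [u_k] with [u_k z = e^(- om_k p) u_k (z + p) + F z], and, up to a unimodular
    factor, [<f, g_(m,n)>] is the [m]-th Fourier coefficient on [[0, p]] of
    [x |-> sum_k A_k e^(- om_k x) u_k (x - beta n)].  By Parseval, the frame sum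
    of [f] is [p] times the sum over [n] of the squared [L2([0, p])] norms of
    these functions.  The upper frame bound follows since [u_k] is bounded in
    [L2] by [F].

    For the lower bound let [d z] be the residue of [z] modulo [beta], and
    [s z = sum_k b_k u_k z] with [b_k = A_k e^(- om_k d(z))].  The weights
    [b_k] are positive, so the energy [e z = sum_k b_k |u_k z|^2] satisfies
    [e z <= q e (z + p) + C |s z|^2] with [q < 1] as long as [d <= p], which
    always holds if [beta <= p].  Integrating, [s] controls [e], hence [u] and
    [F]; and the norm of [s] is the frame sum.

    If [beta > p], the frame sum only sees [s] where [d < p].  Prescribe
    [u_k] to be the indicator of a subinterval of [[p, beta[] on [[p, +oo[] and
    solve the recursion backwards, choosing [F z] to make [s z] vanish where
    [d z < p] and [F z = 0] elsewhere.  The energy still decays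
    geometrically, so [F] is a nonzero element of [L2] with vanishing frame
    sum, which rules out a lower frame bound after approximation. *)
Require Import Defs.
From HB Require Import structures.
From mathcomp Require Import all_boot all_order all_algebra.
From mathcomp Require Import all_classical all_reals all_analysis.
From mathcomp Require Import measurable_realfun complex.
From mathcomp Require Import ring lra.
Import Order.TTheory GRing.Theory Num.Theory.
Import numFieldNormedType.Exports.
Local Open Scope classical_set_scope.
Local Open Scope ring_scope.

(** * Integrals of continuous functions on segments *)

(** The recursions for the [u_k] have different factors [q_k = e^(- om_k p)] but the same source
    [F]. The unknown value [F z] thus shifts all the [q_k u_k (z + p)] by one common amount: it
    moves their weighted mean and leaves their weighted spread alone. The spread is inherited from
    [z + p], and the mean after the shift is what [s z] observes. Positivity of the weights makes
    this an energy. The condition [d <= p] is used twice: it bounds the total weight from below, and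
    it bounds the ratio of the weights at [z] and [z + p] by [1 / q_k], which one of the two factors
    of [q_k^2] absorbs.

    Since the weights are real, real and imaginary parts decouple and every estimate concerns real
    functions. Transforms are taken only of continuous functions on a segment, where they are honest
    integrals; Plancherel then follows from Parseval, and [L2] is reached by density. Integrability
    of the energy is not known in advance, so the decay inequality is iterated pointwise, with
    boundedness of the [u_k] removing the remainder. *)

Section ContinuousReal.
Context {R : realType}.
Implicit Types h k : R -> R.

Lemma continuous_mulf h k :
  continuous h -> continuous k -> continuous (fun x => h x * k x).
Proof. by move=> ch ck x; apply: continuousM; [exact: ch|exact: ck]. Qed.

Lemma continuous_addf h k :
  continuous h -> continuous k -> continuous (fun x => h x + k x).
Proof. by move=> ch ck x; apply: continuousD; [exact: ch|exact: ck]. Qed.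

Lemma continuous_oppf h : continuous h -> continuous (fun x => - h x).
Proof. by move=> ch x; apply: continuousN; exact: ch. Qed.

Lemma continuous_expf h n : continuous h -> continuous (fun x => h x ^+ n).
Proof.
move=> ch; elim: n => [|n IH].
  by under eq_fun do rewrite expr0; move=> x; exact: cst_continuous.
by under eq_fun do rewrite exprS; exact: continuous_mulf.
Qed.

Lemma continuous_compf h k :
  continuous h -> continuous k -> continuous (fun x => k (h x)).
Proof.
by move=> ch ck x; apply: continuous_comp; [exact: ch|exact: ck].
Qed.

Lemma continuous_invf h :
  (forall x, h x != 0) -> continuous h -> continuous (fun x => (h x)^-1).
Proof. by move=> h0 ch x; apply: continuousV; [exact: h0|exact: ch]. Qed.

Lemma continuous_sumf (I : Type) (r : seq I) (P : pred I) (F : I -> R -> R) :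
  (forall i, continuous (F i)) -> continuous (fun x => \sum_(i <- r | P i) F i x).
Proof.
move=> cF; elim: r => [|i r IH].
  by under eq_fun do rewrite big_nil; move=> x; exact: cst_continuous.
case: (boolP (P i)) => Pi; last first.
  by under eq_fun do rewrite big_cons (negbTE Pi).
by under eq_fun do rewrite big_cons Pi; exact: continuous_addf.
Qed.

Lemma continuous_cstf (c : R) : continuous (fun _ : R => c).
Proof. by move=> x; exact: cst_continuous. Qed.

Lemma continuous_idf : continuous (fun x : R => x).
Proof. by move=> x; exact: cvg_id. Qed.

Lemma continuous_cosf h : continuous h -> continuous (fun x => cos (h x)).
Proof. by move=> ch; exact: continuous_compf ch (@continuous_cos R). Qed.

Lemma continuous_sinf h : continuous h -> continuous (fun x => sin (h x)).
Proof. by move=> ch; exact: continuous_compf ch (@continuous_sin R). Qed.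

Lemma continuous_expRf h : continuous h -> continuous (fun x => expR (h x)).
Proof. by move=> ch; exact: continuous_compf ch (@continuous_expR R). Qed.

Lemma continuous_normf h : continuous h -> continuous (fun x => `|h x|).
Proof. by move=> ch x; apply: (continuous_comp (ch x)); exact: norm_continuous. Qed.

End ContinuousReal.

(* Purely syntactic dispatch: unification up to conversion may unfold the
   reals here. *)
Ltac ctn := lazymatch goal with
  | |- continuous (fun _ => ?c) => exact: continuous_cstf
  | |- continuous (fun x => x) => exact: continuous_idf
  | |- continuous (fun x => (@?h x + @?k x)%R) => apply: (continuous_addf h k); ctn
  | |- continuous (fun x => (- @?h x)%R) => apply: (continuous_oppf h); ctn
  | |- continuous (fun x => (@?h x * @?k x)%R) => apply: (continuous_mulf h k); ctn
  | |- continuous (fun x => (@?h x ^+ ?n)%R) => apply: (continuous_expf h n); ctn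
  | |- continuous (fun x => cos (@?h x)) => apply: (continuous_cosf h); ctn
  | |- continuous (fun x => sin (@?h x)) => apply: (continuous_sinf h); ctn
  | |- continuous (fun x => expR (@?h x)) => apply: (continuous_expRf h); ctn
  | |- continuous (fun x => `|@?h x|%R) => apply: (continuous_normf h); ctn
  | |- continuous (fun x => bigop.body _ _ _) => apply: continuous_sumf => ?; ctn
  | H : continuous ?f |- continuous ?f => exact: H
  | H : continuous ?f |- continuous (fun x => ?f x) => exact: H
  | H : forall i, continuous (?f i) |- continuous (?f _) => exact: H
  | H : forall i, continuous (?f i) |- continuous (fun x => ?f _ x) => exact: H
  | H : forall i, continuous (?f i) |- continuous (fun x => ?f _ (@?h x)) => apply: (continuous_compf h _ _ (H _)); ctn
  | H : continuous ?f |- continuous (fun x => ?f (@?h x)) => apply: (continuous_compf h f _ H); ctn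
  | |- continuous (fun x => ?f (@?h x)) =>
      first [solve [eauto 2] | apply: (continuous_compf h f); [ctn | solve [eauto 2]]]
  | |- continuous _ => solve [eauto 2]
  end.

Section IntervalIntegral.
Context {R : realType}.
Notation mu := (@lebesgue_measure R).
Implicit Types (a b c : R) (h k : R -> R).

Lemma continuous_integrable a b h :
  continuous h -> mu.-integrable `[a, b] (EFin \o h).
Proof.
move=> ch; apply: continuous_compact_integrable; first exact: segment_compact.
exact: continuous_subspaceT.
Qed.

Lemma cintZ a b c h : continuous h ->
  \int[mu]_(t in `[a, b]) (c * h t) = c * \int[mu]_(t in `[a, b]) h t.
Proof. by move=> ch; rewrite RintegralZl//; exact: continuous_integrable. Qed.

Lemma cintZr a b c h : continuous h ->
  \int[mu]_(t in `[a, b]) (h t * c) = (\int[mu]_(t in `[a, b]) h t) * c.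
Proof. by move=> ch; rewrite RintegralZr//; exact: continuous_integrable. Qed.

Lemma cintD a b h k : continuous h -> continuous k ->
  \int[mu]_(t in `[a, b]) (h t + k t) =
  \int[mu]_(t in `[a, b]) h t + \int[mu]_(t in `[a, b]) k t.
Proof. by move=> ch ck; rewrite RintegralD//; exact: continuous_integrable. Qed.

Lemma cintN a b h : continuous h ->
  \int[mu]_(t in `[a, b]) (- h t) = - \int[mu]_(t in `[a, b]) h t.
Proof.
move=> ch; rewrite -mulN1r -cintZ//.
by apply: eq_Rintegral => x _; rewrite mulN1r.
Qed.

Lemma cintB a b h k : continuous h -> continuous k ->
  \int[mu]_(t in `[a, b]) (h t - k t) =
  \int[mu]_(t in `[a, b]) h t - \int[mu]_(t in `[a, b]) k t.
Proof. by move=> ch ck; rewrite RintegralB//; exact: continuous_integrable. Qed.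

Lemma cint_sum a b (I : Type) (r : seq I) (P : pred I) (F : I -> R -> R) :
  (forall i, continuous (F i)) ->
  \int[mu]_(t in `[a, b]) (\sum_(i <- r | P i) F i t) =
  \sum_(i <- r | P i) \int[mu]_(t in `[a, b]) F i t.
Proof.
move=> cF; elim: r => [|i r IH].
  under eq_Rintegral do rewrite big_nil.
  by rewrite big_nil Rintegral_cst// mul0r.
rewrite big_cons; case: (boolP (P i)) => Pi; last first.
  by rewrite -IH; apply: eq_Rintegral => t _; rewrite big_cons (negbTE Pi).
rewrite -IH -cintD//; last exact: continuous_sumf.
by apply: eq_Rintegral => t _; rewrite big_cons Pi.
Qed.

Lemma cint_le a b h k : continuous h -> continuous k ->
  (forall t, a <= t <= b -> h t <= k t) ->
  \int[mu]_(t in `[a, b]) h t <= \int[mu]_(t in `[a, b]) k t.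
Proof.
move=> ch ck hk; apply: le_Rintegral => //.
- exact: continuous_integrable.
- exact: continuous_integrable.
Qed.

Lemma cint_ge0 a b h : (forall t, a <= t <= b -> 0 <= h t) ->
  0 <= \int[mu]_(t in `[a, b]) h t.
Proof.
by move=> h0; apply: Rintegral_ge0 => x /=; rewrite in_itv/=; exact: h0.
Qed.

Lemma cint_cst a b c : a <= b -> \int[mu]_(t in `[a, b]) c = c * (b - a).
Proof.
move=> ab; rewrite Rintegral_cst//= lebesgue_measure_itv/= lte_fin.
case: ltP => // ba; have -> : b = a by apply/le_anti; rewrite ba ab.
by rewrite subrr /= !mulr0.
Qed.

Lemma cint_norm a b h : continuous h ->
  `|\int[mu]_(t in `[a, b]) h t| <= \int[mu]_(t in `[a, b]) `|h t|.
Proof. by move=> ch; apply: le_normr_Rintegral => //; exact: continuous_integrable. Qed.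

Lemma EFin_cint a b h : continuous h ->
  (\int[mu]_(t in `[a, b]) h t)%:E = (\int[mu]_(t in `[a, b]) (h t)%:E)%E.
Proof.
move=> ch; rewrite /Rintegral fineK//.
exact: (integrable_fin_num _ (continuous_integrable _ _ _ ch)).
Qed.

Lemma cint_eq a b h k : (forall t, a <= t <= b -> h t = k t) ->
  \int[mu]_(t in `[a, b]) h t = \int[mu]_(t in `[a, b]) k t.
Proof.
move=> hk; apply: eq_Rintegral => t; rewrite inE/= in_itv/=; exact: hk.
Qed.

Lemma cint_FTC a b h k : a < b -> continuous h ->
  (forall x : R, is_derive x (1 : R) k (h x)) ->
  \int[mu]_(t in `[a, b]) h t = k b - k a.
Proof.
move=> ab ch dk.
have ck : continuous k.
  by move=> x; apply/differentiable_continuous/derivable1_diffP; exact: (@ex_derive _ _ _ _ _ _ _ (dk x)).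
rewrite /Rintegral (@continuous_FTC2 _ h k)//.
- exact: continuous_subspaceT.
- split.
  + by move=> x _; exact: (@ex_derive _ _ _ _ _ _ _ (dk x)).
  + by apply: cvg_at_right_filter; exact: ck.
  + by apply: cvg_at_left_filter; exact: ck.
- by move=> x _; rewrite derive1E; exact: derive_val.
Qed.

End IntervalIntegral.

Section Calculus.
Context {R : realType}.

Lemma is_derive_mulc (c x : R) : is_derive x (1 : R) (fun t : R => c * t) c.
Proof.
have := @is_deriveZ _ _ _ (@id R) c x 1 1 (is_derive_id x 1).
by rewrite /GRing.scale/= mulr1.
Qed.

Lemma is_derive_sin_mul (c x : R) :
  is_derive x (1 : R) (fun t : R => sin (c * t)) (cos (c * x) * c).
Proof.
exact: (@is_derive1_comp _ (@sin R) (fun t => c * t) x _ _ (is_derive_sin _) (is_derive_mulc c x)).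
Qed.

Lemma is_derive_cos_mul (c x : R) :
  is_derive x (1 : R) (fun t : R => cos (c * t)) (- sin (c * x) * c).
Proof.
exact: (@is_derive1_comp _ (@cos R) (fun t => c * t) x _ _ (is_derive_cos _) (is_derive_mulc c x)).
Qed.

Lemma is_derive_expR_mul (c x : R) :
  is_derive x (1 : R) (fun t : R => expR (c * t)) (expR (c * x) * c).
Proof.
exact: (@is_derive1_comp _ (@expR R) (fun t => c * t) x _ _ (is_derive_expR _) (is_derive_mulc c x)).
Qed.

Lemma cos_periodz (n : int) (x : R) : cos (x + 2 * pi * n%:~R) = cos x.
Proof.
have P m y : cos (y + 2 * pi * m%:R) = cos y :> R.
  have -> : 2 * pi * m%:R = (pi : R) *+ 2 *+ m by rewrite mulr_natr (mulr_natl pi 2).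
  exact: (periodicn (@cosD2pi R) m y).
case: (intP n) => [|m|m]; first by rewrite mulr0 addr0.
  exact: P.
rewrite -[LHS](P m.+1); congr cos.
by rewrite mulrNz pmulrn; ring.
Qed.

Lemma sin_periodz (n : int) (x : R) : sin (x + 2 * pi * n%:~R) = sin x.
Proof. by rewrite -2!cosBpihalf addrAC cos_periodz. Qed.

Lemma uniform_continuity_segment (a b : R) (f : R -> R) (e : R) :
  continuous f -> 0 < e ->
  exists2 d, 0 < d & forall x y, a <= x <= b -> `|x - y| < d -> `|f x - f y| < e.
Proof.
move=> cf e0.
have e20 : 0 < e / 2 by rewrite divr_gt0.
have /compact_near_coveringP/(_ R (nbhs (0 : R)^'+)
  (fun d x => forall y, `|x - y| < d -> `|f x - f y| < e)) := @segment_compact R a b.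
case.
- move=> x _; have /cvgrPdist_lt/(_ _ e20) := cf x.
  move=> /nbhs_ballP[d /= d0 xd].
  (* Half of the radius is spent on moving the centre from [x] to [u], the other half on the
     distance from [u] to [y]; [y] itself may leave the segment. *)
  exists (ball x (d / 2), [set r : R | r < d / 2]) => /=.
    split; first by apply: nbhsx_ballx; rewrite divr_gt0.
    by apply: nbhs_right_lt; rewrite divr_gt0.
  move=> [u r]/= [xu rd] y uy.
  have H1 : `|f x - f u| < e / 2.
    by apply: xd; apply: lt_trans xu _; rewrite ltr_pdivrMr// ltr_pMr// ltr1n.
  have H2 : `|f x - f y| < e / 2.
    apply: xd; rewrite /ball/=.
    have -> : x - y = (x - u) + (u - y) by ring.
    rewrite (le_lt_trans (ler_normD _ _))// (splitr d) ltrD//.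
    by rewrite (lt_trans uy).
  have -> : f u - f y = - (f x - f u) + (f x - f y) by ring.
  by rewrite (le_lt_trans (ler_normD _ _))// normrN (splitr e) ltrD.
- move=> d /= d0 dP; exists (d / 2); first by rewrite divr_gt0.
  move=> x y xab xy; apply: (dP (d / 2)) xy => /=.
  + by rewrite sub0r normrN gtr0_norm ?divr_gt0// ltr_pdivrMr// ltr_pMr// ltr1n.
  + by rewrite divr_gt0.
  + by rewrite in_itv.
Qed.

Lemma continuous_bounded_segment (a b : R) (f : R -> R) : continuous f ->
  exists2 B, 0 < B & forall x, a <= x <= b -> `|f x| <= B.
Proof.
move=> cf.
have [ab|ba] := leP a b; last first.
  exists 1 => // x /andP[ax xb]; have := le_trans ax xb.
  by rewrite leNgt ba.
have cn : {within `[a, b], continuous (fun x => `|f x|)}.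
  by apply: continuous_subspaceT; exact: continuous_normf.
have [c _ cP] := EVT_max ab cn.
exists (`|f c| + 1); first by rewrite ltr_pwDr.
by move=> x xab; rewrite (le_trans (cP x _)) ?in_itv//= lerDl.
Qed.

End Calculus.

(** * Parseval and Plancherel identities *)

Ltac tring :=
  repeat match goal with
  | |- context [@cos ?R ?x] => generalize (@cos R x); intro
  | |- context [@sin ?R ?x] => generalize (@sin R x); intro
  end; ring.

Section FourierIntegral.
Context {R : realType}.
Notation mu := (@lebesgue_measure R).
Implicit Types (a b z : R) (f g : R -> R).

(* Real and imaginary parts of the integral of (f + i g)(t) e^(2 i pi z t). *)
Definition FTr a b f g z : R :=
  \int[mu]_(t in `[a, b]) (f t * cos (2 * pi * z * t) - g t * sin (2 * pi * z * t)).
Definition FTi a b f g z : R :=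
  \int[mu]_(t in `[a, b]) (f t * sin (2 * pi * z * t) + g t * cos (2 * pi * z * t)).

Lemma cint_cos_int a b (n : int) : a < b ->
  \int[mu]_(t in `[a, b]) cos (2 * pi * (n%:~R / (b - a)) * t) =
  if n == 0 then b - a else 0.
Proof.
move=> ab; have ba : b - a != 0 by rewrite subr_eq0 gt_eqF.
have [->|n0] := eqVneq n 0.
  transitivity (\int[mu]_(t in `[a, b]) (1 : R)).
    by apply: cint_eq => t _; rewrite mul0r mulr0 mul0r cos0.
  by rewrite cint_cst ?mul1r// ltW.
set c := 2 * pi * (n%:~R / (b - a)).
have c0 : c != 0.
  by rewrite /c !mulf_neq0 ?invr_eq0 ?intr_eq0// ?gt_eqF ?pi_gt0.
have -> : \int[mu]_(t in `[a, b]) cos (c * t) =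
          c^-1 * \int[mu]_(t in `[a, b]) (cos (c * t) * c).
  by rewrite cintZr; [rewrite mulrC mulfK|ctn].
have cc : continuous (fun t => cos (c * t) * c) by ctn.
rewrite (cint_FTC _ _ _ _ ab cc (is_derive_sin_mul c)).
have -> : c * b = c * a + 2 * pi * n%:~R by rewrite /c; field.
by rewrite sin_periodz subrr mulr0.
Qed.

Lemma cint_sin_int a b (n : int) : a < b ->
  \int[mu]_(t in `[a, b]) sin (2 * pi * (n%:~R / (b - a)) * t) = 0.
Proof.
move=> ab; have ba : b - a != 0 by rewrite subr_eq0 gt_eqF.
have [->|n0] := eqVneq n 0.
  transitivity (\int[mu]_(t in `[a, b]) (0 : R)).
    by apply: cint_eq => t _; rewrite mul0r mulr0 mul0r sin0.
  by rewrite cint_cst ?mul0r// ltW.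
set c := 2 * pi * (n%:~R / (b - a)).
have c0 : c != 0.
  by rewrite /c !mulf_neq0 ?invr_eq0 ?intr_eq0// ?gt_eqF ?pi_gt0.
have -> : \int[mu]_(t in `[a, b]) sin (c * t) =
          - c^-1 * \int[mu]_(t in `[a, b]) (- sin (c * t) * c).
  rewrite cintZr; [rewrite cintN; [by field|by ctn]|by ctn].
have cc : continuous (fun t => - sin (c * t) * c) by ctn.
rewrite (cint_FTC _ _ _ _ ab cc (is_derive_cos_mul c)).
have -> : c * b = c * a + 2 * pi * n%:~R by rewrite /c; field.
by rewrite cos_periodz subrr mulr0.
Qed.

(** The squared distance between [f + i g] and its partial Fourier sum over [s] is nonnegative; by
    orthogonality of the characters it is the energy of [f + i g] minus the normalized sum of
    squared coefficients. *)
Lemma Bessel a b f g (s : seq int) : a < b -> continuous f -> continuous g ->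
  uniq s ->
  \sum_(n <- s) (FTr a b f g (n%:~R / (b - a)) ^+ 2
                 + FTi a b f g (n%:~R / (b - a)) ^+ 2) <=
  (b - a) * \int[mu]_(t in `[a, b]) (f t ^+ 2 + g t ^+ 2).
Proof.
move=> ab cf cg us; set P := b - a.
have P0 : 0 < P by rewrite subr_gt0.
pose th n : R := 2 * pi * (n%:~R / P).
(* The coefficients are given opaque names, so that continuity and ring normalization treat them as
   constants. *)
have [X XE] : exists X : int -> R, forall n, FTr a b f g (n%:~R / P) = X n by eexists.
have [Y YE] : exists Y : int -> R, forall n, FTi a b f g (n%:~R / P) = Y n by eexists.
(* [F + i G] is the partial sum, [P^-1] times the sum of [(X n + i Y n) e^(- i th n t)]. *)
pose F t := P^-1 * \sum_(n <- s) (X n * cos (th n * t) + Y n * sin (th n * t)).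
pose G t := P^-1 * \sum_(n <- s) (Y n * cos (th n * t) - X n * sin (th n * t)).
have cF : continuous F by rewrite /F; ctn.
have cG : continuous G by rewrite /G; ctn.
(* Real part of the pairing with the partial sum. Applied to [f + i g] and to [F + i G] itself, it
   gives [P^-1 T] both times. *)
have dot (u v : R -> R) : continuous u -> continuous v ->
    \int[mu]_(t in `[a, b]) (u t * F t + v t * G t) =
    P^-1 * \sum_(n <- s) (X n * FTr a b u v (n%:~R / P) + Y n * FTi a b u v (n%:~R / P)).
  move=> cu cv.
  transitivity (\int[mu]_(t in `[a, b]) (P^-1 * \sum_(n <- s)
     (X n * (u t * cos (th n * t) - v t * sin (th n * t)) +
      Y n * (u t * sin (th n * t) + v t * cos (th n * t))))).
    apply: cint_eq => t _; rewrite /F /G.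
    rewrite !(mulrCA _ P^-1) -mulrDr; congr (_ * _).
    rewrite !mulr_sumr -big_split/=; apply: eq_bigr => n _; tring.
  rewrite cintZ; last by ctn.
  rewrite cint_sum; last by move=> n; ctn.
  congr (_ * _); apply: eq_bigr => n _.
  rewrite cintD; [|by ctn|by ctn].
  by rewrite !cintZ//; ctn.
have FTFG n : n \in s -> FTr a b F G (n%:~R / P) = X n /\ FTi a b F G (n%:~R / P) = Y n.
  move=> ns; split.
  - transitivity (\int[mu]_(t in `[a, b]) (P^-1 * \sum_(m <- s)
       (X m * cos (th (m - n) * t) + Y m * sin (th (m - n) * t)))).
      apply: cint_eq => t _; rewrite -/(th n) /F /G -2!(mulrA P^-1) -mulrBr; congr (_ * _).
      rewrite !mulr_suml -sumrB; apply: eq_bigr => m _.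
      have -> : th (m - n) * t = th m * t - th n * t by rewrite /th rmorphB/=; ring.
      rewrite cosB sinB; tring.
    rewrite cintZ; last by ctn.
    rewrite cint_sum; last by move=> m; ctn.
    rewrite (bigD1_seq n)//= cintD; [|by ctn|by ctn].
    rewrite !cintZ; [|by ctn|by ctn].
    rewrite cint_cos_int// cint_sin_int// subrr eqxx big1 => [|m mn].
      by rewrite -/P; field; rewrite gt_eqF.
    rewrite cintD; [|by ctn|by ctn].
    rewrite !cintZ; [|by ctn|by ctn].
    by rewrite cint_cos_int// cint_sin_int// subr_eq0 (negbTE mn) !mulr0 addr0.
  - transitivity (\int[mu]_(t in `[a, b]) (P^-1 * \sum_(m <- s)
       (Y m * cos (th (m - n) * t) - X m * sin (th (m - n) * t)))).
      apply: cint_eq => t _; rewrite -/(th n) /F /G -2!(mulrA P^-1) -mulrDr; congr (_ * _).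
      rewrite !mulr_suml -big_split/=; apply: eq_bigr => m _.
      have -> : th (m - n) * t = th m * t - th n * t by rewrite /th rmorphB/=; ring.
      rewrite cosB sinB; tring.
    rewrite cintZ; last by ctn.
    rewrite cint_sum; last by move=> m; ctn.
    rewrite (bigD1_seq n)//= cintB; [|by ctn|by ctn].
    rewrite !cintZ; [|by ctn|by ctn].
    rewrite cint_cos_int// cint_sin_int// subrr eqxx big1 => [|m mn].
      by rewrite -/P; field; rewrite gt_eqF.
    rewrite cintB; [|by ctn|by ctn].
    rewrite !cintZ; [|by ctn|by ctn].
    by rewrite cint_cos_int// cint_sin_int// subr_eq0 (negbTE mn) !mulr0 subr0.
set T := \sum_(n <- s) _.
have fF : \int[mu]_(t in `[a, b]) (f t * F t + g t * G t) = P^-1 * T.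
  by rewrite (dot _ _ cf cg); congr (_ * _); apply: eq_bigr => n _; rewrite XE YE !expr2.
have FF : \int[mu]_(t in `[a, b]) (F t * F t + G t * G t) = P^-1 * T.
  rewrite (dot _ _ cF cG); congr (_ * _); rewrite /T; apply: eq_big_seq => n ns.
  have [-> ->] := FTFG n ns.
  by rewrite XE YE !expr2.
have := @cint_ge0 _ a b (fun t => (f t - F t) ^+ 2 + (g t - G t) ^+ 2) _.
have -> : \int[mu]_(t in `[a, b]) ((f t - F t) ^+ 2 + (g t - G t) ^+ 2) =
  \int[mu]_(t in `[a, b]) (f t ^+ 2 + g t ^+ 2) - P^-1 * T.
  transitivity (\int[mu]_(t in `[a, b]) ((f t ^+ 2 + g t ^+ 2) +
     ((-2) * (f t * F t + g t * G t) + (F t * F t + G t * G t)))).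
    by apply: cint_eq => t _; ring.
  rewrite cintD; [|by ctn|by ctn].
  congr (_ + _).
  rewrite cintD; [|by ctn|by ctn].
  rewrite (cintZ _ _ (-2)); last by ctn.
  by rewrite fF FF; ring.
move=> H; have : 0 <= \int[mu]_(t in `[a, b]) (f t ^+ 2 + g t ^+ 2) - P^-1 * T.
  by apply: H => t _; rewrite addr_ge0// sqr_ge0.
by rewrite subr_ge0 mulrC ler_pdivrMr// mulrC.
Qed.

End FourierIntegral.

(** * The Fejer kernel and the lower half of Parseval's identity *)

Section Fejer.
Context {R : realType}.
Notation mu := (@lebesgue_measure R).
Implicit Types (a b t s : R) (f g : R -> R).

(** The Fejer kernel of period [P], kept as a squared modulus of a sum of [M] characters: it is
    visibly nonnegative, and [fejerB] separates the variables [t] and [s]. *)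
Definition fejer (P : R) (M : nat) (u : R) : R :=
  M%:R^-1 * ((\sum_(j < M) cos (2 * pi * (j%:R / P) * u)) ^+ 2
             + (\sum_(j < M) sin (2 * pi * (j%:R / P) * u)) ^+ 2).

Lemma fejer_ge0 P M u : 0 <= fejer P M u.
Proof. by rewrite mulr_ge0 ?invr_ge0 ?ler0n// addr_ge0// sqr_ge0. Qed.

Lemma continuous_fejer P M : continuous (fejer P M).
Proof. by rewrite /fejer; ctn. Qed.

Let frq (P : R) (j k : nat) : R := 2 * pi * ((j%:Z - k%:Z)%:~R / P).

Lemma fejerB P M t s : fejer P M (t - s) =
  M%:R^-1 * \sum_(j < M) \sum_(k < M)
    (cos (frq P j k * t) * cos (frq P j k * s) + sin (frq P j k * t) * sin (frq P j k * s)).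
Proof.
rewrite /fejer; congr (_ * _).
rewrite !expr2 !mulr_suml -big_split/=; apply: eq_bigr => j _.
rewrite !mulr_sumr -big_split/=; apply: eq_bigr => k _.
by rewrite -!cosB; congr cos; rewrite /frq rmorphB/= -!pmulrn; ring.
Qed.

Lemma cint_fejer a b M t : a < b -> (0 < M)%N ->
  \int[mu]_(s in `[a, b]) fejer (b - a) M (t - s) = b - a.
Proof.
move=> ab M0.
transitivity (\int[mu]_(s in `[a, b]) (M%:R^-1 * \sum_(j < M) \sum_(k < M)
    (cos (frq (b - a) j k * t) * cos (frq (b - a) j k * s) +
     sin (frq (b - a) j k * t) * sin (frq (b - a) j k * s)))).
  by apply: cint_eq => s _; rewrite fejerB.
rewrite cintZ; last by ctn.
rewrite cint_sum; last by move=> j; ctn.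
rewrite (eq_bigr (fun=> b - a)) => [|j _].
  rewrite sumr_const card_ord -[X in _ * X]mulr_natl mulrA mulVf ?mul1r//.
  by rewrite pnatr_eq0 -lt0n.
rewrite cint_sum; last by move=> k; ctn.
rewrite (bigD1 j)//= big1 => [|k kj].
  rewrite cintD; [|by ctn|by ctn].
  rewrite !cintZ; [|by ctn|by ctn].
  by rewrite cint_cos_int// cint_sin_int// subrr eqxx /frq subrr mul0r mulr0 mul0r cos0; ring.
rewrite cintD; [|by ctn|by ctn].
rewrite !cintZ; [|by ctn|by ctn].
rewrite cint_cos_int// cint_sin_int// subr_eq0 ifF; first by ring.
by apply/negbTE; rewrite eq_sym.
Qed.

Lemma sum_cos_telescope (M : nat) (x : R) :
  2 * sin x * \sum_(j < M) cos (2 * j%:R * x) = sin ((2 * M%:R - 1) * x) + sin x.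
Proof.
elim: M => [|M IH].
  by rewrite big_ord0 mulr0 mulr0 sub0r mulN1r sinN addNr.
rewrite big_ord_recr/= mulrDr IH.
have -> : (2 * M.+1%:R - 1) * x = 2 * M%:R * x + x by rewrite -natr1; ring.
have -> : (2 * M%:R - 1) * x = 2 * M%:R * x - x by ring.
by rewrite sinB sinD; tring.
Qed.

Lemma sum_sin_telescope (M : nat) (x : R) :
  2 * sin x * \sum_(j < M) sin (2 * j%:R * x) = cos x - cos ((2 * M%:R - 1) * x).
Proof.
elim: M => [|M IH].
  by rewrite big_ord0 mulr0 mulr0 sub0r mulN1r cosN subrr.
rewrite big_ord_recr/= mulrDr IH.
have -> : (2 * M.+1%:R - 1) * x = 2 * M%:R * x + x by rewrite -natr1; ring.
have -> : (2 * M%:R - 1) * x = 2 * M%:R * x - x by ring.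
by rewrite cosB cosD; tring.
Qed.

Lemma sqr_le1_of_double (x y z : R) : `|y| <= 1 -> `|z| <= 1 -> 2 * x = y + z ->
  x ^+ 2 <= 1.
Proof.
move=> y1 z1 xyz; rewrite -[leRHS](expr1n _ 2) -[leLHS]real_normK ?num_real//.
rewrite ler_sqr ?nnegrE//.
have : `|2 * x| <= 2 by rewrite xyz (le_trans (ler_normD _ _))//; lra.
by rewrite normrM ger0_norm//; lra.
Qed.

(** Multiplied by [2 sin x], each trigonometric sum telescopes to two sines or two cosines, so
    [sin x] times the sum lies in [[-1, 1]]. The two squares account for the constant [2]. *)
Lemma fejer_le (P : R) M u : fejer P M u * sin (pi * u / P) ^+ 2 <= 2 / M%:R.
Proof.
set x := pi * u / P.
have Ec : \sum_(j < M) cos (2 * pi * (j%:R / P) * u) = \sum_(j < M) cos (2 * j%:R * x).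
  by apply: eq_bigr => j _; congr cos; rewrite /x; ring.
have Es : \sum_(j < M) sin (2 * pi * (j%:R / P) * u) = \sum_(j < M) sin (2 * j%:R * x).
  by apply: eq_bigr => j _; congr sin; rewrite /x; ring.
rewrite /fejer Ec Es.
have H1 : (sin x * \sum_(j < M) cos (2 * j%:R * x)) ^+ 2 <= 1.
  apply: (sqr_le1_of_double _ (sin ((2 * M%:R - 1) * x)) (sin x)).
  - by rewrite ler_norml sin_geN1 sin_le1.
  - by rewrite ler_norml sin_geN1 sin_le1.
  - by rewrite mulrA sum_cos_telescope.
have H2 : (sin x * \sum_(j < M) sin (2 * j%:R * x)) ^+ 2 <= 1.
  apply: (sqr_le1_of_double _ (cos x) (- cos ((2 * M%:R - 1) * x))).
  - by rewrite ler_norml cos_geN1 cos_le1.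
  - by rewrite normrN ler_norml cos_geN1 cos_le1.
  - by rewrite mulrA sum_sin_telescope.
rewrite mulrC mulrCA mulrC ler_wpM2r ?invr_ge0 ?ler0n//.
by rewrite mulrDr -!exprMn; apply: (le_trans (lerD H1 H2)).
Qed.

Lemma sin_pos_min (d : R) : 0 < d -> d < pi / 2 ->
  exists2 m : R, 0 < m & forall x, d <= `|x| <= pi - d -> m <= sin x ^+ 2.
Proof.
move=> d0 dpi.
have dd : d <= pi - d by lra.
have cs : {within `[d, pi - d], continuous (@sin R)}.
  by apply: continuous_subspaceT; exact: continuous_sin.
have [c cd cP] := EVT_min dd cs.
have c0 : 0 < sin c.
  apply: sin_gt0_pi; move: cd; rewrite in_itv/= => /andP[dc cpi].
  by apply/andP; split; lra.
exists (sin c ^+ 2); first by rewrite exprn_gt0.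
move=> x xd.
have -> : sin x ^+ 2 = sin `|x| ^+ 2.
  by case: (ger0P x) => // _; rewrite sinN sqrrN.
have H := cP `|x| _; rewrite in_itv/= in H.
rewrite ler_sqr ?nnegrE ?(ltW c0) ?H//.
by apply: le_trans (H xd); exact: ltW.
Qed.

(** A difference [n = j - k] occurs [M - |n|] times, so [Qf] is a Cesaro mean of squared Fourier
    coefficients. [cv] is the convolution of [f] with the Fejer kernel, and [Qf] is its pairing with
    [f]. *)
Let Qf (a b : R) (M : nat) (f : R -> R) := M%:R^-1 * \sum_(j < M) \sum_(k < M)
  ((\int[mu]_(s in `[a, b]) (f s * cos (frq (b - a) j k * s))) ^+ 2 +
   (\int[mu]_(s in `[a, b]) (f s * sin (frq (b - a) j k * s))) ^+ 2).

Let cv (a b : R) (M : nat) (f : R -> R) (t : R) := M%:R^-1 * \sum_(j < M) \sum_(k < M)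
  (cos (frq (b - a) j k * t) * \int[mu]_(s in `[a, b]) (f s * cos (frq (b - a) j k * s)) +
   sin (frq (b - a) j k * t) * \int[mu]_(s in `[a, b]) (f s * sin (frq (b - a) j k * s))).

Let continuous_cv a b M f : continuous (cv a b M f).
Proof. by rewrite /cv; ctn. Qed.

Let cvE a b M f t : continuous f ->
  \int[mu]_(s in `[a, b]) (fejer (b - a) M (t - s) * f s) = cv a b M f t.
Proof.
move=> cf.
transitivity (\int[mu]_(s in `[a, b]) (M%:R^-1 * \sum_(j < M) \sum_(k < M)
    (cos (frq (b - a) j k * t) * (f s * cos (frq (b - a) j k * s)) +
     sin (frq (b - a) j k * t) * (f s * sin (frq (b - a) j k * s))))).
  apply: cint_eq => s _; rewrite fejerB -mulrA; congr (_ * _).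
  rewrite mulr_suml; apply: eq_bigr => j _.
  by rewrite mulr_suml; apply: eq_bigr => k _; tring.
rewrite cintZ; last by ctn.
congr (_ * _); rewrite cint_sum; last by move=> j; ctn.
apply: eq_bigr => j _; rewrite cint_sum; last by move=> k; ctn.
apply: eq_bigr => k _; rewrite cintD; [|by ctn|by ctn].
by rewrite !cintZ//; ctn.
Qed.

Let QfE a b M f : continuous f ->
  \int[mu]_(t in `[a, b]) (f t * cv a b M f t) = Qf a b M f.
Proof.
move=> cf.
transitivity (\int[mu]_(t in `[a, b]) (M%:R^-1 * \sum_(j < M) \sum_(k < M)
  (\int[mu]_(s in `[a, b]) (f s * cos (frq (b - a) j k * s)) * (f t * cos (frq (b - a) j k * t)) +
   \int[mu]_(s in `[a, b]) (f s * sin (frq (b - a) j k * s)) * (f t * sin (frq (b - a) j k * t))))).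
  apply: cint_eq => t _; rewrite /cv mulrCA; congr (_ * _).
  rewrite mulr_sumr; apply: eq_bigr => j _.
  rewrite mulr_sumr; apply: eq_bigr => k _.
  rewrite mulrDr.
  by congr (_ + _); rewrite mulrA mulrC.
rewrite cintZ; last by ctn.
congr (_ * _); rewrite cint_sum; last by move=> j; ctn.
apply: eq_bigr => j _; rewrite cint_sum; last by move=> k; ctn.
apply: eq_bigr => k _; rewrite cintD; [|by ctn|by ctn].
by rewrite !cintZ -?expr2//; ctn.
Qed.

(** The two exponentials are at least [1] on the end layers of width [d]. They majorize the
    indicators of these layers by continuous functions, at a cost of order [d]. *)
Let exp_cutoff a b (d : R) : a < b -> 0 < d ->
  \int[mu]_(t in `[a, b]) (expR (1 - (t - a) / d) + expR (1 - (b - t) / d)) <= 2 * expR 1 * d.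
Proof.
move=> ab d0; have dn : d != 0 by rewrite gt_eqF.
pose c := d^-1; have dc : d * c = 1 by rewrite /c divff.
have E1 t : expR (1 - (t - a) / d) = (- d * expR (1 + a / d)) * (expR (- c * t) * - c).
  have -> : 1 - (t - a) / d = (1 + a / d) + - c * t by rewrite /c; ring.
  by rewrite expRD -[LHS]mul1r -dc; ring.
have E2 t : expR (1 - (b - t) / d) = (d * expR (1 - b / d)) * (expR (c * t) * c).
  have -> : 1 - (b - t) / d = (1 - b / d) + c * t by rewrite /c; ring.
  by rewrite expRD -[LHS]mul1r -dc; ring.
have D1 : continuous (fun t => expR (- c * t) * - c) by ctn.
have D2 : continuous (fun t => expR (c * t) * c) by ctn.
have -> : \int[mu]_(t in `[a, b]) (expR (1 - (t - a) / d) + expR (1 - (b - t) / d)) =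
  \int[mu]_(t in `[a, b]) ((- d * expR (1 + a / d)) * (expR (- c * t) * - c)) +
  \int[mu]_(t in `[a, b]) ((d * expR (1 - b / d)) * (expR (c * t) * c)).
  by rewrite -cintD; [apply: cint_eq => t _; rewrite E1 E2|ctn|ctn].
rewrite (cintZ _ _ _ _ D1) (cintZ _ _ _ _ D2).
rewrite (cint_FTC _ _ _ _ ab D1 (is_derive_expR_mul (- c))).
rewrite (cint_FTC _ _ _ _ ab D2 (is_derive_expR_mul c)).
rewrite !mulrBr -!mulrA -!expRD.
have -> : 1 + a / d + - c * a = 1 by rewrite /c; ring.
have -> : 1 - b / d + c * b = 1 by rewrite /c; ring.
have := expR_gt0 (1 + a / d + - c * b); have := expR_gt0 (1 - b / d + c * a).
by move=> /(mulr_gt0 d0) + /(mulr_gt0 d0); lra.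
Qed.

(** The quantity to bound is the double integral of [f t (f t - f s)] against the kernel. For
    [|t - s| < d] uniform continuity applies; for [d <= |t - s| <= P - d] the kernel is of order
    [1 / M]; otherwise [t] is near an end, where the periodic extension of [f] may jump. The
    converse inequality is Bessel's. *)
Lemma fejer_approx a b f (e : R) : a < b -> continuous f -> 0 < e ->
  exists M0 : nat, forall M : nat, (M0 < M)%N ->
  (b - a) * \int[mu]_(t in `[a, b]) f t ^+ 2 <=
  M%:R^-1 * (\sum_(j < M) \sum_(k < M)
    ((\int[mu]_(s in `[a, b]) (f s * cos (2 * pi * ((j%:Z - k%:Z)%:~R / (b - a)) * s))) ^+ 2 +
     (\int[mu]_(s in `[a, b]) (f s * sin (2 * pi * ((j%:Z - k%:Z)%:~R / (b - a)) * s))) ^+ 2))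
  + e.
Proof.
move=> ab cf e0; set P := b - a.
have P0 : 0 < P by rewrite subr_gt0.
have [B B0 fB] := continuous_bounded_segment a b f cf.
pose e1 := e / (3 * B * P ^+ 2).
have e10 : 0 < e1 by rewrite divr_gt0// !mulr_gt0// exprn_gt0.
have [d1 d10 fd1] := uniform_continuity_segment a b f e1 cf e10.
pose E := expR 1 : R.
have E0 : 0 < E by exact: expR_gt0.
(* Each of the three regions is allowed an error [e / 3]: [e1] serves the near region, the second
   entry of [d] the end layers, and the threshold on [M] the rest. The entry [P / 4] keeps
   [pi d / P] below [pi / 2]. *)
pose d := Num.min d1 (Num.min (e / (12 * E * B ^+ 2 * P)) (P / 4)).
have d0 : 0 < d.
  by rewrite !lt_min d10 !divr_gt0// !mulr_gt0// exprn_gt0.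
have dd1 : d <= d1 by rewrite ge_min lexx.
have dE : d <= e / (12 * E * B ^+ 2 * P) by rewrite !ge_min lexx orbT.
have dP : d <= P / 4 by rewrite !ge_min lexx !orbT.
have pd0 : 0 < pi * d / P by rewrite divr_gt0// mulr_gt0// pi_gt0.
have pd1 : pi * d / P < pi / 2.
  by rewrite -mulrA ltr_pM2l ?pi_gt0// ltr_pdivrMr//; lra.
have [m m0 mP] := sin_pos_min _ pd0 pd1.
have BB : 0 <= 2 * B ^+ 2 by rewrite mulr_ge0// sqr_ge0.
exists (Num.truncn (12 * B ^+ 2 * P ^+ 2 / (m * e))) => M MM.
have M0 : (0 < M)%N by exact: leq_ltn_trans MM.
have ME : 12 * B ^+ 2 * P ^+ 2 <= M%:R * (m * e).
  rewrite -ler_pdivrMr ?mulr_gt0//; apply: ltW; apply: lt_le_trans (truncnS_gt _) _.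
  by rewrite ler_nat.
rewrite -/(Qf a b M f) -QfE//.
pose chi t := expR (1 - (t - a) / d) + expR (1 - (b - t) / d).
have cchi : continuous chi by rewrite /chi; ctn.
have chi0 t : 0 <= chi t by rewrite addr_ge0// expR_ge0.
have M0' : (0 : R) < M%:R by rewrite ltr0n.
pose K : R := 4 * B ^+ 2 / (M%:R * m).
have K0 : 0 <= K by rewrite divr_ge0// ?mulr_ge0 ?sqr_ge0 ?ltW.
have kernel_bound t s : a <= t <= b -> a <= s <= b ->
  f t * (f t - f s) * fejer P M (t - s) <=
  (B * e1 + 2 * B ^+ 2 * chi t) * fejer P M (t - s) + K.
  move=> tab sab; have F0 := fejer_ge0 P M (t - s).
  have ft := fB _ tab; have fs := fB _ sab.
  have ub2 : f t * (f t - f s) <= 2 * B ^+ 2.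
    apply: (le_trans (ler_norm _)); rewrite normrM.
    have -> : 2 * B ^+ 2 = B * (B + B) by ring.
    apply: ler_pM => //; apply: (le_trans (ler_normB _ _)).
    exact: lerD.
  have [near|far] := ltP `|t - s| d.
    have H : f t * (f t - f s) <= B * e1.
      apply: (le_trans (ler_norm _)); rewrite normrM; apply: ler_pM => //.
      by apply: ltW; apply: fd1 => //; exact: lt_le_trans near dd1.
    have : f t * (f t - f s) * fejer P M (t - s) <= B * e1 * fejer P M (t - s).
      exact: ler_wpM2r.
    have : 0 <= 2 * B ^+ 2 * chi t * fejer P M (t - s).
      by rewrite mulr_ge0// mulr_ge0.
    lra.
  have [farP|corner] := leP `|t - s| (P - d).
    have H : m <= sin (pi * (t - s) / P) ^+ 2.
      apply: mP; rewrite !normrM (ger0_norm (pi_ge0 _)) normfV (gtr0_norm P0).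
      have -> : pi - pi * d / P = pi * (P - d) / P by field; rewrite gt_eqF.
      by rewrite !ler_wpM2r ?invr_ge0 ?(ltW P0)// !ler_wpM2l// pi_ge0.
    have H2 : fejer P M (t - s) * m <= 2 / M%:R.
      by apply: le_trans (fejer_le P M (t - s)); exact: ler_wpM2l.
    have H3 : fejer P M (t - s) <= 2 / (M%:R * m).
      by rewrite invfM mulrA -ler_pdivlMr ?invr_gt0// ?invrK// in H2 *; rewrite ler_pdivlMr.
    have : f t * (f t - f s) * fejer P M (t - s) <= 2 * B ^+ 2 * (2 / (M%:R * m)).
      apply: (le_trans (ler_wpM2r F0 ub2)); apply: ler_wpM2l H3.
      exact: BB.
    have -> : 2 * B ^+ 2 * (2 / (M%:R * m)) = K by rewrite /K; ring.
    have : 0 <= (B * e1 + 2 * B ^+ 2 * chi t) * fejer P M (t - s).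
      rewrite mulr_ge0// addr_ge0//; [exact: mulr_ge0 (ltW B0) (ltW e10)|exact: mulr_ge0].
    lra.
  (* Inside a segment of length [P], a distance above [P - d] forces [t] to within [d] of an end. *)
  have chi1 : 1 <= chi t.
    move: tab sab => /andP[at_ tb] /andP[as_ sb].
    have : t - a <= d \/ b - t <= d.
      have [ta|ta] := leP (t - a) d; [by left|right].
      rewrite leNgt; apply/negP => tb'; move: corner; rewrite ltNge => /negP; apply.
      by rewrite ler_norml /P; apply/andP; split; lra.
    case=> H.
      have : 1 <= expR (1 - (t - a) / d).
        by rewrite -[leLHS]expR0 ler_expR subr_ge0 ler_pdivrMr// mul1r.
      by have := expR_ge0 (1 - (b - t) / d); rewrite /chi; lra.
    have : 1 <= expR (1 - (b - t) / d).
      by rewrite -[leLHS]expR0 ler_expR subr_ge0 ler_pdivrMr// mul1r.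
    by have := expR_ge0 (1 - (t - a) / d); rewrite /chi; lra.
  have : f t * (f t - f s) * fejer P M (t - s) <= 2 * B ^+ 2 * chi t * fejer P M (t - s).
    apply: ler_wpM2r => //; apply: (le_trans ub2).
    by rewrite ler_peMr.
  have : 0 <= B * e1 * fejer P M (t - s).
    by rewrite mulr_ge0//; exact: mulr_ge0 (ltW B0) (ltW e10).
  lra.
have inner t : a <= t <= b ->
  P * f t ^+ 2 - f t * cv a b M f t <= (B * e1 + 2 * B ^+ 2 * chi t) * P + K * P.
  move=> tab.
  have cfj : continuous (fun s => fejer P M (t - s)).
    apply: (continuous_compf (fun s => t - s)); first by ctn.
    exact: continuous_fejer.
  have -> : P * f t ^+ 2 - f t * cv a b M f t =
    \int[mu]_(s in `[a, b]) (f t * (f t - f s) * fejer P M (t - s)).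
    transitivity (\int[mu]_(s in `[a, b])
      (f t ^+ 2 * fejer P M (t - s) - f t * (fejer P M (t - s) * f s))); last first.
      by apply: cint_eq => s _; ring.
    rewrite cintB; [|by ctn|by ctn].
    have cff : continuous (fun s => fejer P M (t - s) * f s) by ctn.
    rewrite (cintZ _ _ (f t ^+ 2) _ cfj) (cintZ _ _ (f t) _ cff).
    by rewrite (cvE a b M f t cf) (cint_fejer a b M t ab M0) -/P; ring.
  apply: (le_trans (y := \int[mu]_(s in `[a, b])
     ((B * e1 + 2 * B ^+ 2 * chi t) * fejer P M (t - s) + K))).
    apply: cint_le; [by ctn|by ctn|].
    by move=> s sab; exact: kernel_bound.
  rewrite cintD; [|by ctn|by ctn].
  by rewrite (cintZ _ _ _ _ cfj) (cint_fejer a b M t ab M0) (cint_cst _ _ _ (ltW ab)).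
have ccv := continuous_cv a b M f.
rewrite -lerBlDl -cintZ; last by ctn.
rewrite -cintB; [|by ctn|by ctn].
apply: (le_trans (y := \int[mu]_(t in `[a, b])
   ((B * e1 * P + K * P) + 2 * B ^+ 2 * P * chi t))).
  apply: cint_le; [by ctn|by ctn|].
  move=> t tab; apply: (le_trans (inner t tab)).
  by rewrite le_eqVlt; apply/orP; left; apply/eqP; ring.
rewrite cintD; [|by ctn|by ctn].
rewrite cintZ// cint_cst ?(ltW ab)// -/P.
have H1 : B * e1 * P * P = e / 3.
  by rewrite /e1; field; rewrite !gt_eqF.
have H2 : K * P * P <= e / 3.
  rewrite /K (_ : _ * P * P = 4 * B ^+ 2 * P ^+ 2 / (M%:R * m)); last by ring.
  by rewrite ler_pdivrMr ?mulr_gt0//; move: ME; lra.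
have H3 : 2 * B ^+ 2 * P * \int[mu]_(t in `[a, b]) chi t <= e / 3.
  apply: (le_trans (y := 2 * B ^+ 2 * P * (2 * E * d))).
    by apply: ler_wpM2l; [exact: mulr_ge0 BB (ltW P0)|exact: exp_cutoff].
  move: dE; rewrite ler_pdivlMr ?mulr_gt0 ?exprn_gt0//.
  by lra.
lra.
Qed.

End Fejer.

Section EsumSeq.
Context {R : realType} {T : choiceType}.

Lemma esum_ge_seq (u : T -> R) (s : seq T) : uniq s ->
  ((\sum_(i <- s) u i)%:E <= \esum_(i in [set: T]) (u i)%:E)%E.
Proof.
move=> us; apply: esum_ge; exists [set` s]; first by split.
by rewrite -fsbig_seq// sumEFin.
Qed.

Lemma esum_le_seq (u : T -> R) (c : R) :
  (forall s : seq T, uniq s -> \sum_(i <- s) u i <= c) ->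
  (\esum_(i in [set: T]) (u i)%:E <= c%:E)%E.
Proof.
move=> H; apply: ub_ereal_sup => _ [X [finX _] <-].
by rewrite fsbig_finite//= sumEFin lee_fin; exact: H.
Qed.

End EsumSeq.

Section Parseval.
Context {R : realType}.
Notation mu := (@lebesgue_measure R).

(** Bessel gives one inequality. For the other, [fejer_approx] bounds the energy by a Cesaro mean;
    for each fixed [j] the integers [j - k] are distinct, so the inner sum is at most the full sum
    [T], and so is the average over [j < M]. *)
Theorem Parseval (a b : R) (f g : R -> R) : a < b -> continuous f -> continuous g ->
  (\esum_(n in [set: int]) (FTr a b f g (n%:~R / (b - a)) ^+ 2
                         + FTi a b f g (n%:~R / (b - a)) ^+ 2)%:E =
  ((b - a) * \int[mu]_(t in `[a, b]) (f t ^+ 2 + g t ^+ 2))%:E)%E.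
Proof.
move=> ab cf cg.
set u := fun n : int => FTr a b f g (n%:~R / (b - a)) ^+ 2
                         + FTi a b f g (n%:~R / (b - a)) ^+ 2.
have u0 n : 0 <= u n by rewrite addr_ge0// sqr_ge0.
have ub : (\esum_(n in [set: int]) (u n)%:E <=
          ((b - a) * \int[mu]_(t in `[a, b]) (f t ^+ 2 + g t ^+ 2))%:E)%E.
  by apply: esum_le_seq => s us; exact: Bessel.
have fin : \esum_(n in [set: int]) (u n)%:E \is a fin_num.
  rewrite ge0_fin_numE; first exact: le_lt_trans ub (ltry _).
  by apply: esum_ge0 => n _; rewrite lee_fin.
apply/eqP; rewrite eq_le ub/=.
set T := fine (\esum_(n in [set: int]) (u n)%:E).
have TE : \esum_(n in [set: int]) (u n)%:E = T%:E by rewrite fineK.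
rewrite TE lee_fin; apply/ler_addgt0Pr => e e0.
have e20 : 0 < e / 2 by rewrite divr_gt0.
have [M1 H1] := fejer_approx a b f _ ab cf e20.
have [M2 H2] := fejer_approx a b g _ ab cg e20.
pose M := (maxn M1 M2).+1.
have {}H1 := H1 M (leq_maxl M1 M2); have {}H2 := H2 M (leq_maxr M1 M2).
have M0 : (0 : R) < M%:R by rewrite ltr0n.
rewrite cintD; [|by ctn|by ctn].
rewrite mulrDr; apply: (le_trans (lerD H1 H2)).
have -> (x y z : R) : x + z / 2 + (y + z / 2) = x + y + z by field.
rewrite lerD2r -mulrDr mulrC ler_pdivrMr// -big_split/=.
under eq_bigr do rewrite -big_split/=.
pose C1 n := \int[mu]_(s in `[a, b]) (f s * cos (2 * pi * (n%:~R / (b - a)) * s)).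
pose S1 n := \int[mu]_(s in `[a, b]) (f s * sin (2 * pi * (n%:~R / (b - a)) * s)).
pose C2 n := \int[mu]_(s in `[a, b]) (g s * cos (2 * pi * (n%:~R / (b - a)) * s)).
pose S2 n := \int[mu]_(s in `[a, b]) (g s * sin (2 * pi * (n%:~R / (b - a)) * s)).
have CN (h : R -> R) (n : int) :
    \int[mu]_(s in `[a, b]) (h s * cos (2 * pi * ((- n)%:~R / (b - a)) * s)) =
    \int[mu]_(s in `[a, b]) (h s * cos (2 * pi * (n%:~R / (b - a)) * s)).
  apply: cint_eq => t _; congr (_ * _).
  by rewrite rmorphN/= mulNr mulrN mulNr cosN.
have SN (h : R -> R) (n : int) : continuous h ->
    \int[mu]_(s in `[a, b]) (h s * sin (2 * pi * ((- n)%:~R / (b - a)) * s)) =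
    - \int[mu]_(s in `[a, b]) (h s * sin (2 * pi * (n%:~R / (b - a)) * s)).
  move=> ch; rewrite -cintN; last by ctn.
  apply: cint_eq => t _; rewrite -mulrN; congr (_ * _).
  by rewrite rmorphN/= mulNr mulrN mulNr sinN.
have uE n : u n = (C1 n ^+ 2 + S1 n ^+ 2 + (C2 n ^+ 2 + S2 n ^+ 2)) +
                  2 * (S1 n * C2 n - C1 n * S2 n).
  rewrite /u /FTr /FTi cintB; [|by ctn|by ctn].
  rewrite cintD; [|by ctn|by ctn].
  rewrite -/(C1 n) -/(S1 n) -/(C2 n) -/(S2 n).
  move: (C1 n) (C2 n) (S1 n) (S2 n) => c1 c2 s1 s2; ring.
(* The squared modulus of the complex coefficient exceeds the sum of the four real squares by [w],
   which is odd in [n] and so cancels in the sum over all [j] and [k]. *)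
pose w n := 2 * (S1 n * C2 n - C1 n * S2 n).
have wN n : w (- n) = - w n.
  rewrite /w /C1 /S1 /C2 /S2 !CN !SN//.
  rewrite -/(C1 n) -/(S1 n) -/(C2 n) -/(S2 n).
  move: (C1 n) (C2 n) (S1 n) (S2 n) => c1 c2 s1 s2; ring.
have w0 : \sum_(j < M) \sum_(k < M) w (j%:Z - k%:Z) = 0.
  apply/eqP; rewrite -[_ == 0](mulrn_eq0 _ 2) mulr2n {1}exchange_big/= -big_split/=.
  apply/eqP; apply: big1 => j _; rewrite -big_split/=; apply: big1 => k _.
  by rewrite -(opprB j%:Z) wN addNr.
rewrite -[leLHS]addr0 -[X in _ + X <= _]w0 -big_split/=.
have -> : T * M%:R = \sum_(j < M) T by rewrite sumr_const card_ord mulr_natr.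
apply: ler_sum => j _; rewrite -big_split/=.
rewrite (eq_bigr (fun k : 'I_M => u (j%:Z - k%:Z))) => [|k _]; last by rewrite uE.
rewrite -(big_map (fun k : 'I_M => j%:Z - k%:Z) xpredT u).
rewrite -lee_fin -TE; apply: esum_ge_seq.
rewrite map_inj_uniq ?index_enum_uniq// => k l /eqP.
by rewrite (inj_eq (addrI _)) eqr_opp => /eqP[] /val_inj.
Qed.

End Parseval.

(** * Sums over the integers, translations and folding of the line *)

Section IntSums.
Context {R : realType}.
Local Open Scope ereal_scope.

Lemma bij_nat_int : exists e : nat -> int, set_bij [set: nat] [set: int] e.
Proof.
exists (fun n => if odd n then Negz n./2 else Posz n./2); split => //.
- move=> m n _ _ H; rewrite -(odd_double_half n) -(odd_double_half m); move: H.
  by case: (odd m); case: (odd n) => // -[->].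
- move=> [n|n] _; [exists n.*2 => //|exists n.*2.+1 => //=].
    by rewrite odd_double doubleK.
  by rewrite odd_double/= uphalf_double.
Qed.

Lemma integral_esum_int d (T : measurableType d) (mu : {measure set T -> \bar R})
    (D : set T) (f : int -> T -> \bar R) :
  measurable D -> (forall n, measurable_fun D (f n)) ->
  (forall n x, 0 <= f n x) ->
  \int[mu]_(x in D) (\esum_(n in [set: int]) f n x) =
  \esum_(n in [set: int]) \int[mu]_(x in D) f n x.
Proof.
move=> mD mf f0; have [e ebij] := bij_nat_int.
under eq_integral => x _ do rewrite (reindex_esum _ _ _ _ ebij) -nneseries_esumT//.
rewrite (reindex_esum _ _ _ _ ebij) -nneseries_esumT.
  by rewrite integral_nneseries.
by move=> n; exact: integral_ge0.
Qed.

End IntSums.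

Section Translation.
Context {R : realType}.
Notation mu := (@lebesgue_measure R).
Local Open Scope ereal_scope.

Definition shiftr (c : R) : measurableTypeR R -> measurableTypeR R :=
  fun x => (x + c)%R.

Lemma measurable_shiftr (c : R) : measurable_fun [set: measurableTypeR R] (shiftr c).
Proof. by apply: measurable_funD => //; exact: measurable_id. Qed.

HB.instance Definition _ (c : R) :=
  isMeasurableFun.Build _ _ _ _ (shiftr c) (measurable_shiftr c).

(** Translation preserves the length of half-open intervals, and these determine Lebesgue
    measure. *)
Lemma lebesgue_measure_shift (c : R) (A : set R) : measurable A ->
  pushforward mu (shiftr c) A = mu A.
Proof.
move=> mA; apply/esym/lebesgue_measure_unique => //= _ [[a b]] _ <-.
rewrite /pushforward /shiftr.
have -> : ((fun x : R => (x + c)%R) @^-1` `]a, b]) = `](a - c)%R, (b - c)%R]%classic.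
  by apply/seteqP; split => x /=; rewrite !in_itv/= ltrBlDr lerBrDr.
rewrite !lebesgue_measure_itv/= !lte_fin ltrD2r.
by case: ifPn => // _; rewrite -!EFinB; congr EFin; ring.
Qed.

Lemma ge0_integral_shift_set (c : R) (D : set R) (f : R -> \bar R) :
  measurable D -> measurable_fun D f -> (forall x, 0 <= f x) ->
  \int[mu]_(x in [set x | D (x + c)%R]) f (x + c)%R = \int[mu]_(x in D) f x.
Proof.
move=> mD mf f0.
rewrite -[LHS](ge0_integral_pushforward (measurable_shiftr c) mu mD mf)//.
apply: eq_measure_integral => A mA _; exact: lebesgue_measure_shift.
Qed.

Lemma ge0_integral_shift (c : R) (f : R -> \bar R) :
  measurable_fun setT f -> (forall x, 0 <= f x) ->
  \int[mu]_x f (x + c)%R = \int[mu]_x f x.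
Proof.
move=> mf f0; rewrite -[RHS](ge0_integral_shift_set c)//.
Qed.

(** The translates of [[0, b[] by multiples of [b] tile the line. The tile of [x] is read off the
    floor of [x / b], which yields disjointness and covering together. *)
Lemma integral_fold (b : R) (f : R -> \bar R) : (0 < b)%R ->
  measurable_fun setT f -> (forall x, 0 <= f x) ->
  \esum_(n in [set: int]) (\int[mu]_(x in `[0%R, b[) f (x - b * n%:~R)%R) =
  \int[mu]_x f x.
Proof.
move=> b0 mf f0; have [e ebij] := bij_nat_int.
have [_ einj esurj] := ebij.
rewrite (reindex_esum _ _ _ _ ebij) -nneseries_esumT; last by move=> n; exact: integral_ge0.
pose F k : set R := [set x | 0 <= x + b * (e k)%:~R < b]%R.
have FE k : F k = `[(- (b * (e k)%:~R))%R, (b - b * (e k)%:~R)%R[%classic.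
  apply/seteqP; split => x /=; rewrite /F/= in_itv/= => /andP[h1 h2]; apply/andP; split; lra.
have Ffl k x : F k x -> e k = (- Num.floor (x / b))%R.
  move=> /andP[h1 h2]; apply/eqP; rewrite -eqr_oppLR eq_sym; apply/eqP.
  apply: floor_def; rewrite rmorphD/= rmorphN/= ler_pdivlMr// ltr_pdivrMr//.
  by apply/andP; split; lra.
have -> : [set: R] = \bigcup_k F k.
  apply/seteqP; split => // x _.
  have [k _ ek] := esurj (- Num.floor (x / b))%R I.
  exists k => //; rewrite /F/= ek rmorphN/=.
  have := real_floor_le (num_real (x / b)); have := real_floorD1_gt (num_real (x / b)).
  rewrite rmorphD/= ler_pdivlMr// ltr_pdivrMr//.
  by move=> h1 h2; apply/andP; split; lra.
rewrite ge0_integral_bigcup//.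
- apply: eq_eseriesr => k _; rewrite -[RHS](ge0_integral_shift_set (- (b * (e k)%:~R))%R)//.
  + have <- // : `[0%R, b[%classic = [set x | F k (x - b * (e k)%:~R)%R].
    by apply/seteqP; split => x /=; rewrite /F/= in_itv/= subrK.
  + by rewrite FE.
  + exact: measurable_funTS.
- by move=> k; rewrite FE.
- exact: measurable_funTS.
- apply/trivIsetP => i j _ _ ij; apply/seteqP; split => // x [/Ffl + /Ffl] => <-.
  by move=> /einj; rewrite !inE => /(_ I I) ji; rewrite ji eqxx in ij.
Qed.

End Translation.

Lemma measurable_EFin_fun {R : realType} (D : set R) (f : R -> R) :
  measurable_fun D f -> measurable_fun D (fun x => (f x)%:E).
Proof. by move=> mf; exact/measurable_EFinP. Qed.

(** * Inequalities with geometric decay *)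

Section Decay.
Context {R : realType}.
Notation mu := (@lebesgue_measure R).
Implicit Types (e r : R -> R) (p q B : R).

Lemma decay_iter e r p q B : 0 <= q -> (forall x, e x <= B) ->
  (forall x, e x <= q * e (x + p) + r x) ->
  forall K x, e x <= \sum_(k < K) q ^+ k * r (x + p * k%:R) + q ^+ K * B.
Proof.
move=> q0 eB er; elim=> [|K IH] x; first by rewrite big_ord0 expr0 mul1r add0r.
rewrite big_ord_recl/= expr0 mul1r mulr0 addr0.
apply: (le_trans (er x)); rewrite addrC -addrA lerD2l.
apply: (le_trans (ler_wpM2l q0 (IH (x + p)))).
rewrite mulrDr mulrA -exprS lerD2r mulr_sumr.
rewrite le_eqVlt; apply/orP; left; apply/eqP; apply: eq_bigr => k _.
rewrite mulrA -exprS /bump/= add1n; congr (_ * r _).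
by rewrite -natr1; ring.
Qed.

(** Integrating the inequality as it stands would require the integral of [e] to be finite, which is
    not known where this is applied. The bound [B] makes the remainder of the iteration vanish
    pointwise instead; all shifts of [r] have the same integral, and the geometric series gives
    [(1 - q)^-1]. *)
Lemma decay_integral e r p q B : 0 <= q -> q < 1 ->
  (forall x, 0 <= e x <= B) -> (forall x, 0 <= r x) ->
  measurable_fun setT e -> measurable_fun setT r ->
  (forall x, e x <= q * e (x + p) + r x) ->
  (\int[mu]_x (e x)%:E <= ((1 - q)^-1)%:E * \int[mu]_x (r x)%:E)%E.
Proof.
move=> q0 q1 eB r0 me mr er.
have e0 x : 0 <= e x by case/andP: (eB x).
have eB' x : e x <= B by case/andP: (eB x).
pose u k x := q ^+ k * r (x + p * k%:R).
have u0 k x : 0 <= u k x by rewrite mulr_ge0// exprn_ge0.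
have mrk (k : nat) : measurable_fun setT (fun x : R => r (x + p * k%:R)).
  exact: (measurableT_comp mr (measurable_shiftr (p * k%:R))).
have mu_ k : measurable_fun setT (u k) by apply: measurable_funM.
have ptw x : ((e x)%:E <= \sum_(k <oo) (u k x)%:E)%E.
  apply/lee_addgt0Pr => d d0.
  have [K KB] : exists K, q ^+ K * B < d.
    have B0 : 0 <= B by exact: le_trans (e0 x) (eB' x).
    have q1' : `|q| < 1 by rewrite ger0_norm.
    (* [B + 1] rather than [B], which may be [0]. *)
    have dB : 0 < d / (B + 1) by rewrite divr_gt0// ltr_pwDr.
    have /cvgrPdist_lt/(_ _ dB)[K _ HK] := cvg_expr q1'.
    exists K; have /= := HK K (leqnn K).
    rewrite sub0r normrN ger0_norm ?exprn_ge0// => H.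
    apply: (@le_lt_trans _ _ (q ^+ K * (B + 1))).
      by rewrite ler_wpM2l ?exprn_ge0// lerDl.
    by rewrite -ltr_pdivlMr// ltr_pwDr.
  apply: (@le_trans _ _ (\sum_(0 <= k < K) (u k x)%:E + d%:E)%E); last first.
    by apply: leeD2r; apply: nneseries_lim_ge => k _ _; rewrite lee_fin.
  rewrite sumEFin -EFinD lee_fin big_mkord.
  by apply: (le_trans (decay_iter e r p q B q0 eB' er K x)); rewrite lerD2l ltW.
apply: (@le_trans _ _ (\int[mu]_x \sum_(k <oo) (u k x)%:E)%E).
  apply: ge0_le_integral => //.
  - by move=> x _; rewrite lee_fin.
  - exact/measurable_EFinP.
  - apply: ge0_emeasurable_sum => [k x _ _|k _]; first by rewrite lee_fin.
    exact: measurable_EFin_fun (mu_ k).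
rewrite integral_nneseries//; last first.
- by move=> k x _; rewrite lee_fin.
- by move=> k; exact: measurable_EFin_fun (mu_ k).
have Ek k : (\int[mu]_x (u k x)%:E = (q ^+ k)%:E * \int[mu]_x (r x)%:E)%E.
  rewrite /u; under eq_integral do rewrite EFinM.
  rewrite ge0_integralZl_EFin//.
  - rewrite (ge0_integral_shift (p * k%:R) (fun x => (r x)%:E))//.
    exact: measurable_EFin_fun.
  - by move=> x _; rewrite lee_fin.
  - exact: measurable_EFin_fun (mrk k).
  - exact: exprn_ge0.
have I0 : (0 <= \int[mu]_x (r x)%:E)%E by apply: integral_ge0 => x _; rewrite lee_fin.
apply: lime_le.
  by apply: is_cvg_nneseries => k _ _; apply: integral_ge0 => x _; rewrite lee_fin.
near=> K.
rewrite (eq_bigr (fun k => (q ^+ k)%:E * \int[mu]_x (r x)%:E)%E) => [|k _]; last exact: Ek.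
rewrite -ge0_sume_distrl; last by move=> k _; rewrite lee_fin exprn_ge0.
rewrite lee_wpmul2r// sumEFin lee_fin big_mkord.
have H := subrX1 q K.
rewrite -[(1 - q)^-1]mul1r ler_pdivlMr ?subr_gt0// mulrC.
have -> : (1 - q) * \sum_(k < K) q ^+ k = 1 - q ^+ K.
  by rewrite -opprB mulNr -H opprB.
by rewrite gerBl exprn_ge0.
Unshelve. all: by end_near. Qed.

End Decay.

(** * Plancherel's identity on a segment *)

Section Plancherel.
Context {R : realType}.
Notation mu := (@lebesgue_measure R).

Lemma continuous_cint_param (a b : R) (F : R -> R -> R) (B : R) :
  (forall z, continuous (F z)) -> (forall t, continuous (F^~ t)) ->
  (forall z t, a <= t <= b -> `|F z t| <= B) ->
  continuous (fun z => \int[mu]_(t in `[a, b]) F z t).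
Proof.
move=> cF cFt FB z.
have zI : z \in `]z - 1, z + 1[%classic by rewrite inE/= in_itv/=; apply/andP; split; lra.
apply: (@continuity_under_integral R _ _ mu F `[a, b] _ (z - 1) (z + 1) _ _ (fun=> B) _ _ z zI) => //.
- by move=> x _; exact: continuous_integrable.
- by apply: aeW => t _ x _; exact: cFt.
- by apply: continuous_integrable; ctn.
- by move=> x _; apply: aeW => t /=; rewrite in_itv/=; exact: FB.
Qed.

Variables (a b : R) (f g : R -> R).
Hypotheses (cf : continuous f) (cg : continuous g).

Let bnd : exists2 B, 0 <= B & forall t, a <= t <= b -> `|f t| + `|g t| <= B.
Proof.
have [B1 B10 H1] := continuous_bounded_segment a b f cf.
have [B2 B20 H2] := continuous_bounded_segment a b g cg.
exists (B1 + B2); first by rewrite addr_ge0// ltW.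
by move=> t tab; rewrite lerD// ?H1 ?H2.
Qed.

Let bound1 (x y u v : R) : `|u| <= 1 -> `|v| <= 1 -> `|x * u + y * v| <= `|x| + `|y|.
Proof.
move=> u1 v1; rewrite (le_trans (ler_normD _ _))// !normrM lerD// ler_piMr//.
Qed.

Let ncos (x : R) : `|cos x| <= 1.
Proof. by rewrite ler_norml cos_geN1 cos_le1. Qed.

Let nsin (x : R) : `|sin x| <= 1.
Proof. by rewrite ler_norml sin_geN1 sin_le1. Qed.

Lemma continuous_FTr : continuous (FTr a b f g).
Proof.
have [B B0 HB] := bnd.
apply: (continuous_cint_param _ _ _ B).
- by move=> z; ctn.
- by move=> t; ctn.
- move=> z t tab; rewrite -mulrN (le_trans _ (HB t tab))//.
  by apply: bound1; rewrite ?normrN.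
Qed.

Lemma continuous_FTi : continuous (FTi a b f g).
Proof.
have [B B0 HB] := bnd.
apply: (continuous_cint_param _ _ _ B).
- by move=> z; ctn.
- by move=> t; ctn.
- by move=> z t tab; rewrite (le_trans _ (HB t tab))//; apply: bound1.
Qed.

Lemma FT_bounded : exists2 B, 0 <= B &
  forall z, `|FTr a b f g z| <= B /\ `|FTi a b f g z| <= B.
Proof.
have [B B0 HB] := bnd.
have cB : continuous (fun _ : R => B) by ctn.
exists (\int[mu]_(t in `[a, b]) B).
  by apply: cint_ge0.
move=> z; split.
- apply: (le_trans (cint_norm _ _ _ _)); first by ctn.
  apply: cint_le => //; first by ctn.
  move=> t tab; rewrite -mulrN (le_trans _ (HB t tab))//.
  by apply: bound1; rewrite ?normrN.
- apply: (le_trans (cint_norm _ _ _ _)); first by ctn.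
  apply: cint_le => //; first by ctn.
  by move=> t tab; rewrite (le_trans _ (HB t tab))//; apply: bound1.
Qed.

Lemma FT_modulation (z x : R) :
  FTr a b f g (z + x) =
    FTr a b (fun t => f t * cos (2 * pi * x * t) - g t * sin (2 * pi * x * t))
            (fun t => f t * sin (2 * pi * x * t) + g t * cos (2 * pi * x * t)) z /\
  FTi a b f g (z + x) =
    FTi a b (fun t => f t * cos (2 * pi * x * t) - g t * sin (2 * pi * x * t))
            (fun t => f t * sin (2 * pi * x * t) + g t * cos (2 * pi * x * t)) z.
Proof.
have E t : 2 * pi * (z + x) * t = 2 * pi * z * t + 2 * pi * x * t by ring.
by split; apply: cint_eq => t _; rewrite E cosD sinD; tring.
Qed.

(** The values of the transform at the points [x + n / (b - a)] are the Fourier coefficients of the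
    function modulated by [x], whose modulus is unchanged. Parseval thus gives a sum independent of
    [x], and folding turns the integral over the line into the integral of this sum over an interval
    of length [1 / (b - a)]. *)
Theorem Plancherel : a < b ->
  (\int[mu]_z (FTr a b f g z ^+ 2 + FTi a b f g z ^+ 2)%:E =
   (\int[mu]_(t in `[a, b]) (f t ^+ 2 + g t ^+ 2))%:E)%E.
Proof.
move=> ab; have P0 : 0 < b - a by rewrite subr_gt0.
have cr := continuous_FTr; have ci := continuous_FTi.
pose U z := FTr a b f g z ^+ 2 + FTi a b f g z ^+ 2.
have cU : continuous U by rewrite /U; ctn.
have U0 z : 0 <= U z by rewrite addr_ge0// sqr_ge0.
have mU : measurable_fun setT (fun z => (U z)%:E).
  by apply/measurable_EFinP; exact: continuous_measurable_fun.
have iP0 : 0 < (b - a)^-1 by rewrite invr_gt0.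
rewrite -(integral_fold (b - a)^-1 (fun z => (U z)%:E))//.
rewrite -integral_esum_int//; last 2 first.
- move=> n; apply/measurable_EFinP; apply: measurable_funTS.
  apply: continuous_measurable_fun.
  by apply: (continuous_compf (fun z => z - (b - a)^-1 * n%:~R) U) => //; ctn.
- by move=> n x; rewrite lee_fin.
set I := \int[mu]_(t in _) _.
transitivity (\int[mu]_(x in `[0%R, (b - a)^-1%R[) ((b - a) * I)%R%:E)%E; last first.
  rewrite integral_cst//= lebesgue_measure_itv/= lte_fin iP0 -EFinD -EFinM subr0.
  by congr EFin; field; rewrite gt_eqF.
apply: eq_integral => x _.
rewrite (reindex_esum setT setT (fun n : int => - n)%R); last first.
  split; [by []|by move=> m n _ _; exact: oppr_inj|].
  by move=> n _; exists (- n)%R => //; rewrite opprK.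
pose fx t := f t * cos (2 * pi * x * t) - g t * sin (2 * pi * x * t).
pose gx t := f t * sin (2 * pi * x * t) + g t * cos (2 * pi * x * t).
have cfx : continuous fx by rewrite /fx; ctn.
have cgx : continuous gx by rewrite /gx; ctn.
have -> : I = \int[mu]_(t in `[a, b]) (fx t ^+ 2 + gx t ^+ 2).
  apply: cint_eq => t _; rewrite /fx /gx.
  set th := 2 * pi * x * t.
  transitivity ((f t ^+ 2 + g t ^+ 2) * (cos th ^+ 2 + sin th ^+ 2)).
    by rewrite cos2Dsin2 mulr1.
  by tring.
rewrite -Parseval//; apply: eq_esum => n _; congr EFin.
rewrite /U; have -> : x - (b - a)^-1 * (- n)%:~R = n%:~R / (b - a) + x.
  by rewrite rmorphN/=; ring.
by have [-> ->] := FT_modulation (n%:~R / (b - a)) x.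
Qed.

End Plancherel.

Section MeasurableReal.
Context {R : realType} {d : measure_display} {T : measurableType d}.
Implicit Types h k : T -> R.

Lemma measurable_mulf h k : measurable_fun setT h -> measurable_fun setT k ->
  measurable_fun setT (fun x => h x * k x).
Proof. exact: measurable_funM. Qed.

Lemma measurable_addf h k : measurable_fun setT h -> measurable_fun setT k ->
  measurable_fun setT (fun x => h x + k x).
Proof. exact: measurable_funD. Qed.

Lemma measurable_compf h (c : R -> R) : continuous c ->
  measurable_fun setT h -> measurable_fun setT (fun x => c (h x)).
Proof. by move=> cc mh; apply: (measurableT_comp (continuous_measurable_fun cc)). Qed.

Lemma measurable_oppf h : measurable_fun setT h -> measurable_fun setT (fun x => - h x).
Proof. by apply: (measurable_compf h -%R); exact: opp_continuous. Qed.

Lemma measurable_expf h n : measurable_fun setT h -> measurable_fun setT (fun x => h x ^+ n).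
Proof. exact: measurable_funX. Qed.

Lemma measurable_sumf (I : Type) (r : seq I) (F : I -> T -> R) :
  (forall i, measurable_fun setT (F i)) ->
  measurable_fun setT (fun x => \sum_(i <- r) F i x).
Proof. by move=> mF; exact: measurable_sum. Qed.

Lemma measurable_cstf (c : R) : measurable_fun [set: T] (fun _ => c).
Proof. exact: measurable_cst. Qed.

Lemma measurable_cosf h : measurable_fun setT h -> measurable_fun setT (fun x => cos (h x)).
Proof. exact/measurable_compf/continuous_cos. Qed.

Lemma measurable_sinf h : measurable_fun setT h -> measurable_fun setT (fun x => sin (h x)).
Proof. exact/measurable_compf/continuous_sin. Qed.

Lemma measurable_expRf h : measurable_fun setT h -> measurable_fun setT (fun x => expR (h x)).
Proof. exact/measurable_compf/continuous_expR. Qed.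

End MeasurableReal.

Ltac mtn := lazymatch goal with
  | |- measurable_fun _ (fun _ => ?c) => exact: measurable_cstf
  | |- measurable_fun _ (fun x => x) => exact: measurable_id
  | |- measurable_fun _ (fun x => x.1) => exact: measurable_fst
  | |- measurable_fun _ (fun x => x.2) => exact: measurable_snd
  | |- measurable_fun _ (fun x => (@?h x + @?k x)%R) => apply: (measurable_addf h k); mtn
  | |- measurable_fun _ (fun x => (- @?h x)%R) => apply: (measurable_oppf h); mtn
  | |- measurable_fun _ (fun x => (@?h x * @?k x)%R) => apply: (measurable_mulf h k); mtn
  | |- measurable_fun _ (fun x => (@?h x ^+ ?n)%R) => apply: (measurable_expf h n); mtn
  | |- measurable_fun _ (fun x => cos (@?h x)) => apply: (measurable_cosf h); mtn
  | |- measurable_fun _ (fun x => sin (@?h x)) => apply: (measurable_sinf h); mtn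
  | |- measurable_fun _ (fun x => expR (@?h x)) => apply: (measurable_expRf h); mtn
  | |- measurable_fun _ (fun x => bigop.body _ _ _) => apply: measurable_sumf => ?; mtn
  | H : measurable_fun _ ?f |- measurable_fun _ ?f => exact: H
  | H : measurable_fun _ ?f |- measurable_fun _ (fun x => ?f x) => exact: H
  | H : forall i, measurable_fun _ (?f i) |- measurable_fun _ (?f _) => exact: H
  | H : forall i, measurable_fun _ (?f i) |- measurable_fun _ (fun x => ?f _ x) => exact: H
  | H : continuous ?c |- measurable_fun _ (fun x => ?c (@?h x)) => apply: (measurable_compf h c H); mtn
  | |- measurable_fun _ _ => solve [eauto 2]
  end.

Section Swap.
Context {R : realType}.
Notation mu := (@lebesgue_measure R).

Lemma cint_swap (a b c d : R) (K : R -> R -> R) (B : R) : a <= b -> c <= d ->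
  measurable_fun setT (fun xt : measurableTypeR R * measurableTypeR R => K xt.1 xt.2) ->
  (forall x t, c <= x <= d -> a <= t <= b -> `|K x t| <= B) ->
  \int[mu]_(x in `[c, d]) (\int[mu]_(t in `[a, b]) K x t) =
  \int[mu]_(t in `[a, b]) (\int[mu]_(x in `[c, d]) K x t).
Proof.
move=> ab cd mK KB.
have mKx x : measurable_fun setT (K x).
  exact: (measurableT_comp mK (measurable_pair1 x)).
have mKt t : measurable_fun setT (K^~ t).
  exact: (measurableT_comp mK (measurable_pair2 t)).
have mab : measurable (`[a, b]%classic : set (measurableTypeR R)) by [].
have mcd : measurable (`[c, d]%classic : set (measurableTypeR R)) by [].
pose A : set (measurableTypeR R * measurableTypeR R) := `[c, d]%classic `*` `[a, b]%classic.
have mA : measurable A by exact: measurableX.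
pose k (xt : measurableTypeR R * measurableTypeR R) : R := K xt.1 xt.2.
have intA : (mu \x mu)%E.-integrable A (EFin \o k).
  apply: measurable_bounded_integrable => //.
  - rewrite [ltLHS]product_measure1E//= !lebesgue_measure_itv/= !lte_fin.
    by case: ifP; case: ifP; rewrite -?EFinB ?mul0e ?mule0 -?EFinM ?ltry.
  - exact: measurable_funTS.
  - exists B; split; first exact: num_real.
    move=> y By [x t] [/= xcd tab]; apply: le_trans (ltW By).
    by rewrite /k/=; apply: KB; [move: xcd|move: tab]; rewrite in_itv.
rewrite integrable_mkcond// in intA.
have := Fubini intA.
have E1 x : (\int[mu]_y ((EFin \o k) \_ A) (x, y) =
   (((fun x => \int[mu]_(t in `[a, b]) (K x t)%:E) \_ `[c, d]) x))%E.
  rewrite /patch; case: ifPn => [xcd|xcd].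
    rewrite [RHS]integral_mkcond; apply: eq_integral => y _.
    by rewrite /patch /A in_setX xcd.
  rewrite (eq_integral (cst 0%E)) ?integral0// => y _.
  by rewrite /A in_setX (negbTE xcd).
have E2 y : (\int[mu]_x ((EFin \o k) \_ A) (x, y) =
   (((fun y => \int[mu]_(x in `[c, d]) (K x y)%:E) \_ `[a, b]) y))%E.
  rewrite /patch; case: ifPn => [yab|yab].
    rewrite [RHS]integral_mkcond; apply: eq_integral => x _.
    by rewrite /patch /A in_setX yab andbT.
  rewrite (eq_integral (cst 0%E)) ?integral0// => x _.
  by rewrite /A in_setX (negbTE yab) andbF.
under eq_integral do rewrite E1.
under [X in _ = X -> _]eq_integral do rewrite E2.
rewrite -!integral_mkcond => E; rewrite /Rintegral.
have fin1 x : c <= x <= d -> (\int[mu]_(t in `[a, b]) (K x t)%:E)%E \is a fin_num.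
  move=> xcd; apply: integrable_fin_num => //.
  apply: measurable_bounded_integrable => //.
  - by rewrite [ltLHS]lebesgue_measure_itv/= lte_fin; case: ifP; rewrite -?EFinB ltry.
  - exact: measurable_funTS (mKx x).
  - exists B; split; first exact: num_real.
    move=> y By t /= tab; apply: le_trans (ltW By); apply: KB => //.
have fin2 t : a <= t <= b -> (\int[mu]_(x in `[c, d]) (K x t)%:E)%E \is a fin_num.
  move=> tab; apply: integrable_fin_num => //.
  apply: measurable_bounded_integrable => //.
  - by rewrite [ltLHS]lebesgue_measure_itv/= lte_fin; case: ifP; rewrite -?EFinB ltry.
  - exact: measurable_funTS (mKt t).
  - exists B; split; first exact: num_real.
    move=> y By x /= xcd; apply: le_trans (ltW By); apply: KB => //.
congr fine.
transitivity (\int[mu]_(x in `[c, d]) (\int[mu]_(t in `[a, b]) (K x t)%:E))%E.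
  by apply: eq_integral => x; rewrite inE/= in_itv/= => xcd; rewrite fineK ?fin1.
rewrite E; apply: eq_integral => t; rewrite inE/= in_itv/= => tab.
by rewrite fineK ?fin2.
Qed.

End Swap.

(** * Gabor coefficients as Fourier coefficients *)

Section Resolvent.
Context {R : realType}.
Notation mu := (@lebesgue_measure R).
Variables (om p : R).
Hypotheses (om0 : 0 < om) (p0 : 0 < p).

(** The squared modulus of [1 - q e^(2 i pi p t)] with [q = e^(- om p) < 1], hence never zero. *)
Definition resD (t : R) : R :=
  (1 - expR (- (om * p)) * cos (2 * pi * p * t)) ^+ 2
  + (expR (- (om * p)) * sin (2 * pi * p * t)) ^+ 2.

Lemma resq_lt1 : expR (- (om * p)) < 1.
Proof. by rewrite expR_lt1 oppr_lt0 mulr_gt0. Qed.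

Lemma resD_gt0 t : 0 < resD t.
Proof.
have q0 := expR_gt0 (- (om * p)); have q1 := resq_lt1.
have c1 : cos (2 * pi * p * t) <= 1 := cos_le1 _.
rewrite /resD ltr_pwDl ?sqr_ge0// exprn_gt0// subr_gt0.
apply: le_lt_trans q1; rewrite ler_piMr//; exact: ltW.
Qed.

(* Real and imaginary parts of 1 / (1 - e^(- om p) e^(2 i pi p t)). *)
Definition res1 (t : R) := (1 - expR (- (om * p)) * cos (2 * pi * p * t)) * (resD t)^-1.
Definition res2 (t : R) := (expR (- (om * p)) * sin (2 * pi * p * t)) * (resD t)^-1.

Lemma continuous_resDV : continuous (fun t => (resD t)^-1).
Proof.
apply: continuous_invf; first by move=> t; rewrite gt_eqF ?resD_gt0.
by rewrite /resD; ctn.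
Qed.

Lemma continuous_res1 : continuous res1.
Proof. by have H := continuous_resDV; rewrite /res1; ctn. Qed.

Lemma continuous_res2 : continuous res2.
Proof. by have H := continuous_resDV; rewrite /res2; ctn. Qed.

Variables (a b : R) (f g : R -> R).
Hypotheses (cf : continuous f) (cg : continuous g).

Definition resf t := f t * res1 t - g t * res2 t.
Definition resg t := f t * res2 t + g t * res1 t.

Lemma continuous_resf : continuous resf.
Proof. by have H1 := continuous_res1; have H2 := continuous_res2; rewrite /resf; ctn. Qed.

Lemma continuous_resg : continuous resg.
Proof. by have H1 := continuous_res1; have H2 := continuous_res2; rewrite /resg; ctn. Qed.

Definition uR z := FTr a b resf resg z.
Definition uI z := FTi a b resf resg z.

(** Shifting [z] by [p] multiplies the integrand by [e^(2 i pi p t)]. In [u z - q u (z + p)] the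
    resolvent factor therefore cancels, and the transform of [f + i g] remains. *)
Lemma uR_rec z : uR z = expR (- (om * p)) * uR (z + p) + FTr a b f g z.
Proof.
have c1 := continuous_resf; have c2 := continuous_resg.
rewrite /uR; have [-> _] := FT_modulation a b resf resg z p.
rewrite /FTr -cintZ; last by ctn.
rewrite -cintD; [|by ctn|by ctn].
apply: cint_eq => t _; rewrite /resf /resg /res1 /res2.
have := resD_gt0 t; rewrite /resD.
move: (expR _) (cos (2 * pi * p * t)) (sin (2 * pi * p * t)) (cos _) (sin _) => q c s c' s' D0.
by field; rewrite gt_eqF.
Qed.

Lemma uI_rec z : uI z = expR (- (om * p)) * uI (z + p) + FTi a b f g z.
Proof.
have c1 := continuous_resf; have c2 := continuous_resg.
rewrite /uI; have [_ ->] := FT_modulation a b resf resg z p.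
rewrite /FTi -cintZ; last by ctn.
rewrite -cintD; [|by ctn|by ctn].
apply: cint_eq => t _; rewrite /resf /resg /res1 /res2.
have := resD_gt0 t; rewrite /resD.
move: (expR _) (cos (2 * pi * p * t)) (sin (2 * pi * p * t)) (cos _) (sin _) => q c s c' s' D0.
by field; rewrite gt_eqF.
Qed.

Let lapl (sg : R) : R := om ^+ 2 + sg ^+ 2.

Let lapl_gt0 sg : 0 < lapl sg.
Proof. by rewrite ltr_pwDl ?sqr_ge0// exprn_gt0. Qed.

(** Real part of [(1 - e^(- (om - i sg) p)) / (om - i sg)], the integral of a complex exponential;
    [k] is an explicit antiderivative. *)
Lemma cint_exp_cos (sg : R) :
  \int[mu]_(x in `[0, p]) (expR (- om * x) * cos (sg * x)) =
  (om - expR (- (om * p)) * (om * cos (sg * p) - sg * sin (sg * p))) / (om ^+ 2 + sg ^+ 2).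
Proof.
have D0 := lapl_gt0 sg; rewrite /lapl in D0.
pose k := (fun x => expR (- om * x)) * ((sg / (om ^+ 2 + sg ^+ 2)) \*o (fun x => sin (sg * x))
   - (om / (om ^+ 2 + sg ^+ 2)) \*o (fun x => cos (sg * x))) : R -> R.
have dk x : is_derive x (1 : R) k (expR (- om * x) * cos (sg * x)).
  have H1 := is_derive_expR_mul (- om) x.
  have H2 := is_derive_sin_mul sg x.
  have H3 := is_derive_cos_mul sg x.
  rewrite /k; apply: is_derive_eq => /=.
  rewrite /GRing.scale/= !fctE/=.
  move: (expR _) (cos _) (sin _) => q c s.
  by field; rewrite gt_eqF.
rewrite (cint_FTC _ _ _ k p0 _ dk); last by ctn.
rewrite /k !fctE/= !mulr0 expR0 cos0 sin0 mulNr.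
move: (expR _) (cos _) (sin _) => q c s.
by field; rewrite gt_eqF.
Qed.

Lemma cint_exp_sin (sg : R) :
  \int[mu]_(x in `[0, p]) (expR (- om * x) * sin (sg * x)) =
  (sg - expR (- (om * p)) * (om * sin (sg * p) + sg * cos (sg * p))) / (om ^+ 2 + sg ^+ 2).
Proof.
have D0 := lapl_gt0 sg; rewrite /lapl in D0.
pose k := (fun x => expR (- om * x)) * ((- sg / (om ^+ 2 + sg ^+ 2)) \*o (fun x => cos (sg * x))
   - (om / (om ^+ 2 + sg ^+ 2)) \*o (fun x => sin (sg * x))) : R -> R.
have dk x : is_derive x (1 : R) k (expR (- om * x) * sin (sg * x)).
  have H1 := is_derive_expR_mul (- om) x.
  have H2 := is_derive_sin_mul sg x.
  have H3 := is_derive_cos_mul sg x.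
  rewrite /k; apply: is_derive_eq => /=.
  rewrite /GRing.scale/= !fctE/=.
  move: (expR _) (cos _) (sin _) => q c s.
  by field; rewrite gt_eqF.
rewrite (cint_FTC _ _ _ k p0 _ dk); last by ctn.
rewrite /k !fctE/= !mulr0 expR0 cos0 sin0 mulNr.
move: (expR _) (cos _) (sin _) => q c s.
by field; rewrite gt_eqF.
Qed.

End Resolvent.

Section Coefficients.
Context {R : realType}.
Notation mu := (@lebesgue_measure R).
Variables (om p a b : R) (f g : R -> R).
Hypotheses (om0 : 0 < om) (p0 : 0 < p) (ab : a < b).
Hypotheses (cf : continuous f) (cg : continuous g).
Variables (y : R) (m : int).

Let sg t : R := 2 * pi * (t - m%:~R / p).
Let F := resf om p f g.
Let G := resg om p f g.
Let cF : continuous F. Proof. exact: continuous_resf. Qed.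
Let cG : continuous G. Proof. exact: continuous_resg. Qed.
Let U x := expR (- om * x) * uR om p a b f g (x - y).
Let V x := expR (- om * x) * uI om p a b f g (x - y).

Let K1 x t := expR (- om * x) * (F t * cos (sg t * x - 2 * pi * y * t)
                                - G t * sin (sg t * x - 2 * pi * y * t)).
Let K2 x t := expR (- om * x) * (F t * sin (sg t * x - 2 * pi * y * t)
                                + G t * cos (sg t * x - 2 * pi * y * t)).

Let FG_bound : exists B, forall t, a <= t <= b -> `|F t| + `|G t| <= B.
Proof.
have [B1 B10 H1] := continuous_bounded_segment a b F cF.
have [B2 B20 H2] := continuous_bounded_segment a b G cG.
by exists (B1 + B2) => t tab; rewrite lerD// ?H1 ?H2.
Qed.

Let K_bound (x : R) (A B C c s : R) : 0 <= x -> `|A| + `|B| <= C -> `|c| <= 1 -> `|s| <= 1 ->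
  `|expR (- om * x) * (A * c + B * s)| <= C.
Proof.
move=> x0 AB c1 s1; rewrite normrM ger0_norm ?expR_ge0//.
apply: le_trans AB; rewrite -[leRHS]mul1r ler_pM ?expR_ge0//.
  by rewrite expR_le1 mulNr oppr_le0 mulr_ge0// ltW.
by rewrite (le_trans (ler_normD _ _))// !normrM lerD// ler_piMr//.
Qed.

Let UE1 x : \int[mu]_(t in `[a, b]) K1 x t =
  U x * cos (2 * pi * (- (m%:~R / p)) * x) - V x * sin (2 * pi * (- (m%:~R / p)) * x).
Proof.
set th := 2 * pi * - (m%:~R / p) * x.
rewrite /U /V /uR /uI /FTr /FTi -!mulrA !(mulrC (\int[_]_(_ in _) _)) !mulrA.
rewrite -!cintZ; [|by ctn|by ctn].
rewrite -cintB; [|by ctn|by ctn].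
apply: cint_eq => t _; rewrite /K1 -/F -/G.
have -> : sg t * x - 2 * pi * y * t = 2 * pi * (x - y) * t + th by rewrite /sg /th; ring.
by rewrite cosD sinD; tring.
Qed.

Let UE2 x : \int[mu]_(t in `[a, b]) K2 x t =
  U x * sin (2 * pi * (- (m%:~R / p)) * x) + V x * cos (2 * pi * (- (m%:~R / p)) * x).
Proof.
set th := 2 * pi * - (m%:~R / p) * x.
rewrite /U /V /uR /uI /FTr /FTi -!mulrA !(mulrC (\int[_]_(_ in _) _)) !mulrA.
rewrite -!cintZ; [|by ctn|by ctn].
rewrite -cintD; [|by ctn|by ctn].
apply: cint_eq => t _; rewrite /K2 -/F -/G.
have -> : sg t * x - 2 * pi * y * t = 2 * pi * (x - y) * t + th by rewrite /sg /th; ring.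
by rewrite cosD sinD; tring.
Qed.

Let sgp t : cos (sg t * p) = cos (2 * pi * p * t) /\ sin (sg t * p) = sin (2 * pi * p * t).
Proof.
have -> : sg t * p = 2 * pi * p * t + 2 * pi * (- m)%:~R.
  by rewrite /sg rmorphN/=; field; rewrite gt_eqF.
by rewrite cos_periodz sin_periodz.
Qed.

(** After the integrals are swapped, the inner one is [(1 - q e^(i sg p)) / (om - i sg)]. As
    [sg t p] equals [2 pi p t] up to a multiple of [2 pi], its numerator is the reciprocal of the
    resolvent factor. What is left is [(f + i g) e^(- 2 i pi y t) / (om - i sg)], a simple fraction
    like those of the window. *)
Lemma coefR :
  FTr 0 p U V (- (m%:~R / p)) =
  \int[mu]_(t in `[a, b])
   (((f t * cos (2 * pi * y * t) + g t * sin (2 * pi * y * t)) * om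
   - (g t * cos (2 * pi * y * t) - f t * sin (2 * pi * y * t)) * sg t)
    / (om ^+ 2 + sg t ^+ 2)).
Proof.
have [B HB] := FG_bound.
transitivity (\int[mu]_(x in `[0, p]) (\int[mu]_(t in `[a, b]) K1 x t)).
  by apply: cint_eq => x _; rewrite UE1.
rewrite (cint_swap _ _ _ _ _ B) ?(ltW ab) ?(ltW p0)//; last 2 first.
- by rewrite /K1 /sg; mtn.
- move=> x t /andP[x0 _] tab; rewrite /K1 -(mulrN (G t)).
  by apply: K_bound; rewrite ?normrN ?HB// ler_norml ?cos_geN1 ?cos_le1 ?sin_geN1 ?sin_le1.
apply: cint_eq => t _.
transitivity (\int[mu]_(x in `[0, p])
  ((F t * cos (2 * pi * y * t) + G t * sin (2 * pi * y * t)) * (expR (- om * x) * cos (sg t * x)) +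
   (F t * sin (2 * pi * y * t) - G t * cos (2 * pi * y * t)) * (expR (- om * x) * sin (sg t * x)))).
  by apply: cint_eq => x _; rewrite /K1 cosB sinB; tring.
rewrite cintD; [|by ctn|by ctn].
rewrite !cintZ; [|by ctn|by ctn].
rewrite cint_exp_cos// cint_exp_sin//.
have [-> ->] := sgp t.
rewrite /F /G /resf /resg /res1 /res2.
have := resD_gt0 om p om0 p0 t; rewrite /resD.
have : 0 < om ^+ 2 + sg t ^+ 2 by rewrite ltr_pwDl ?sqr_ge0// exprn_gt0.
move: (expR _) (cos (2 * pi * p * t)) (sin (2 * pi * p * t)) (cos _) (sin _) (sg t).
move=> q c s c' s' r r0 D0.
by field; rewrite !gt_eqF.
Qed.

Lemma coefI :
  FTi 0 p U V (- (m%:~R / p)) =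
  \int[mu]_(t in `[a, b])
   (((f t * cos (2 * pi * y * t) + g t * sin (2 * pi * y * t)) * sg t
   + (g t * cos (2 * pi * y * t) - f t * sin (2 * pi * y * t)) * om)
    / (om ^+ 2 + sg t ^+ 2)).
Proof.
have [B HB] := FG_bound.
transitivity (\int[mu]_(x in `[0, p]) (\int[mu]_(t in `[a, b]) K2 x t)).
  by apply: cint_eq => x _; rewrite UE2.
rewrite (cint_swap _ _ _ _ _ B) ?(ltW ab) ?(ltW p0)//; last 2 first.
- by rewrite /K2 /sg; mtn.
- move=> x t /andP[x0 _] tab; rewrite /K2.
  by apply: K_bound; rewrite ?HB// ler_norml ?cos_geN1 ?cos_le1 ?sin_geN1 ?sin_le1.
apply: cint_eq => t _.
transitivity (\int[mu]_(x in `[0, p])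
  ((F t * cos (2 * pi * y * t) + G t * sin (2 * pi * y * t)) * (expR (- om * x) * sin (sg t * x)) +
   (G t * cos (2 * pi * y * t) - F t * sin (2 * pi * y * t)) * (expR (- om * x) * cos (sg t * x)))).
  by apply: cint_eq => x _; rewrite /K2 cosB sinB; tring.
rewrite cintD; [|by ctn|by ctn].
rewrite !cintZ; [|by ctn|by ctn].
rewrite cint_exp_cos// cint_exp_sin//.
have [-> ->] := sgp t.
rewrite /F /G /resf /resg /res1 /res2.
have := resD_gt0 om p om0 p0 t; rewrite /resD.
have : 0 < om ^+ 2 + sg t ^+ 2 by rewrite ltr_pwDl ?sqr_ge0// exprn_gt0.
move: (expR _) (cos (2 * pi * p * t)) (sin (2 * pi * p * t)) (cos _) (sin _) (sg t).
move=> q c s c' s' r r0 D0.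
by field; rewrite !gt_eqF.
Qed.

End Coefficients.

(** * The rational window and its Gabor coefficients *)

Section RatWindow.
Context {R : realType} (N : nat) (a w : 'I_N -> R).
Hypothesis w0 : forall k, 0 < w k.

Definition rwR (t : R) : R := \sum_(k < N) a k * t / (t ^+ 2 + w k ^+ 2).
Definition rwI (t : R) : R := \sum_(k < N) a k * w k / (t ^+ 2 + w k ^+ 2).

Lemma rw_den_gt0 t k : 0 < t ^+ 2 + w k ^+ 2.
Proof. by rewrite ltr_wpDl ?sqr_ge0// exprn_gt0. Qed.

Let continuous_rw_den k : continuous (fun t : R => (t ^+ 2 + w k ^+ 2)^-1).
Proof. by apply: continuous_invf; [move=> t; rewrite gt_eqF ?rw_den_gt0|ctn]. Qed.

Lemma continuous_rwR : continuous rwR.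
Proof. by have H := continuous_rw_den; rewrite /rwR; ctn. Qed.

Lemma continuous_rwI : continuous rwI.
Proof. by have H := continuous_rw_den; rewrite /rwI; ctn. Qed.

Lemma rat_windowE t : rat_window a w t = Complex (rwR t) (rwI t).
Proof.
rewrite /rat_window /rwR /rwI.
have -> : Complex (\sum_(k < N) a k * t / (t ^+ 2 + w k ^+ 2))
                  (\sum_(k < N) a k * w k / (t ^+ 2 + w k ^+ 2)) =
          \sum_(k < N) Complex (a k * t / (t ^+ 2 + w k ^+ 2)) (a k * w k / (t ^+ 2 + w k ^+ 2)).
  elim/big_rec3: _ => // k x y z _ <-.
  by apply/eqP; rewrite eq_complex/= !eqxx.
apply: eq_bigr => k _; have D0 := rw_den_gt0 t k.
have y0 : Complex t 0 - Complex 0 1 * Complex (w k) 0 != 0.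
  by rewrite eq_complex/= negb_and; apply/orP; right; have := w0 k; lra.
apply: (mulIf y0); rewrite divfK//.
apply/eqP; rewrite eq_complex/=; apply/andP; split; apply/eqP; field; rewrite gt_eqF//.
Qed.

End RatWindow.

Section FourierSum.
Context {R : realType} (N : nat) (A : 'I_N -> R) (U V : 'I_N -> R -> R) (c d z : R).
Hypotheses (cU : forall k, continuous (U k)) (cV : forall k, continuous (V k)).

Lemma FTr_sum : FTr c d (fun x => \sum_(k < N) A k * U k x) (fun x => \sum_(k < N) A k * V k x) z =
  \sum_(k < N) A k * FTr c d (U k) (V k) z.
Proof.
transitivity (\sum_(k < N) \int[@lebesgue_measure R]_(t in `[c, d])
    (A k * (U k t * cos (2 * pi * z * t) - V k t * sin (2 * pi * z * t)))).
  rewrite -cint_sum; last by move=> k; ctn.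
  apply: cint_eq => x _; rewrite !mulr_suml -sumrB.
  by apply: eq_bigr => k _; tring.
by apply: eq_bigr => k _; rewrite cintZ//; ctn.
Qed.

Lemma FTi_sum : FTi c d (fun x => \sum_(k < N) A k * U k x) (fun x => \sum_(k < N) A k * V k x) z =
  \sum_(k < N) A k * FTi c d (U k) (V k) z.
Proof.
transitivity (\sum_(k < N) \int[@lebesgue_measure R]_(t in `[c, d])
    (A k * (U k t * sin (2 * pi * z * t) + V k t * cos (2 * pi * z * t)))).
  rewrite -cint_sum; last by move=> k; ctn.
  apply: cint_eq => x _; rewrite !mulr_suml -big_split/=.
  by apply: eq_bigr => k _; tring.
by apply: eq_bigr => k _; rewrite cintZ//; ctn.
Qed.

End FourierSum.

Section GaborCoefficients.
Context {R : realType} (N : nat) (a w : 'I_N -> R) (alpha beta : R).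
Notation mu := (@lebesgue_measure R).
Hypotheses (w0 : forall k, 0 < w k) (alpha0 : 0 < alpha).
Variables (c d : R) (f g : R -> R).
Hypotheses (cd : c < d) (cf : continuous f) (cg : continuous g).

Definition cutoff (t : R) : R[i] := if c <= t <= d then Complex (f t) (g t) else 0.

Let om k : R := 2 * pi * w k.

Definition PhiR (y x : R) : R := \sum_(k < N) 2 * pi * a k *
  (expR (- om k * x) * uR (om k) alpha^-1 c d f g (x - y)).
Definition PhiI (y x : R) : R := \sum_(k < N) 2 * pi * a k *
  (expR (- om k * x) * uI (om k) alpha^-1 c d f g (x - y)).

Let om0 k : 0 < om k.
Proof. by rewrite !mulr_gt0// pi_gt0. Qed.

Let p0 : 0 < alpha^-1. Proof. by rewrite invr_gt0. Qed.

Let cF k : continuous (resf (om k) alpha^-1 f g).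
Proof. exact: continuous_resf. Qed.

Let cG k : continuous (resg (om k) alpha^-1 f g).
Proof. exact: continuous_resg. Qed.

Lemma continuous_uR k : continuous (uR (om k) alpha^-1 c d f g).
Proof. exact: continuous_FTr. Qed.

Lemma continuous_uI k : continuous (uI (om k) alpha^-1 c d f g).
Proof. exact: continuous_FTi. Qed.

Lemma continuous_PhiR y : continuous (PhiR y).
Proof. by have H := continuous_uR; rewrite /PhiR; ctn. Qed.

Lemma continuous_PhiI y : continuous (PhiI y).
Proof. by have H := continuous_uI; rewrite /PhiI; ctn. Qed.

(** With [om = 2 pi w], the fraction [2 pi a / (om - 2 i pi s)] is [i] times the conjugate of
    [a / (s - i w)]. The unimodular factor is thus [i]: the real part of the inner product is [FTi]
    and its imaginary part is [- FTr]. *)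
Lemma inner_gabor (m n : int) :
  cabs2 (inner cutoff (gabor_atom (rat_window a w) alpha beta m n)) =
  FTr 0 alpha^-1 (PhiR (beta * n%:~R)) (PhiI (beta * n%:~R)) (- (m%:~R / alpha^-1)) ^+ 2 +
  FTi 0 alpha^-1 (PhiR (beta * n%:~R)) (PhiI (beta * n%:~R)) (- (m%:~R / alpha^-1)) ^+ 2.
Proof.
set y := beta * n%:~R; set z := - (m%:~R / alpha^-1).
have cu := continuous_uR; have cv := continuous_uI.
pose P t := f t * cos (2 * pi * y * t) + g t * sin (2 * pi * y * t).
pose Q t := g t * cos (2 * pi * y * t) - f t * sin (2 * pi * y * t).
pose s t := t - m%:~R / alpha^-1.
pose sg t : R := 2 * pi * s t.
have cP : continuous P by rewrite /P; ctn.
have cQ : continuous Q by rewrite /Q; ctn.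
have Dinv k : continuous (fun t => (om k ^+ 2 + sg t ^+ 2)^-1).
  apply: continuous_invf; last by rewrite /sg /s; ctn.
  by move=> t; rewrite gt_eqF// ltr_pwDl ?sqr_ge0// exprn_gt0.
have csg : continuous sg by rewrite /sg /s; ctn.
have D0 t k : 0 < w k ^+ 2 + s t ^+ 2 by rewrite addrC; exact: rw_den_gt0.
have cU k : continuous (fun x => expR (- om k * x) * uR (om k) alpha^-1 c d f g (x - y)) by ctn.
have cV k : continuous (fun x => expR (- om k * x) * uI (om k) alpha^-1 c d f g (x - y)) by ctn.
have XE : FTr 0 alpha^-1 (PhiR y) (PhiI y) z =
    \int[mu]_(t in `[c, d]) (P t * rwI N a w (s t) - Q t * rwR N a w (s t)).
  rewrite /PhiR /PhiI FTr_sum//.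
  transitivity (\sum_(k < N) \int[mu]_(t in `[c, d])
     (2 * pi * a k * ((P t * om k - Q t * sg t) / (om k ^+ 2 + sg t ^+ 2)))).
    apply: eq_bigr => k _; rewrite /z coefR// cintZ//.
    by rewrite -/y; ctn.
  rewrite -cint_sum; last by move=> k; ctn.
  apply: cint_eq => t _; rewrite /rwR /rwI !mulr_sumr -sumrB.
  apply: eq_bigr => k _; rewrite /sg /om.
  have H := D0 t k; have pi0 := pi_gt0 R.
  move: (P t) (Q t) (s t) (pi : R) (w k) H pi0 => P' Q' s' pi' w' H pi0; field.
  rewrite addrC gt_eqF//=.
  have -> : (2 * pi' * w') ^+ 2 + (2 * pi' * s') ^+ 2 = (2 * pi') ^+ 2 * (w' ^+ 2 + s' ^+ 2) by ring.
  by rewrite gt_eqF// mulr_gt0// exprn_gt0// mulr_gt0.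
have YE : FTi 0 alpha^-1 (PhiR y) (PhiI y) z =
    \int[mu]_(t in `[c, d]) (P t * rwR N a w (s t) + Q t * rwI N a w (s t)).
  rewrite /PhiR /PhiI FTi_sum//.
  transitivity (\sum_(k < N) \int[mu]_(t in `[c, d])
     (2 * pi * a k * ((P t * sg t + Q t * om k) / (om k ^+ 2 + sg t ^+ 2)))).
    apply: eq_bigr => k _; rewrite /z coefI// cintZ//.
    by rewrite -/y; ctn.
  rewrite -cint_sum; last by move=> k; ctn.
  apply: cint_eq => t _; rewrite /rwR /rwI !mulr_sumr -big_split/=.
  apply: eq_bigr => k _; rewrite /sg /om.
  have H := D0 t k; have pi0 := pi_gt0 R.
  move: (P t) (Q t) (s t) (pi : R) (w k) H pi0 => P' Q' s' pi' w' H pi0; field.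
  rewrite addrC gt_eqF//=.
  have -> : (2 * pi' * w') ^+ 2 + (2 * pi' * s') ^+ 2 = (2 * pi') ^+ 2 * (w' ^+ 2 + s' ^+ 2) by ring.
  by rewrite gt_eqF// mulr_gt0// exprn_gt0// mulr_gt0.
have atomE t : cutoff t * conjc (gabor_atom (rat_window a w) alpha beta m n t) =
    if c <= t <= d then Complex (P t * rwR N a w (s t) + Q t * rwI N a w (s t))
                               (Q t * rwR N a w (s t) - P t * rwI N a w (s t)) else 0.
  rewrite /cutoff; case: ifP => _; last by rewrite mul0r.
  rewrite /gabor_atom rat_windowE// /cexpi.
  have -> : 2 * pi * beta * n%:~R * t = 2 * pi * y * t by rewrite /y; ring.
  have -> : t - alpha * m%:~R = s t by rewrite /s invrK mulrC.
  by apply/eqP; rewrite eq_complex/= /P /Q; apply/andP; split; apply/eqP; tring.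
rewrite /inner /cabs2/=.
have -> : \int[mu]_t complex.Re (cutoff t * conjc (gabor_atom (rat_window a w) alpha beta m n t)) =
    FTi 0 alpha^-1 (PhiR y) (PhiI y) z.
  rewrite YE [RHS]Rintegral_mkcond; apply: eq_Rintegral => t _.
  by rewrite atomE /patch mem_setE in_itv/=; case: ifP.
have -> : \int[mu]_t complex.Im (cutoff t * conjc (gabor_atom (rat_window a w) alpha beta m n t)) =
    - FTr 0 alpha^-1 (PhiR y) (PhiI y) z.
  have cs : continuous s by rewrite /s; ctn.
  have crwR : continuous (fun t => rwR N a w (s t)).
    exact: (continuous_compf s (rwR N a w) cs (continuous_rwR N a w w0)).
  have crwI : continuous (fun t => rwI N a w (s t)).
    exact: (continuous_compf s (rwI N a w) cs (continuous_rwI N a w w0)).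
  rewrite XE -cintN; last by ctn.
  rewrite [RHS]Rintegral_mkcond; apply: eq_Rintegral => t _.
  by rewrite atomE /patch mem_setE in_itv/=; case: ifP => //= _; rewrite opprB.
by rewrite sqrrN addrC.
Qed.

(** For fixed [n], the sum over [m] is Parseval on a segment of length [alpha^-1]. The interval is
    left half-open in the result, the shape in which it is folded later. *)
Lemma esum_inner_gabor :
  (\esum_(mn in [set: int * int])
    (cabs2 (inner cutoff (gabor_atom (rat_window a w) alpha beta mn.1 mn.2)))%:E =
  \esum_(n in [set: int]) ((alpha^-1)%:E *
    \int[mu]_(x in `[0%R, alpha^-1%R[)
      (PhiR (beta * n%:~R) x ^+ 2 + PhiI (beta * n%:~R) x ^+ 2)%R%:E))%E.
Proof.
pose T (n m : int) : \bar R :=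
  (cabs2 (inner cutoff (gabor_atom (rat_window a w) alpha beta m n)))%:E.
have T0 n m : (0 <= T n m)%E by rewrite lee_fin addr_ge0// sqr_ge0.
transitivity (\esum_(nm in [set: int] `*`` (fun=> [set: int])) T nm.1 nm.2)%E.
  rewrite (reindex_esum ([set: int] `*`` (fun=> [set: int])) setT (fun nm => (nm.2, nm.1)))//.
  split; [by []|by move=> [m n] [m' n'] _ _ [-> ->]|].
  by move=> [m n] _; exists (n, m).
rewrite -esum_esum//; apply: eq_esum => n _.
have cR := continuous_PhiR (beta * n%:~R); have cI := continuous_PhiI (beta * n%:~R).
have cRI : continuous (fun x => PhiR (beta * n%:~R) x ^+ 2 + PhiI (beta * n%:~R) x ^+ 2) by ctn.
transitivity ((alpha^-1 - 0) *
  \int[mu]_(x in `[0, alpha^-1]) (PhiR (beta * n%:~R) x ^+ 2 + PhiI (beta * n%:~R) x ^+ 2))%:E.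
  rewrite -Parseval// [RHS](reindex_esum setT setT (fun m : int => - m)); last first.
    split; [by []|by move=> k l _ _; exact: oppr_inj|].
    by move=> k _; exists (- k) => //; rewrite opprK.
  by apply: eq_esum => m _; rewrite /T inner_gabor rmorphN/= mulNr subr0.
rewrite EFinM subr0 EFin_cint// integral_itv_bndo_bndc//.
by apply: measurable_funTS; apply: measurable_EFin_fun; exact: continuous_measurable_fun.
Qed.

End GaborCoefficients.

(** * Energy estimates *)

Section FoldMultiple.
Context {R : realType}.
Notation mu := (@lebesgue_measure R).
Local Open Scope ereal_scope.

Lemma integral_fold_shift (b c : R) (f : R -> \bar R) : (0 < b)%R ->
  measurable_fun setT f -> (forall x, 0 <= f x) ->
  \esum_(n in [set: int]) (\int[mu]_(x in `[0%R, b[) f (x + c - b * n%:~R)%R) =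
  \int[mu]_x f x.
Proof.
move=> b0 mf f0; rewrite -[RHS](ge0_integral_shift c)// -[RHS](integral_fold b)//.
- by apply: eq_esum => n _; apply: eq_integral => x _; rewrite addrAC.
- exact: (measurableT_comp mf (measurable_shiftr c)).
Qed.

(** The interval consists of [L] consecutive periods, each of which contributes the full integral by
    folding. This is for the case where [p] exceeds [beta] and the shifted intervals overlap. *)
Lemma integral_fold_le (b : R) (L : nat) (f : R -> \bar R) : (0 < b)%R ->
  measurable_fun setT f -> (forall x, 0 <= f x) ->
  \esum_(n in [set: int]) (\int[mu]_(x in `[0%R, (b * L%:R)%R[) f (x - b * n%:~R)%R) =
  L%:R%:E * \int[mu]_x f x.
Proof.
move=> b0 mf f0.
have mfn n : measurable_fun setT (fun x : R => f (x - b * n%:~R)%R).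
  exact: (measurableT_comp mf (measurable_shiftr (- (b * n%:~R)))).
elim: L => [|L IH].
  rewrite mul0e esum1// => n _.
  by rewrite set_itv_ge ?integral_set0// bnd_simp mulr0 -leNgt.
rewrite -natr1 EFinD ge0_muleDl ?lee_fin// mul1e -IH.
rewrite -[in RHS](integral_fold_shift b (b * L%:R))//.
rewrite -esumD; [|by move=> n _; exact: integral_ge0|by move=> n _; exact: integral_ge0].
apply: eq_esum => n _.
have bL : (0 <= b * L%:R)%R by rewrite mulr_ge0// ltW.
have bS : (b * L%:R <= b * (L%:R + 1))%R by rewrite ler_wpM2l ?ltW// ltrDl.
have -> : `[0%R, (b * (L%:R + 1))%R[%classic =
    `[0%R, (b * L%:R)%R[%classic `|` `[(b * L%:R)%R, (b * (L%:R + 1))%R[%classic.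
  by rewrite -itv_bndbnd_setU// bnd_simp.
rewrite ge0_integral_setU//=; last 2 first.
- exact: measurable_funTS (mfn n).
- apply/disj_setPS => y [/=]; rewrite !in_itv/= => /andP[_ h1] /andP[h2 _].
  by move: (lt_le_trans h1 h2); rewrite ltxx.
congr (_ + _).
rewrite -(ge0_integral_shift_set (b * L%:R)).
- have -> : [set x | `[(b * L%:R)%R, (b * (L%:R + 1))%R[%classic (x + b * L%:R)%R] =
    `[0%R, b[%classic.
    by apply/seteqP; split => x /=; rewrite !in_itv/= => /andP[h1 h2]; apply/andP; split; lra.
  by [].
- by [].
- exact: measurable_funTS (mfn n).
- by [].
Qed.

End FoldMultiple.

Section Energy.
Context {R : realType} (N : nat) (A om : 'I_N -> R) (p beta : R).
Notation mu := (@lebesgue_measure R).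
Hypotheses (A0 : forall k, 0 < A k) (om0 : forall k, 0 < om k).
Hypotheses (p0 : 0 < p) (beta0 : 0 < beta).

(* For [A = ampl], [om = rate] and the transforms [uR], [uI] below, this is the
   contribution to the frame sum, see [gaborS_cut]. *)
Definition Sfun (u : 'I_N -> R -> R) : \bar R :=
  \esum_(n in [set: int]) (p%:E * \int[mu]_(x in `[0%R, p[)
    ((\sum_(k < N) A k * (expR (- om k * x) * u k (x - beta * n%:~R))) ^+ 2)%:E)%E.

(** The source [F] is the same for every [k]. The uniform bound stands in for integrability: it is
    what [decay_integral] asks for. *)
Definition resolvent_eq (u : 'I_N -> R -> R) (F : R -> R) : Prop :=
  [/\ forall k, measurable_fun setT (u k), measurable_fun setT F,
      exists B, forall k z, `|u k z| <= B &
      forall k z, u k z = expR (- (om k * p)) * u k (z + p) + F z].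

Let q k := expR (- (om k * p)).

Let q_ge0 k : 0 <= q k. Proof. exact: expR_ge0. Qed.

Let q_lt1 k : q k < 1.
Proof. by rewrite expR_lt1 oppr_lt0 mulr_gt0. Qed.

(** Convexity gives [(q x + y)^2 <= q x^2 + y^2 / (1 - q)], a decay inequality for the square of
    [u k]. One factor [(1 - q)^-1] comes from convexity, the other from the geometric series. *)
Lemma resolvent_sqr_integral u F k : resolvent_eq u F ->
  (\int[mu]_z (u k z ^+ 2)%:E <= ((1 - q k) ^- 2)%:E * \int[mu]_z (F z ^+ 2)%:E)%E.
Proof.
move=> [mu_ mF [B uB] urec].
have q1 : 0 < 1 - q k by rewrite subr_gt0.
have H := decay_integral (fun z => u k z ^+ 2) (fun z => (1 - q k)^-1 * F z ^+ 2) p (q k) (B ^+ 2)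
  (q_ge0 k) (q_lt1 k).
apply: (le_trans (H _ _ _ _ _)).
- move=> x; rewrite sqr_ge0/= -[leLHS]real_normK ?num_real//.
  have uBx := uB k x.
  by rewrite ler_sqr ?nnegrE//; exact: le_trans (normr_ge0 _) uBx.
- by move=> x; rewrite mulr_ge0 ?sqr_ge0// invr_ge0 ltW.
- by mtn.
- by mtn.
- move=> z; rewrite urec -/(q k).
  move: (q k) q1 (q_ge0 k) (u k (z + p)) (F z) => r r1 r0 x y.
  have -> : r * x ^+ 2 + (1 - r)^-1 * y ^+ 2 =
    (r * x + y) ^+ 2 + r * ((1 - r) * x - y) ^+ 2 / (1 - r).
    by field; rewrite gt_eqF.
  rewrite lerDl; apply: divr_ge0; last exact: ltW.
  exact: mulr_ge0 r0 (sqr_ge0 _).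
rewrite le_eqVlt; apply/orP; left; apply/eqP.
under eq_integral do rewrite EFinM.
rewrite ge0_integralZl_EFin//.
- by rewrite muleA -EFinM -invfM expr2.
- by move=> x _; rewrite lee_fin sqr_ge0.
- by apply: measurable_EFin_fun; mtn.
- by rewrite invr_ge0 ltW.
Qed.

Lemma sqr_sum_le (x : 'I_N -> R) : (\sum_k x k) ^+ 2 <= N%:R * \sum_k x k ^+ 2.
Proof.
have H : 0 <= \sum_(i < N) \sum_(j < N) (x i - x j) ^+ 2.
  by apply: sumr_ge0 => i _; apply: sumr_ge0 => j _; exact: sqr_ge0.
have : \sum_(i < N) \sum_(j < N) (x i - x j) ^+ 2 =
   2 * (N%:R * \sum_k x k ^+ 2 - (\sum_k x k) ^+ 2).
  transitivity (\sum_(i < N) (N%:R * x i ^+ 2 + \sum_k x k ^+ 2 + (-2) * (x i * \sum_k x k))).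
    apply: eq_bigr => i _.
    have -> : N%:R * x i ^+ 2 = \sum_(j < N) x i ^+ 2 by rewrite sumr_const card_ord mulr_natl.
    rewrite !mulr_sumr -!big_split/=; apply: eq_bigr => j _; ring.
  rewrite !big_split/= -!mulr_sumr -mulr_suml sumr_const card_ord -[X in _ + X + _]mulr_natl.
  ring.
lra.
Qed.

(** The exponentials are at most [1] on [[0, p[], so Cauchy-Schwarz over [k] reduces the integrand
    to the sum of the squares of the [u k]; [[0, p[] is covered by [L] periods of length [beta]. *)
Lemma Sfun_le : exists2 C : R, 0 <= C & forall u,
  (forall k, measurable_fun setT (u k)) ->
  (Sfun u <= C%:E * \sum_(k < N) \int[mu]_z (u k z ^+ 2)%:E)%E.
Proof.
pose Am := \sum_(k < N) A k ^+ 2.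
have Am0 : 0 <= Am by apply: sumr_ge0 => k _; exact: sqr_ge0.
pose L := (Num.truncn (p / beta)).+1.
have pL : p <= beta * L%:R by rewrite mulrC -ler_pdivrMr// ltW// truncnS_gt.
exists (p * (N%:R * Am) * L%:R).
  by rewrite !mulr_ge0// ltW.
move=> u mu_.
pose G z := \sum_(k < N) u k z ^+ 2.
have mG : measurable_fun setT G by rewrite /G; mtn.
have G0 z : 0 <= G z by apply: sumr_ge0 => k _; exact: sqr_ge0.
have mGE := measurable_EFin_fun _ _ mG.
have -> : (\sum_(k < N) \int[mu]_z (u k z ^+ 2)%:E = \int[mu]_z (G z)%:E)%E.
  rewrite -ge0_integral_sum//.
  - by apply: eq_integral => z _; rewrite sumEFin.
  - by move=> k; apply: measurable_EFin_fun; mtn.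
  - by move=> k z _; rewrite lee_fin sqr_ge0.
pose c := p * (N%:R * Am).
have c0 : 0 <= c by rewrite !mulr_ge0// ltW.
have -> : ((p * (N%:R * Am) * L%:R)%:E * \int[mu]_z (G z)%:E =
    L%:R%:E * \int[mu]_z (c * G z)%:E)%E.
  under [in RHS]eq_integral do rewrite EFinM.
  rewrite ge0_integralZl_EFin//; last by move=> z _; rewrite lee_fin.
  by rewrite [RHS]muleA -EFinM [in RHS]mulrC.
rewrite -(integral_fold_le beta L (fun z => (c * G z)%:E))//; last 2 first.
- by apply: measurable_EFin_fun; mtn.
- by move=> z; rewrite lee_fin mulr_ge0.
apply: le_esum => n _.
have mun k : measurable_fun setT (fun x : R => u k (x - beta * n%:~R)).
  exact: (measurableT_comp (mu_ k) (measurable_shiftr (- (beta * n%:~R)))).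
have mGn : measurable_fun setT (fun x : R => G (x - beta * n%:~R)).
  exact: (measurableT_comp mG (measurable_shiftr (- (beta * n%:~R)))).
rewrite -ge0_integralZl_EFin//; last 3 first.
- by move=> x _; rewrite lee_fin sqr_ge0.
- by apply: measurable_funTS; apply: measurable_EFin_fun; mtn.
- exact: ltW.
apply: (@le_trans _ _ (\int[mu]_(x in `[0%R, p[) (c * G (x - beta * n%:~R))%:E)%E).
  apply: ge0_le_integral => //.
  - by move=> x _; apply: mule_ge0; rewrite lee_fin ?sqr_ge0// ltW.
  - apply: measurable_funTS; apply: measurable_EFin_fun.
    by mtn.
  - by apply: measurable_funTS; apply: measurable_EFin_fun; mtn.
  - move=> x /=; rewrite in_itv/= => /andP[x0 xp]; rewrite -EFinM lee_fin -mulrA ler_pM2l//.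
    apply: (le_trans (sqr_sum_le _)); rewrite -mulrA ler_wpM2l// /G mulr_sumr.
    apply: ler_sum => k _; rewrite !exprMn.
    have -> : A k ^+ 2 * (expR (- om k * x) ^+ 2 * u k (x - beta * n%:~R) ^+ 2) =
      A k ^+ 2 * expR (- om k * x) ^+ 2 * u k (x - beta * n%:~R) ^+ 2 by ring.
    apply: ler_wpM2r; first exact: sqr_ge0.
    apply: (@le_trans _ _ (A k ^+ 2)); last first.
      rewrite /Am (bigD1 k)//= lerDl; apply: sumr_ge0 => l _; exact: sqr_ge0.
    rewrite ler_piMr ?sqr_ge0// expr_le1// ?expR_ge0// expR_le1 mulNr oppr_le0.
    by rewrite mulr_ge0// ltW.
apply: ge0_subset_integral => //.
- by apply: measurable_funTS; apply: measurable_EFin_fun; mtn.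
- by move=> x _; rewrite lee_fin mulr_ge0.
- by apply: subset_itvl; rewrite bnd_simp.
Qed.

Lemma Sfun_upper : exists2 C : R, 0 <= C & forall u F, resolvent_eq u F ->
  (Sfun u <= C%:E * \int[mu]_z (F z ^+ 2)%:E)%E.
Proof.
have [C C0 HC] := Sfun_le.
exists (C * \sum_(k < N) (1 - q k) ^- 2).
  rewrite mulr_ge0//; apply: sumr_ge0 => k _.
  by rewrite invr_ge0 exprn_ge0// subr_ge0 ltW.
move=> u F H; have [mu_ _ _ _] := H.
apply: (le_trans (HC u mu_)); rewrite EFinM -muleA lee_wpmul2l ?lee_fin//.
rewrite -sumEFin ge0_sume_distrl; last first.
  by move=> k _; rewrite lee_fin invr_ge0 exprn_ge0// subr_ge0 ltW.
by apply: lee_sum => k _; exact: resolvent_sqr_integral.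
Qed.

(* A common shift does not change the [b]-weighted variance, and
   energy = variance + (weighted sum)^2 / (total weight). *)
Lemma weighted_energy (b v : 'I_N -> R) (x : R) : 0 < \sum_k b k ->
  \sum_k b k * (v k + x) ^+ 2 <=
  \sum_k b k * v k ^+ 2 + (\sum_k b k * (v k + x)) ^+ 2 / \sum_k b k.
Proof.
set W := \sum_k b k => W0.
have -> : \sum_k b k * (v k + x) = \sum_k b k * v k + W * x.
  by rewrite mulr_suml -big_split/=; apply: eq_bigr => k _; ring.
have -> : \sum_k b k * (v k + x) ^+ 2 =
    \sum_k b k * v k ^+ 2 + 2 * x * (\sum_k b k * v k) + W * x ^+ 2.
  rewrite mulr_suml mulr_sumr -!big_split/=; apply: eq_bigr => k _; ring.
rewrite -subr_ge0; set S := \sum_k b k * v k.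
have -> : \sum_k b k * v k ^+ 2 + (S + W * x) ^+ 2 / W -
   (\sum_k b k * v k ^+ 2 + 2 * x * S + W * x ^+ 2) = S ^+ 2 / W.
  by field; rewrite gt_eqF.
by rewrite divr_ge0 ?sqr_ge0// ltW.
Qed.

(** [dl] is left abstract because two choices are made: the residue modulo [beta] for the lower
    bound, and its truncation at [p] when [beta > p]. *)
Definition energy (dl : R -> R) (u : 'I_N -> R -> R) (z : R) : R :=
  \sum_(k < N) A k * expR (- om k * dl z) * u k z ^+ 2.

Definition output (dl : R -> R) (u : 'I_N -> R -> R) (z : R) : R :=
  \sum_(k < N) A k * expR (- om k * dl z) * u k z.

Hypothesis N0 : (0 < N)%N.

Lemma exists_rate : exists q1, [/\ 0 <= q1, q1 < 1 & forall k, q k <= q1].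
Proof.
exists (\big[Order.max/0]_(k < N) q k); split.
- by elim/big_rec: _ => // k x _ x0; rewrite le_max x0 orbT.
- by elim/big_rec: _ => // k x _ x1; rewrite gt_max q_lt1.
- by move=> k; rewrite (bigD1 k)//= le_max lexx.
Qed.

(** A lower bound for the total weight that is uniform in [z], because [dl z <= p]. *)
Let W0 := \sum_(k < N) A k * q k.

Let W0_gt0 : 0 < W0.
Proof.
rewrite /W0 (bigD1 (Ordinal N0))//= ltr_pwDl//.
  by rewrite mulr_gt0// expR_gt0.
by apply: sumr_ge0 => k _; rewrite mulr_ge0// ltW.
Qed.

Let weight_ge k (x : R) : 0 <= x <= p -> A k * q k <= A k * expR (- om k * x).
Proof.
move=> /andP[x0 xp]; rewrite ler_pM2l// ler_expR mulNr lerN2.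
by rewrite ler_pM2l.
Qed.

(** [weighted_energy] is applied to the values [q k * u k (z + p)] and their common shift [x]; the
    weighted sum after the shift is the output. Since [dl (z + p) <= p <= dl z + p], replacing the
    weights at [z] by those at [z + p] costs at most [1 / q k], and of the factor [q k ^+ 2] one
    [q k <= q1] remains. *)
Lemma energy_step (dl : R -> R) u (x q1 z : R) : (forall z, 0 <= dl z <= p) ->
  (forall k, q k <= q1) ->
  (forall k, u k z = q k * u k (z + p) + x) ->
  energy dl u z <= q1 * energy dl u (z + p) + output dl u z ^+ 2 / W0.
Proof.
move=> dlp qq1 urec.
pose b k := A k * expR (- om k * dl z).
have bW : W0 <= \sum_k b k by apply: ler_sum => k _; exact: weight_ge.
have b0 k : 0 < b k by rewrite mulr_gt0// expR_gt0.
have W1 := lt_le_trans W0_gt0 bW.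
have -> : energy dl u z = \sum_k b k * (q k * u k (z + p) + x) ^+ 2.
  by apply: eq_bigr => k _; rewrite urec.
apply: (le_trans (weighted_energy b (fun k => q k * u k (z + p)) x W1)).
apply: lerD.
  rewrite mulr_sumr; apply: ler_sum => k _.
  rewrite exprMn (mulrA (b k)) (mulrA q1); apply: ler_wpM2r; first exact: sqr_ge0.
  apply: (@le_trans _ _ (q k * (A k * expR (- om k * dl (z + p))))); last first.
    by rewrite ler_wpM2r// mulr_ge0 ?expR_ge0// ltW.
  rewrite /b [leRHS]mulrCA -mulrA ler_pM2l// /q expr2 -!expRD ler_expR.
  have /andP[h1 h2] := dlp z; have /andP[h3 h4] := dlp (z + p).
  have -> : - (om k * p) + - om k * dl (z + p) = - om k * (p + dl (z + p)) by ring.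
  have -> : - om k * dl z + (- (om k * p) - om k * p) = - om k * (dl z + p + p) by ring.
  by rewrite !mulNr lerN2 ler_pM2l//; lra.
have -> : \sum_k b k * (q k * u k (z + p) + x) = output dl u z.
  by apply: eq_bigr => k _; rewrite -urec.
apply: ler_wpM2l; first exact: sqr_ge0.
by rewrite lef_pV2 ?posrE.
Qed.

Lemma energy_ge (dl : R -> R) u z k : 0 <= dl z <= p ->
  A k * q k * u k z ^+ 2 <= energy dl u z.
Proof.
move=> dlp; rewrite /energy (bigD1 k)//=.
apply: (@le_trans _ _ (A k * expR (- om k * dl z) * u k z ^+ 2)).
  by rewrite ler_wpM2r ?sqr_ge0// weight_ge.
rewrite lerDl; apply: sumr_ge0 => l _.
by rewrite mulr_ge0 ?sqr_ge0// mulr_ge0 ?expR_ge0// ltW.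
Qed.

Let energy_ge0 (dl : R -> R) u z : 0 <= energy dl u z.
Proof.
by apply: sumr_ge0 => l _; rewrite mulr_ge0 ?sqr_ge0// mulr_ge0 ?expR_ge0// ltW.
Qed.

(** The recursion for a single index gives [F z = u z - q u (z + p)], and each of the two values is
    controlled by the energy at its own point, where the weight of that index is at least [a0]. The
    two energies have the same integral, hence [c + c]. *)
Lemma energy_controls : exists2 C : R, 0 <= C & forall (dl : R -> R) u F,
  measurable_fun setT dl -> (forall z, 0 <= dl z <= p) -> resolvent_eq u F ->
  (\int[mu]_z (F z ^+ 2)%:E <= C%:E * \int[mu]_z (energy dl u z)%:E)%E.
Proof.
pose k0 := Ordinal N0; pose a0 := A k0 * q k0.
have a00 : 0 < a0 by rewrite mulr_gt0// expR_gt0.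
pose c := 2 / a0.
have c0 : 0 < c by rewrite divr_gt0.
exists (c + c); first by rewrite addr_ge0// ltW.
move=> dl u F mdl dlp [mu_ mF _ urec].
pose E := energy dl u.
have E0 z : 0 <= E z by exact: energy_ge0.
have mE : measurable_fun setT E by rewrite /E /energy; mtn.
have mEp : measurable_fun setT (fun z : R => E (z + p)).
  exact: (measurableT_comp mE (measurable_shiftr p)).
have FE z : F z ^+ 2 <= c * (E z + E (z + p)).
  have H1 : a0 * u k0 z ^+ 2 <= E z by exact: energy_ge.
  have H2 : a0 * u k0 (z + p) ^+ 2 <= E (z + p) by exact: energy_ge.
  have : F z ^+ 2 <= 2 * (u k0 z ^+ 2 + u k0 (z + p) ^+ 2).
    have -> : F z = u k0 z - q k0 * u k0 (z + p) by rewrite urec /q; ring.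
    apply: (@le_trans _ _ (2 * (u k0 z ^+ 2 + (q k0 * u k0 (z + p)) ^+ 2))).
      have := sqr_ge0 (u k0 z + q k0 * u k0 (z + p)).
      by move: (u k0 z) (q k0 * u k0 (z + p)) => x y; lra.
    rewrite ler_pM2l// lerD2l exprMn ler_piMl ?sqr_ge0// expr_le1//.
    exact: ltW.
  rewrite /c mulrAC ler_pdivlMr//; move: H1 H2.
  move: (F z ^+ 2) (u k0 z ^+ 2) (u k0 (z + p) ^+ 2) (E z) (E (z + p)) => F' x y e1 e2 H1 H2 H3.
  apply: (@le_trans _ _ (2 * (x + y) * a0)); first by rewrite ler_pM2r.
  lra.
apply: (@le_trans _ _ (\int[mu]_z (c%:E * ((E z)%:E + (E (z + p))%:E)))%E).
  apply: ge0_le_integral => //.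
  - by move=> z _; rewrite lee_fin sqr_ge0.
  - by apply: measurable_EFin_fun; mtn.
  - under eq_fun do rewrite -EFinD -EFinM.
    by apply: measurable_EFin_fun; mtn.
  - by move=> z _; rewrite -EFinD -EFinM lee_fin.
rewrite ge0_integralZl_EFin//; last 3 first.
- by move=> z _; rewrite -EFinD lee_fin addr_ge0.
- by under eq_fun do rewrite -EFinD; apply: measurable_EFin_fun; mtn.
- exact: ltW.
rewrite ge0_integralD//; last 4 first.
- by move=> z _; rewrite lee_fin.
- exact: measurable_EFin_fun.
- by move=> z _; rewrite lee_fin.
- by apply: measurable_EFin_fun; mtn.
rewrite (ge0_integral_shift p (fun z => (E z)%:E))//; last exact: measurable_EFin_fun.
have I0 : (0 <= \int[mu]_z (E z)%:E)%E by apply: integral_ge0 => z _; rewrite lee_fin.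
by rewrite [(c + c)%:E]EFinD ge0_muleDr// ge0_muleDl// lee_fin ltW.
Qed.

(** The constants multiply: [c] from [energy_controls], [(1 - q1)^-1] from the iteration and [W0^-1]
    from [energy_step]. *)
Lemma energy_lower : exists2 C : R, 0 <= C & forall (dl : R -> R) u F,
  measurable_fun setT dl -> (forall z, 0 <= dl z <= p) -> resolvent_eq u F ->
  (\int[mu]_z (F z ^+ 2)%:E <= C%:E * \int[mu]_z (output dl u z ^+ 2)%:E)%E.
Proof.
have [q1 [q10 q11 qq1]] := exists_rate.
have q1' : 0 < 1 - q1 by rewrite subr_gt0.
have [c c0 Hc] := energy_controls.
exists (c * ((1 - q1)^-1 / W0)).
  by rewrite !mulr_ge0// ?invr_ge0 ltW.
move=> dl u F mdl dlp H; have [mu_ mF [B uB] urec] := H.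
pose E := energy dl u.
have mE : measurable_fun setT E by rewrite /E /energy; mtn.
have mo : measurable_fun setT (output dl u) by rewrite /output; mtn.
have EB z : 0 <= E z <= \sum_(k < N) A k * B ^+ 2.
  rewrite energy_ge0/=; apply: ler_sum => k _; rewrite -mulrA ler_pM2l//.
  rewrite -[leRHS]mul1r ler_pM ?expR_ge0 ?sqr_ge0//.
    rewrite expR_le1 mulNr oppr_le0 mulr_ge0//; first exact: ltW.
    by case/andP: (dlp z).
  rewrite -[leLHS]real_normK ?num_real// ler_sqr ?nnegrE//.
  exact: le_trans (normr_ge0 _) (uB k z).
apply: (le_trans (Hc dl u F mdl dlp H)).
rewrite EFinM -muleA; apply: lee_wpmul2l; first by rewrite lee_fin.
have D := decay_integral E (fun z => output dl u z ^+ 2 / W0) p q1 _ q10 q11 EB _ mE _ _.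
apply: (le_trans (D _ _ _)).
- by move=> z; rewrite divr_ge0 ?sqr_ge0// ltW.
- by mtn.
- by move=> z; apply: (energy_step _ _ (F z)).
under eq_integral do rewrite mulrC EFinM.
rewrite ge0_integralZl_EFin//.
- by rewrite muleA -EFinM.
- by move=> x _; rewrite lee_fin sqr_ge0.
- by apply: measurable_EFin_fun; mtn.
- by rewrite invr_ge0 ltW.
Qed.

Let dl (z : R) : R := z - beta * (Num.floor (z / beta))%:~R.

Lemma measurable_floor_intr : measurable_fun setT (fun z : R => (Num.floor z)%:~R : R).
Proof.
move=> _ Y mY; rewrite setTI.
have -> : (fun z : R => (Num.floor z)%:~R : R) @^-1` Y =
    \bigcup_(n in [set n : int | Y n%:~R]) `[n%:~R, (n + 1)%:~R[%classic.
  apply/seteqP; split => [z /= Yz|z [n /= Yn]].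
    exists (Num.floor z) => //=; rewrite in_itv/= real_floor_le ?num_real//.
    exact: real_floorD1_gt (num_real z).
  by rewrite in_itv/= => /floor_def ->.
rewrite bigcup_mkcond; apply: countable_bigcupT_measurable => [|n]; first exact: countableP.
by case: ifP.
Qed.

Lemma modulo_beta : measurable_fun setT dl /\ (forall z, 0 <= dl z < beta) /\
  (forall (n : int) x, 0 <= x < beta -> dl (x - beta * n%:~R) = x).
Proof.
split; last split.
- rewrite /dl; have H := measurable_floor_intr.
  have H2 : measurable_fun setT (fun z : R => (Num.floor (z / beta))%:~R : R).
    apply: (measurableT_comp H); mtn.
  by mtn.
- move=> z; have := real_floor_le (num_real (z / beta)).
  have := real_floorD1_gt (num_real (z / beta)).
  rewrite rmorphD/= ler_pdivlMr// ltr_pdivrMr// /dl => h1 h2.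
  by apply/andP; split; lra.
- move=> n x /andP[x0 xb]; rewrite /dl.
  have -> : Num.floor ((x - beta * n%:~R) / beta) = - n.
    apply: floor_def; rewrite rmorphD/= rmorphN/= ler_pdivlMr// ltr_pdivrMr//.
    by apply/andP; split; lra.
  by rewrite rmorphN/=; ring.
Qed.

(** At [x - beta n] with [x] in [[0, beta[] the residue is [x], so the integrand of [Sfun] is the
    squared output there. When [beta <= p], the interval [[0, p[] contains such a whole period, and
    folding recovers the integral of the squared output over the line. The same inequality provides
    [dl <= p]. *)
Lemma Sfun_lower : beta <= p -> exists2 C : R, 0 <= C & forall u F, resolvent_eq u F ->
  (\int[mu]_z (F z ^+ 2)%:E <= C%:E * Sfun u)%E.
Proof.
move=> bp; have [C C0 HC] := energy_lower.
have [mdl [dlb dlx]] := modulo_beta.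
exists (C / p); first by rewrite divr_ge0// ltW.
move=> u F H; have [mu_ _ _ _] := H.
have dlp z : 0 <= dl z <= p.
  by have /andP[-> h] := dlb z; rewrite (le_trans (ltW h)).
apply: (le_trans (HC dl u F mdl dlp H)).
have mo : measurable_fun setT (output dl u) by rewrite /output; mtn.
have o0 z : 0 <= p * output dl u z ^+ 2 by rewrite mulr_ge0 ?sqr_ge0// ltW.
have mpo : measurable_fun setT (fun z : R => (p * output dl u z ^+ 2)%:E).
  by apply: measurable_EFin_fun; mtn.
have -> : (C%:E * \int[mu]_z (output dl u z ^+ 2)%:E =
   (C / p)%:E * \int[mu]_z (p * output dl u z ^+ 2)%:E)%E.
  under [in RHS]eq_integral do rewrite EFinM.
  rewrite ge0_integralZl_EFin//; last 3 first.
  - by move=> z _; rewrite lee_fin sqr_ge0.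
  - by apply: measurable_EFin_fun; mtn.
  - exact: ltW.
  by rewrite [RHS]muleA -EFinM divfK// gt_eqF.
rewrite lee_wpmul2l ?lee_fin ?divr_ge0 ?(ltW p0)//.
rewrite -(integral_fold beta (fun z => (p * output dl u z ^+ 2)%:E))//.
apply: le_esum => n _.
have mun k : measurable_fun setT (fun x : R => u k (x - beta * n%:~R)).
  exact: (measurableT_comp (mu_ k) (measurable_shiftr (- (beta * n%:~R)))).
rewrite -ge0_integralZl_EFin//; last 3 first.
- by move=> x _; rewrite lee_fin sqr_ge0.
- by apply: measurable_funTS; apply: measurable_EFin_fun; mtn.
- exact: ltW.
apply: (@le_trans _ _ (\int[mu]_(x in `[0%R, beta[)
   (p%:E * ((\sum_(k < N) A k * (expR (- om k * x) * u k (x - beta * n%:~R))) ^+ 2)%:E))%E).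
  rewrite le_eqVlt; apply/orP; left; apply/eqP; apply: eq_integral => x.
  rewrite inE/= in_itv/= => xb; rewrite -EFinM; congr (_ * _ ^+ 2)%:E.
  by apply: eq_bigr => k _; rewrite dlx// mulrA.
apply: ge0_subset_integral => //.
- apply: measurable_funTS; under eq_fun do rewrite -EFinM.
  by apply: measurable_EFin_fun; mtn.
- by move=> x _; rewrite -EFinM lee_fin mulr_ge0 ?sqr_ge0// ltW.
- by apply: subset_itvl; rewrite bnd_simp.
Qed.

End Energy.

(** * Frame bounds for truncated continuous functions *)

Section FrameOnCuts.
Context {R : realType} (N : nat) (a w : 'I_N -> R) (alpha beta : R).
Notation mu := (@lebesgue_measure R).
Hypotheses (a0 : forall k, 0 < a k) (w0 : forall k, 0 < w k).
Hypotheses (alpha0 : 0 < alpha) (beta0 : 0 < beta) (N0 : (0 < N)%N).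

Definition ampl (k : 'I_N) : R := 2 * pi * a k.
Definition rate (k : 'I_N) : R := 2 * pi * w k.

Lemma ampl_gt0 k : 0 < ampl k.
Proof. by rewrite !mulr_gt0// pi_gt0. Qed.

Lemma rate_gt0 k : 0 < rate k.
Proof. by rewrite !mulr_gt0// pi_gt0. Qed.

Definition gaborS (h : R -> R[i]) : \bar R :=
  \esum_(mn in [set: int * int])
    (cabs2 (inner h (gabor_atom (rat_window a w) alpha beta mn.1 mn.2)))%:E.

Let p0 : 0 < alpha^-1. Proof. by rewrite invr_gt0. Qed.

Section Cut.
Variables (c d : R) (f g : R -> R).
Hypotheses (cd : c < d) (cf : continuous f) (cg : continuous g).

Lemma L2norm2_cut :
  L2norm2 (cutoff c d f g) = (\int[mu]_(t in `[c, d]) (f t ^+ 2 + g t ^+ 2))%R%:E.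
Proof.
rewrite EFin_cint; last by ctn.
rewrite integral_mkcond; apply: eq_integral => t _.
rewrite /cutoff /patch mem_setE in_itv/= /cabs2.
by case: ifP => // _; rewrite /= expr0n addr0.
Qed.

Lemma resolvent_eq_uR : resolvent_eq N rate alpha^-1
  (fun k => uR (rate k) alpha^-1 c d f g) (FTr c d f g).
Proof.
split.
- move=> k; apply: continuous_measurable_fun.
  exact: (continuous_uR N w alpha w0 alpha0 c d f g cf cg k).
- by apply: continuous_measurable_fun; exact: continuous_FTr.
- have H k : exists B, forall z, `|uR (rate k) alpha^-1 c d f g z| <= B.
    have cF := continuous_resf _ _ (rate_gt0 k) p0 _ _ cf cg.
    have cG := continuous_resg _ _ (rate_gt0 k) p0 _ _ cf cg.
    have [B _ HB] := FT_bounded c d _ _ cF cG.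
    by exists B => z; have [] := HB z.
  have [B HB] := boolp.choice H.
  exists (\sum_(k < N) `|B k|) => k z.
  apply: (le_trans (HB k z)); rewrite (bigD1 k)//= (le_trans (ler_norm _))// lerDl.
  by apply: sumr_ge0 => l _.
- by move=> k z; exact: (uR_rec _ _ (rate_gt0 k) p0 c d f g cf cg z).
Qed.

Lemma resolvent_eq_uI : resolvent_eq N rate alpha^-1
  (fun k => uI (rate k) alpha^-1 c d f g) (FTi c d f g).
Proof.
split.
- move=> k; apply: continuous_measurable_fun.
  exact: (continuous_uI N w alpha w0 alpha0 c d f g cf cg k).
- by apply: continuous_measurable_fun; exact: continuous_FTi.
- have H k : exists B, forall z, `|uI (rate k) alpha^-1 c d f g z| <= B.
    have cF := continuous_resf _ _ (rate_gt0 k) p0 _ _ cf cg.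
    have cG := continuous_resg _ _ (rate_gt0 k) p0 _ _ cf cg.
    have [B _ HB] := FT_bounded c d _ _ cF cG.
    by exists B => z; have [] := HB z.
  have [B HB] := boolp.choice H.
  exists (\sum_(k < N) `|B k|) => k z.
  apply: (le_trans (HB k z)); rewrite (bigD1 k)//= (le_trans (ler_norm _))// lerDl.
  by apply: sumr_ge0 => l _.
- by move=> k z; exact: (uI_rec _ _ (rate_gt0 k) p0 c d f g cf cg z).
Qed.

(** The weights in [PhiR] and [PhiI] are real, so the squared modulus splits into two real problems
    with the same weights. *)
Lemma gaborS_cut : gaborS (cutoff c d f g) =
  (Sfun N ampl rate alpha^-1 beta (fun k => uR (rate k) alpha^-1 c d f g) +
   Sfun N ampl rate alpha^-1 beta (fun k => uI (rate k) alpha^-1 c d f g))%E.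
Proof.
rewrite /gaborS esum_inner_gabor// /Sfun -esumD; last 2 first.
- move=> n _; apply: mule_ge0; first by rewrite lee_fin ltW.
  by apply: integral_ge0 => x _; rewrite lee_fin sqr_ge0.
- move=> n _; apply: mule_ge0; first by rewrite lee_fin ltW.
  by apply: integral_ge0 => x _; rewrite lee_fin sqr_ge0.
apply: eq_esum => n _; rewrite -ge0_muleDr; last 2 first.
- by apply: integral_ge0 => x _; rewrite lee_fin sqr_ge0.
- by apply: integral_ge0 => x _; rewrite lee_fin sqr_ge0.
have cR := continuous_PhiR N a w alpha w0 alpha0 c d f g cf cg (beta * n%:~R).
have cI := continuous_PhiI N a w alpha w0 alpha0 c d f g cf cg (beta * n%:~R).
congr (_ * _)%E; rewrite -ge0_integralD//.
- by move=> x _; rewrite lee_fin sqr_ge0.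
- apply: measurable_funTS; apply: measurable_EFin_fun; apply: continuous_measurable_fun.
  exact: continuous_expf cR.
- by move=> x _; rewrite lee_fin sqr_ge0.
- apply: measurable_funTS; apply: measurable_EFin_fun; apply: continuous_measurable_fun.
  exact: continuous_expf cI.
Qed.

Lemma L2norm2_cut_FT : L2norm2 (cutoff c d f g) =
  (\int[mu]_z (FTr c d f g z ^+ 2)%:E + \int[mu]_z (FTi c d f g z ^+ 2)%:E)%E.
Proof.
have cr := continuous_FTr c d f g cf cg; have ci := continuous_FTi c d f g cf cg.
rewrite L2norm2_cut -Plancherel// -ge0_integralD//.
- by move=> x _; rewrite lee_fin sqr_ge0.
- by apply: measurable_EFin_fun; apply: continuous_measurable_fun; ctn.
- by move=> x _; rewrite lee_fin sqr_ge0.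
- by apply: measurable_EFin_fun; apply: continuous_measurable_fun; ctn.
Qed.

End Cut.

Lemma gaborS_cut_upper : exists2 C : R, 0 <= C &
  forall c d f g, c < d -> continuous f -> continuous g ->
  (gaborS (cutoff c d f g) <= C%:E * L2norm2 (cutoff c d f g))%E.
Proof.
have [C C0 HC] := Sfun_upper N ampl rate alpha^-1 beta rate_gt0 p0 beta0.
exists C => // c d f g cd cf cg.
rewrite gaborS_cut// L2norm2_cut_FT// ge0_muleDr.
- apply: leeD; apply: HC; [exact: resolvent_eq_uR|exact: resolvent_eq_uI].
- by apply: integral_ge0 => x _; rewrite lee_fin sqr_ge0.
- by apply: integral_ge0 => x _; rewrite lee_fin sqr_ge0.
Qed.

Lemma gaborS_cut_lower : alpha * beta <= 1 -> exists2 C : R, 0 <= C &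
  forall c d f g, c < d -> continuous f -> continuous g ->
  (L2norm2 (cutoff c d f g) <= C%:E * gaborS (cutoff c d f g))%E.
Proof.
move=> ab1.
have bp : beta <= alpha^-1 by rewrite -[leRHS]mul1r ler_pdivlMr// mulrC.
have [C C0 HC] := Sfun_lower N ampl rate alpha^-1 beta ampl_gt0 rate_gt0 p0 beta0 N0 bp.
exists C => // c d f g cd cf cg.
have S0 u : (0 <= Sfun N ampl rate alpha^-1 beta u)%E.
  apply: esum_ge0 => n _; apply: mule_ge0; first by rewrite lee_fin ltW.
  by apply: integral_ge0 => x _; rewrite lee_fin sqr_ge0.
rewrite gaborS_cut// L2norm2_cut_FT// ge0_muleDr//.
by apply: leeD; apply: HC; [exact: resolvent_eq_uR|exact: resolvent_eq_uI].
Qed.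

End FrameOnCuts.

(** * Extension from truncated continuous functions to L2 *)

Section Density.
Context {R : realType}.
Notation mu := (@lebesgue_measure R).

Lemma cvge0_eventually_lt (u : nat -> \bar R) (e : R) : 0 < e ->
  u n @[n --> \oo] --> 0%E -> exists n0 : nat, forall n, (n0 <= n)%N -> (u n < e%:E)%E.
Proof.
move=> e0 /fine_cvgP[[N1 _ H1] /cvgrPdist_lt/(_ _ e0)[N2 _ H2]].
exists (maxn N1 N2) => n; rewrite geq_max => /andP[n1 n2].
have /= f1 := H1 n n1; have /= f2 := H2 n n2.
rewrite -(fineK f1) lte_fin; move: f2; rewrite sub0r normrN => h.
exact: le_lt_trans (ler_norm _) h.
Qed.

Definition clip (K x : R) : R := (`|x + K| - `|x - K|) / 2.

Lemma clip_le K x : 0 <= K -> `|clip K x| <= K.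
Proof.
move=> K0; rewrite /clip ler_norml.
by case: (ger0P (x + K)) => h1; case: (ger0P (x - K)) => h2; apply/andP; split; lra.
Qed.

Lemma clip_dist K x y : `|y| <= K -> `|y - clip K x| <= `|y - x|.
Proof.
rewrite ler_norml => /andP[y1 y2]; rewrite /clip.
case: (ger0P (x + K)) => h1; case: (ger0P (x - K)) => h2;
  case: (ger0P (y - x)) => h3; rewrite ler_norml; apply/andP; split; lra.
Qed.

Lemma continuous_clip K : continuous (clip K).
Proof. by rewrite /clip; ctn. Qed.

Definition window (n : nat) (x : R) : bool := - n%:R <= x <= n%:R.

Lemma measurable_if_window (n : nat) (h k : R -> R) :
  measurable_fun setT h -> measurable_fun setT k ->
  measurable_fun setT (fun x => if window n x then h x else k x).
Proof.
move=> mh mk; apply: (measurable_fun_ifT (f := fun x => window n x)) => //.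
have -> : (fun x => window n x) = (fun x : R => (- n%:R <= x) && (x <= n%:R)) by [].
by apply: measurable_and; apply: measurable_fun_ler => //; mtn.
Qed.

(** Cut in domain and in height: the result is integrable, and its bound [n] is used to pass from
    [L1] to [L2] approximation. *)
Let trunc (n : nat) (f : R -> R) (x : R) : R :=
  if window n x then (if `|f x| <= n%:R then f x else 0) else 0.

Let measurable_trunc n f : measurable_fun setT f -> measurable_fun setT (trunc n f).
Proof.
move=> mf; apply: measurable_if_window; last by mtn.
apply: (measurable_fun_ifT (f := fun x => `|f x| <= n%:R)) => //.
by apply: measurable_fun_ler => //; exact: measurableT_comp.
Qed.

Let trunc_cvg (f : R -> R) (e : R) : measurable_fun setT f ->
  (\int[mu]_x (f x ^+ 2)%:E < +oo)%E -> 0 < e ->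
  exists n0 : nat, forall n, (n0 <= n)%N ->
    (\int[mu]_x ((f x - trunc n f x) ^+ 2)%:E < e%:E)%E.
Proof.
move=> mf f2 e0.
have int2 : mu.-integrable setT (fun x => (f x ^+ 2)%:E).
  apply/integrableP; split; first by apply: measurable_EFin_fun; mtn.
  by under eq_integral do rewrite gee0_abs ?lee_fin ?sqr_ge0//.
have mt n := measurable_trunc n f mf.
have le n x : (f x - trunc n f x) ^+ 2 <= f x ^+ 2.
  rewrite /trunc; case: ifP => _; last by rewrite subr0.
  by case: ifP => _; rewrite ?subr0// subrr expr0n sqr_ge0.
have cv : \forall x \ae mu, [set: R] x ->
    ((f x - trunc n f x) ^+ 2)%:E @[n --> \oo] --> (0%E : \bar R).
  apply: aeW => x _; apply: cvg_near_cst.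
  exists (Num.truncn (`|x| + `|f x|)).+1 => // n /= nx.
  have h : `|x| + `|f x| < n%:R.
    by apply: lt_le_trans (truncnS_gt _) _; rewrite ler_nat.
  have wx : window n x.
    rewrite /window -ler_norml; apply: ltW; apply: le_lt_trans h.
    by rewrite lerDl.
  have fx : `|f x| <= n%:R.
    by apply: ltW; apply: le_lt_trans h; rewrite lerDr.
  by rewrite /trunc wx fx subrr expr0n.
have dom : \forall x \ae mu, forall n : nat, [set: R] x ->
    (`|((f x - trunc n f x) ^+ 2)%:E| <= (f x ^+ 2)%:E)%E.
  by apply: aeW => x n _; rewrite gee0_abs ?lee_fin ?sqr_ge0.
have mn n : measurable_fun setT (fun x => ((f x - trunc n f x) ^+ 2)%:E).
  by apply: measurable_EFin_fun; mtn.
have [_ _] := @dominated_convergence _ (measurableTypeR R) R mu setT measurableT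
  (fun n x => ((f x - trunc n f x) ^+ 2)%:E) (cst 0%E) (fun x => (f x ^+ 2)%:E)
  mn (measurable_cst _) cv int2 dom.
by rewrite integral0; exact: cvge0_eventually_lt.
Qed.

(** An [L1] approximation is upgraded. Once the approximant is clipped, both functions are bounded
    by [n] on the window, so the squared difference is at most [2 n] times the absolute one, and
    clipping does not increase the distance. *)
Let trunc_approx (n : nat) (f : R -> R) (e : R) : measurable_fun setT f -> 0 < e ->
  exists2 psi : R -> R, continuous psi &
    (\int[mu]_x ((trunc n f x - (if window n x then psi x else 0)) ^+ 2)%:E < e%:E)%E.
Proof.
move=> mf e0; have mt := measurable_trunc n f mf.
have tb x : `|trunc n f x| <= n%:R.
  by rewrite /trunc; case: ifP => _; [case: ifP => //|]; rewrite normr0 ler0n.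
pose E : set R := `[- n%:R, n%:R]%classic.
have mE : measurable E by exact: measurable_itv.
have Efin : (mu E < +oo)%E.
  by rewrite [ltLHS]lebesgue_measure_itv/= lte_fin; case: ifP; rewrite -?EFinB ltry.
have intE : mu.-integrable E (EFin \o trunc n f).
  apply: measurable_bounded_integrable => //; first exact: measurable_funTS.
  exists n%:R; split; first exact: num_real.
  by move=> y ny x _; apply: le_trans (ltW ny).
have [g_ [cg ig Hg]] := approximation_continuous_integrable mE Efin intE.
(* The [+ 1] covers [n = 0]. *)
have en0 : 0 < e / (2 * n%:R + 1) by rewrite divr_gt0// ltr_wpDl// mulr_ge0.
have [m Hm] := cvge0_eventually_lt _ _ en0 Hg.
have {}Hm := Hm m (leqnn m).
have cpsi : continuous (fun x => clip n%:R (g_ m x)).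
  exact: (continuous_compf (g_ m) (clip n%:R) (cg m) (continuous_clip _)).
exists (fun x => clip n%:R (g_ m x)) => //.
set psi := fun x => _ in cpsi *.
have mpsi := continuous_measurable_fun cpsi.
have mgm := continuous_measurable_fun (cg m).
apply: (@le_lt_trans _ _ (\int[mu]_(x in E) ((2 * n%:R) * `|trunc n f x - g_ m x|)%:E)%E).
  rewrite [leRHS]integral_mkcond; apply: ge0_le_integral => //.
  - by move=> x _; rewrite lee_fin sqr_ge0.
  - apply: measurable_EFin_fun; apply: measurable_expf; apply: measurable_addf => //.
    by apply: measurable_oppf; apply: measurable_if_window; mtn.
  - apply/(measurable_restrictT _ _).1 => //.
    apply: measurable_funTS; apply: measurable_EFin_fun; apply: measurable_mulf; first by mtn.
    by apply: measurableT_comp => //; mtn.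
  - move=> x _; rewrite /patch mem_setE in_itv/= -/(window n x).
    case: ifPn => wx; last by rewrite /trunc (negbTE wx) subrr expr0n.
    rewrite lee_fin -real_normK ?num_real// expr2; apply: ler_pM => //; last exact: clip_dist.
    rewrite (le_trans (ler_normB _ _))// mulr2n mulrDl mul1r lerD//.
    by apply: clip_le.
under eq_integral do rewrite EFinM.
rewrite ge0_integralZl_EFin//; last first.
  apply: measurable_funTS; apply: measurable_EFin_fun.
  by apply: measurableT_comp => //; mtn.
have If : (\int[mu]_(x in E) `|(trunc n f x - g_ m x)%:E| < (e / (2 * n%:R + 1))%:E)%E by [].
apply: (@le_lt_trans _ _ ((2 * n%:R)%:E * (e / (2 * n%:R + 1))%:E)%E).
  by rewrite lee_wpmul2l ?lee_fin ?mulr_ge0// ltW.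
by rewrite -EFinM lte_fin mulrCA gtr_pMr// ltr_pdivrMr ?mul1r ?ltrDl// ltr_wpDl// mulr_ge0.
Qed.

(** Every large [n] is allowed, so that the real and imaginary parts of one function can share a
    window. *)
Lemma continuous_window_dense (f : R -> R) (e : R) : measurable_fun setT f ->
  (\int[mu]_x (f x ^+ 2)%:E < +oo)%E -> 0 < e ->
  exists n0 : nat, forall n, (n0 <= n)%N ->
    exists2 psi : R -> R, continuous psi &
    (\int[mu]_x ((f x - (if window n x then psi x else 0)) ^+ 2)%:E < e%:E)%E.
Proof.
move=> mf f2 e0; have e40 : 0 < e / 4 by rewrite divr_gt0.
have [n0 H0] := trunc_cvg f _ mf f2 e40.
exists n0 => n nn0; have {}H0 := H0 n nn0.
have [psi cpsi H1] := trunc_approx n f _ mf e40.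
exists psi => //.
have mt := measurable_trunc n f mf.
have mpsi := continuous_measurable_fun cpsi.
have mw : measurable_fun setT (fun x => if window n x then psi x else 0).
  by apply: measurable_if_window; mtn.
apply: (@le_lt_trans _ _ (\int[mu]_x ((2 * (f x - trunc n f x) ^+ 2)%:E +
   (2 * (trunc n f x - (if window n x then psi x else 0)) ^+ 2)%:E))%E).
  apply: ge0_le_integral => //.
  - by move=> x _; rewrite lee_fin sqr_ge0.
  - by apply: measurable_EFin_fun; mtn.
  - by under eq_fun do rewrite -EFinD; apply: measurable_EFin_fun; mtn.
  - move=> x _; rewrite -EFinD lee_fin.
    move: (f x) (trunc n f x) (if _ then _ else _) => u v y.
    by have := sqr_ge0 (u - v - (v - y)); lra.
rewrite ge0_integralD//; last 4 first.
- by move=> x _; rewrite lee_fin mulr_ge0// sqr_ge0.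
- by apply: measurable_EFin_fun; mtn.
- by move=> x _; rewrite lee_fin mulr_ge0// sqr_ge0.
- by apply: measurable_EFin_fun; mtn.
under eq_integral do rewrite EFinM.
rewrite ge0_integralZl_EFin//; last 2 first.
- by move=> x _; rewrite lee_fin sqr_ge0.
- by apply: measurable_EFin_fun; mtn.
under [X in (_ + X)%E]eq_integral do rewrite EFinM.
rewrite ge0_integralZl_EFin//; last 2 first.
- by move=> x _; rewrite lee_fin sqr_ge0.
- by apply: measurable_EFin_fun; mtn.
have -> : e = 2 * (e / 4) + 2 * (e / 4) by field.
rewrite [ltRHS]EFinD; apply: lteD; rewrite [ltRHS]EFinM lte_pmul2l//.
Qed.

End Density.

Section L2Facts.
Context {R : realType}.
Notation mu := (@lebesgue_measure R).
Notation Re := (@complex.Re R).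
Notation Im := (@complex.Im R).

Lemma ReD (x y : R[i]) : Re (x + y) = Re x + Re y. Proof. by case: x; case: y. Qed.
Lemma ImD (x y : R[i]) : Im (x + y) = Im x + Im y. Proof. by case: x; case: y. Qed.
Lemma ReN (x : R[i]) : Re (- x) = - Re x. Proof. by case: x. Qed.
Lemma ImN (x : R[i]) : Im (- x) = - Im x. Proof. by case: x. Qed.

Lemma L2_parts (h : R -> R[i]) : L2 h ->
  measurable_fun setT (fun t => Re (h t)) /\ measurable_fun setT (fun t => Im (h t)).
Proof. by move=> [? []]. Qed.

Lemma measurable_cabs2 (h : R -> R[i]) :
  measurable_fun setT (fun t => Re (h t)) -> measurable_fun setT (fun t => Im (h t)) ->
  measurable_fun setT (fun t => (cabs2 (h t))%:E).
Proof. by move=> m1 m2; apply: measurable_EFin_fun; rewrite /cabs2; mtn. Qed.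

Lemma cabs2_ge0 (z : R[i]) : 0 <= cabs2 z.
Proof. by rewrite addr_ge0// sqr_ge0. Qed.

Lemma cabs2D_le (x y : R[i]) : cabs2 (x + y) <= 2 * cabs2 x + 2 * cabs2 y.
Proof.
case: x => x1 x2; case: y => y1 y2; rewrite /cabs2/=.
by have := sqr_ge0 (x1 - y1); have := sqr_ge0 (x2 - y2); lra.
Qed.

Lemma L2norm2_ge0 (h : R -> R[i]) : (0 <= L2norm2 h)%E.
Proof. by apply: integral_ge0 => x _; rewrite lee_fin cabs2_ge0. Qed.

Lemma L2norm2_fin (h : R -> R[i]) : L2 h -> L2norm2 h \is a fin_num.
Proof. by move=> [_ [_ hf]]; rewrite ge0_fin_numE// L2norm2_ge0. Qed.

Lemma L2norm2D_le (h k : R -> R[i]) : L2 h -> L2 k ->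
  (L2norm2 (fun t => (h t + k t)%R) <= 2%:E * L2norm2 h + 2%:E * L2norm2 k)%E.
Proof.
move=> [h1 [h2 _]] [k1 [k2 _]].
have mh := measurable_cabs2 _ h1 h2; have mk := measurable_cabs2 _ k1 k2.
rewrite /L2norm2 -!ge0_integralZl_EFin//; [|by move=> x _; rewrite lee_fin cabs2_ge0..].
have mh' : measurable_fun setT (fun t : R => (2%:E * (cabs2 (h t))%:E)%E).
  by under eq_fun do rewrite -EFinM; apply: measurable_EFin_fun; rewrite /cabs2; mtn.
have mk' : measurable_fun setT (fun t : R => (2%:E * (cabs2 (k t))%:E)%E).
  by under eq_fun do rewrite -EFinM; apply: measurable_EFin_fun; rewrite /cabs2; mtn.
rewrite -ge0_integralD//; last 2 first.
- by move=> x _; rewrite -EFinM lee_fin mulr_ge0// cabs2_ge0.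
- by move=> x _; rewrite -EFinM lee_fin mulr_ge0// cabs2_ge0.
apply: ge0_le_integral => //.
- by move=> x _; rewrite lee_fin cabs2_ge0.
- apply: measurable_cabs2.
  + by rewrite (_ : (fun t => _) = fun t => Re (h t) + Re (k t)); [mtn|apply/funext => t; rewrite ReD].
  + by rewrite (_ : (fun t => _) = fun t => Im (h t) + Im (k t)); [mtn|apply/funext => t; rewrite ImD].
- exact: emeasurable_funD.
- by move=> x _; rewrite -!EFinM -EFinD lee_fin cabs2D_le.
Qed.

Lemma L2D (h k : R -> R[i]) : L2 h -> L2 k -> L2 (fun t => h t + k t).
Proof.
move=> Lh Lk; have [h1 h2] := L2_parts _ Lh; have [k1 k2] := L2_parts _ Lk.
split; last split.
- by rewrite (_ : (fun t => _) = fun t => Re (h t) + Re (k t)); [mtn|apply/funext => t; rewrite ReD].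
- by rewrite (_ : (fun t => _) = fun t => Im (h t) + Im (k t)); [mtn|apply/funext => t; rewrite ImD].
- apply: (le_lt_trans (L2norm2D_le _ _ Lh Lk)).
  have fh := L2norm2_fin _ Lh; have fk := L2norm2_fin _ Lk.
  by rewrite -(fineK fh) -(fineK fk) -!EFinM -EFinD ltry.
Qed.

Lemma L2N (h : R -> R[i]) : L2 h -> L2 (fun t => - h t).
Proof.
move=> [h1 [h2 h3]]; split; last split.
- by rewrite (_ : (fun t => _) = fun t => - Re (h t)); [mtn|apply/funext => t; rewrite ReN].
- by rewrite (_ : (fun t => _) = fun t => - Im (h t)); [mtn|apply/funext => t; rewrite ImN].
- apply: le_lt_trans h3; rewrite le_eqVlt; apply/orP; left; apply/eqP.
  by apply: eq_integral => x _; rewrite /cabs2 ReN ImN !sqrrN.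
Qed.

Lemma L2_cutoff (c d : R) (f g : R -> R) : continuous f -> continuous g ->
  c < d -> L2 (cutoff c d f g).
Proof.
move=> cf cg cd.
have E b : (c <= b <= d) = (b \in `[c, d]) by rewrite in_itv.
have mI (h : R -> R) : continuous h ->
    measurable_fun setT (fun t => if c <= t <= d then h t else 0).
  move=> ch; apply: (measurable_fun_ifT (f := fun t => c <= t <= d)).
  - by apply: measurable_and; apply: measurable_fun_ler => //; mtn.
  - exact: continuous_measurable_fun.
  - by mtn.
split; last split.
- rewrite (_ : (fun t => _) = fun t => if c <= t <= d then f t else 0); first exact: mI.
  by apply/funext => t; rewrite /cutoff; case: ifP.
- rewrite (_ : (fun t => _) = fun t => if c <= t <= d then g t else 0); first exact: mI.
  by apply/funext => t; rewrite /cutoff; case: ifP.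
- by rewrite -[X in (X < _)%E]/(L2norm2 _) L2norm2_cut// ltry.
Qed.

Lemma cutoff_dense (h : R -> R[i]) (e : R) : L2 h -> 0 < e ->
  exists c d f g, [/\ c < d, continuous f, continuous g &
    (L2norm2 (fun t => (h t - cutoff c d f g t)%R) < e%:E)%E].
Proof.
move=> Lh e0; have [h1 h2] := L2_parts _ Lh.
have e20 : 0 < e / 2 by rewrite divr_gt0.
have [_ [_ h3]] := Lh.
have hr : (\int[mu]_x (Re (h x) ^+ 2)%:E < +oo)%E.
  apply: le_lt_trans h3; apply: ge0_le_integral => //.
  - by move=> x _; rewrite lee_fin sqr_ge0.
  - by apply: measurable_EFin_fun; mtn.
  - exact: measurable_cabs2.
  - by move=> x _; rewrite lee_fin /cabs2 lerDl sqr_ge0.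
have hi : (\int[mu]_x (Im (h x) ^+ 2)%:E < +oo)%E.
  apply: le_lt_trans h3; apply: ge0_le_integral => //.
  - by move=> x _; rewrite lee_fin sqr_ge0.
  - by apply: measurable_EFin_fun; mtn.
  - exact: measurable_cabs2.
  - by move=> x _; rewrite lee_fin /cabs2 lerDr sqr_ge0.
have [n1 H1] := continuous_window_dense _ _ h1 hr e20.
have [n2 H2] := continuous_window_dense _ _ h2 hi e20.
(* The successor makes the window a nondegenerate segment. *)
pose n := (maxn n1 n2).+1.
have [f cf Hf] := H1 n (leqW (leq_maxl n1 n2)).
have [g cg Hg] := H2 n (leqW (leq_maxr n1 n2)).
exists (- n%:R), n%:R, f, g.
have nn : - n%:R < n%:R :> R by rewrite -subr_gt0 opprK -natrD ltr0n.
split => //.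
have mf := continuous_measurable_fun cf; have mg := continuous_measurable_fun cg.
have mwf : measurable_fun setT (fun x => if window n x then f x else 0).
  by apply: measurable_if_window; mtn.
have mwg : measurable_fun setT (fun x => if window n x then g x else 0).
  by apply: measurable_if_window; mtn.
have -> : L2norm2 (fun t => (h t - cutoff (- n%:R) n%:R f g t)%R) =
  (\int[mu]_x ((Re (h x) - (if window n x then f x else 0)) ^+ 2)%:E +
   \int[mu]_x ((Im (h x) - (if window n x then g x else 0)) ^+ 2)%:E)%E.
  rewrite -ge0_integralD//.
  - apply: eq_integral => x _; rewrite -EFinD /cabs2 ReD ImD ReN ImN /cutoff -/(window n x).
    by case: ifP.
  - by move=> x _; rewrite lee_fin sqr_ge0.
  - by apply: measurable_EFin_fun; mtn.
  - by move=> x _; rewrite lee_fin sqr_ge0.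
  - by apply: measurable_EFin_fun; mtn.
by rewrite [e]splitr [ltRHS]EFinD; exact: lteD.
Qed.

(** The arithmetic-geometric inequality with a free weight [l] plays the part of Cauchy-Schwarz. The
    bound is small as soon as [l] is large and [H] is small compared with [1 / l]. *)
Lemma cauchy_young (h k : R -> R) (H K l : R) : 0 < l ->
  measurable_fun setT h -> measurable_fun setT k ->
  (\int[mu]_x (h x ^+ 2)%:E <= H%:E)%E -> (\int[mu]_x (k x ^+ 2)%:E <= K%:E)%E ->
  mu.-integrable setT (fun x => (h x * k x)%:E) /\
  `|\int[mu]_x (h x * k x)| <= l * H + l^-1 * K.
Proof.
move=> l0 mh mk hH kK.
have le : (\int[mu]_x `|(h x * k x)%:E| <= (l * H + l^-1 * K)%:E)%E.
  apply: (@le_trans _ _ (\int[mu]_x (l%:E * (h x ^+ 2)%:E + (l^-1)%:E * (k x ^+ 2)%:E))%E).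
    apply: ge0_le_integral => //.
    - apply: measurable_EFin_fun.
      by apply: measurableT_comp => //; mtn.
    - under eq_fun do rewrite -!EFinM -EFinD.
      by apply: measurable_EFin_fun; mtn.
    - move=> x _; rewrite /= lee_fin -/(`|_|) normrM.
      have l1 : l * l^-1 = 1 by rewrite divff// gt_eqF.
      have -> : h x ^+ 2 = `|h x| ^+ 2 by rewrite real_normK ?num_real.
      have -> : k x ^+ 2 = `|k x| ^+ 2 by rewrite real_normK ?num_real.
      have hx := normr_ge0 (h x); have kx := normr_ge0 (k x).
      have : 0 <= (l * `|h x| - `|k x|) ^+ 2 / l by rewrite divr_ge0 ?sqr_ge0// ltW.
      have -> : (l * `|h x| - `|k x|) ^+ 2 / l =
         l * `|h x| ^+ 2 + l^-1 * `|k x| ^+ 2 - 2 * (`|h x| * `|k x|).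
        by field; rewrite gt_eqF.
      by have := mulr_ge0 hx kx; lra.
  rewrite ge0_integralD//.
  - rewrite !ge0_integralZl_EFin ?invr_ge0 ?(ltW l0)//.
    + by rewrite EFinD !EFinM leeD// lee_wpmul2l// lee_fin ?invr_ge0 ltW.
    + by move=> x _; rewrite lee_fin sqr_ge0.
    + by apply: measurable_EFin_fun; mtn.
    + by move=> x _; rewrite lee_fin sqr_ge0.
    + by apply: measurable_EFin_fun; mtn.
  - by move=> x _; rewrite -EFinM lee_fin mulr_ge0 ?sqr_ge0// ltW.
  - by under eq_fun do rewrite -EFinM; apply: measurable_EFin_fun; mtn.
  - by move=> x _; rewrite -EFinM lee_fin mulr_ge0 ?sqr_ge0// invr_ge0 ltW.
  - by under eq_fun do rewrite -EFinM; apply: measurable_EFin_fun; mtn.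
have int : mu.-integrable setT (fun x => (h x * k x)%:E).
  apply/integrableP; split; last exact: le_lt_trans le (ltry _).
  by apply: measurable_EFin_fun; mtn.
split => //.
rewrite -lee_fin EFin_normr_Rintegral//.
by apply: le_trans le; apply: le_abse_integral => //; case/integrableP: int.
Qed.

End L2Facts.

(** * Square integrability of the window *)

Section WindowL2.
Context {R : realType} (N : nat) (a w : 'I_N -> R).
Notation mu := (@lebesgue_measure R).
Hypothesis w0 : forall k, 0 < w k.

Lemma integral_oneDsqrV_lty : (\int[mu]_x ((1 + x ^+ 2)^-1)%:E < +oo)%E.
Proof.
rewrite ge0_symfun_integralT.
- have -> : [set x : R | 0 <= x] = `[0, +oo[%classic.
    by apply/seteqP; split => x /=; rewrite in_itv/= andbT.
  by rewrite (integral0y_oneDsqr R) -EFinM ltry.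
- by move=> x; rewrite invr_ge0 addr_ge0// sqr_ge0.
- apply: continuous_invf; first by move=> x; rewrite gt_eqF// ltr_pwDl// sqr_ge0.
  by ctn.
- by move=> x /=; rewrite sqrrN.
Qed.

Definition rwsq (t : R) : R := rwR N a w t ^+ 2 + rwI N a w t ^+ 2.

(** Up to Cauchy-Schwarz over [k], each term is [a^2 / (t^2 + w^2)], and
    [(1 + w^-2) (t^2 + w^2) >= 1 + t^2]. *)
Lemma rwsq_le : exists2 C : R, 0 <= C & forall t, rwsq t <= C * (1 + t ^+ 2)^-1.
Proof.
exists (\sum_(k < N) N%:R * (a k ^+ 2 * (1 + w k ^- 2))).
  apply: sumr_ge0 => k _; rewrite mulr_ge0// mulr_ge0 ?sqr_ge0// addr_ge0//.
  by rewrite invr_ge0 sqr_ge0.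
move=> t; rewrite /rwsq /rwR /rwI.
apply: (le_trans (lerD (sqr_sum_le _ _) (sqr_sum_le _ _))).
rewrite -mulrDr -big_split/= mulr_sumr mulr_suml; apply: ler_sum => k _.
have D0 := rw_den_gt0 N w w0 t k.
have -> : (a k * t / (t ^+ 2 + w k ^+ 2)) ^+ 2 + (a k * w k / (t ^+ 2 + w k ^+ 2)) ^+ 2 =
    a k ^+ 2 / (t ^+ 2 + w k ^+ 2) by field; rewrite gt_eqF.
rewrite -(mulrA N%:R) -(mulrA (a k ^+ 2)); apply: ler_wpM2l; first exact: ler0n.
apply: ler_wpM2l; first exact: sqr_ge0.
have E0 : 0 < 1 + t ^+ 2 by rewrite ltr_pwDl// sqr_ge0.
rewrite ler_pdivlMr// mulrC ler_pdivrMr//.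
have -> : (1 + w k ^- 2) * (t ^+ 2 + w k ^+ 2) = t ^+ 2 + w k ^+ 2 + t ^+ 2 / w k ^+ 2 + 1.
  by field; rewrite gt_eqF.
have h1 : 0 <= t ^+ 2 / w k ^+ 2 by rewrite divr_ge0 ?sqr_ge0.
by have := sqr_ge0 (w k); lra.
Qed.

Lemma continuous_rwsq : continuous rwsq.
Proof.
have c1 := continuous_rwR N a w w0; have c2 := continuous_rwI N a w w0.
by rewrite /rwsq; ctn.
Qed.

Lemma rwsq_ge0 t : 0 <= rwsq t.
Proof. by rewrite addr_ge0// sqr_ge0. Qed.

Lemma rwsq_integral : exists2 G : R, 0 <= G & (\int[mu]_x (rwsq x)%:E = G%:E)%E.
Proof.
have [C C0 HC] := rwsq_le.
have I0 : (0 <= \int[mu]_x (rwsq x)%:E)%E.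
  by apply: integral_ge0 => x _; rewrite lee_fin rwsq_ge0.
have mV : measurable_fun setT (fun x : R => (1 + x ^+ 2)^-1).
  apply: continuous_measurable_fun; apply: continuous_invf; last by ctn.
  by move=> x; rewrite gt_eqF// ltr_pwDl// sqr_ge0.
have fin : (\int[mu]_x (rwsq x)%:E < +oo)%E.
  apply: (@le_lt_trans _ _ (\int[mu]_x (C%:E * ((1 + x ^+ 2)^-1)%:E))%E).
    apply: ge0_le_integral => //.
    - by move=> x _; rewrite lee_fin rwsq_ge0.
    - by apply: measurable_EFin_fun; apply: continuous_measurable_fun; exact: continuous_rwsq.
    - by under eq_fun do rewrite -EFinM; apply: measurable_EFin_fun; mtn.
    - by move=> x _; rewrite -EFinM lee_fin.
  rewrite ge0_integralZl_EFin//.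
  - by rewrite lte_mul_pinfty// integral_oneDsqrV_lty.
  - by move=> x _; rewrite lee_fin invr_ge0 addr_ge0// sqr_ge0.
  - by apply: measurable_EFin_fun.
exists (fine (\int[mu]_x (rwsq x)%:E)); first exact: fine_ge0.
by rewrite fineK// ge0_fin_numE.
Qed.

End WindowL2.

(** * Frame bounds on [L2] by density *)

Section Extension.
Context {R : realType} (N : nat) (a w : 'I_N -> R) (alpha beta : R).
Notation mu := (@lebesgue_measure R).
Notation Re := (@complex.Re R).
Notation Im := (@complex.Im R).
Hypotheses (a0 : forall k, 0 < a k) (w0 : forall k, 0 < w k).
Hypotheses (alpha0 : 0 < alpha) (beta0 : 0 < beta) (N0 : (0 < N)%N).

Notation atom m n := (gabor_atom (rat_window a w) alpha beta m n).
Notation S := (gaborS N a w alpha beta).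

Let th (n : int) t : R := 2 * pi * beta * n%:~R * t.
Let AR m n t := cos (th n t) * rwR N a w (t - alpha * m%:~R) - sin (th n t) * rwI N a w (t - alpha * m%:~R).
Let AI m n t := cos (th n t) * rwI N a w (t - alpha * m%:~R) + sin (th n t) * rwR N a w (t - alpha * m%:~R).

Let atomE m n t : atom m n t = Complex (AR m n t) (AI m n t).
Proof. by rewrite /gabor_atom rat_windowE. Qed.

Let Asq m n t : AR m n t ^+ 2 + AI m n t ^+ 2 = rwsq N a w (t - alpha * m%:~R).
Proof.
rewrite /AR /AI /rwsq; have := cos2Dsin2 (th n t).
move: (cos _) (sin _) (rwR _ _ _ _) (rwI _ _ _ _) => c s x y cs.
have -> : (c * x - s * y) ^+ 2 + (c * y + s * x) ^+ 2 = (c ^+ 2 + s ^+ 2) * (x ^+ 2 + y ^+ 2) by ring.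
by rewrite cs mul1r.
Qed.

Let cAR m n : continuous (AR m n).
Proof.
have c1 := continuous_rwR N a w w0; have c2 := continuous_rwI N a w w0.
by rewrite /AR /th; ctn.
Qed.

Let cAI m n : continuous (AI m n).
Proof.
have c1 := continuous_rwR N a w w0; have c2 := continuous_rwI N a w w0.
by rewrite /AI /th; ctn.
Qed.

Let atom_sq : exists2 G : R, 0 <= G & forall m n,
  (\int[mu]_x (AR m n x ^+ 2)%:E <= G%:E)%E /\ (\int[mu]_x (AI m n x ^+ 2)%:E <= G%:E)%E.
Proof.
have [G G0 HG] := rwsq_integral N a w w0; exists G => // m n.
have mq : measurable_fun setT (fun x => (rwsq N a w x)%:E).
  by apply: measurable_EFin_fun; apply: continuous_measurable_fun; exact: continuous_rwsq.
have mqs : measurable_fun setT (fun x : R => (rwsq N a w (x - alpha * m%:~R))%:E).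
  exact: (measurableT_comp mq (measurable_shiftr (- (alpha * m%:~R)))).
rewrite -HG -(ge0_integral_shift (- (alpha * m%:~R)) (fun x => (rwsq N a w x)%:E))//; last first.
  by move=> x; rewrite lee_fin rwsq_ge0.
have m1 := continuous_measurable_fun (cAR m n); have m2 := continuous_measurable_fun (cAI m n).
split; apply: ge0_le_integral => //.
- by move=> x _; rewrite lee_fin sqr_ge0.
- by apply: measurable_EFin_fun; mtn.
- by move=> x _; rewrite lee_fin -(Asq m n) lerDl sqr_ge0.
- by move=> x _; rewrite lee_fin sqr_ge0.
- by apply: measurable_EFin_fun; mtn.
- by move=> x _; rewrite lee_fin -(Asq m n) lerDr sqr_ge0.
Qed.

Let innerE (h : R -> R[i]) m n : inner h (atom m n) =
  Complex (\int[mu]_t (Re (h t) * AR m n t + Im (h t) * AI m n t))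
          (\int[mu]_t (Im (h t) * AR m n t - Re (h t) * AI m n t)).
Proof.
congr (Complex _ _); apply: eq_Rintegral => t _; rewrite atomE; case: (h t) => x y /=.
  by rewrite mulrN opprK.
by rewrite mulrN addrC.
Qed.

Let L2_sq (h : R -> R[i]) : L2 h ->
  (\int[mu]_x (Re (h x) ^+ 2)%:E <= (fine (L2norm2 h))%:E)%E /\
  (\int[mu]_x (Im (h x) ^+ 2)%:E <= (fine (L2norm2 h))%:E)%E.
Proof.
move=> Lh; have [h1 h2] := L2_parts _ Lh; rewrite fineK ?L2norm2_fin//.
have mh := measurable_cabs2 _ h1 h2.
split; apply: ge0_le_integral => //.
- by move=> x _; rewrite lee_fin sqr_ge0.
- by apply: measurable_EFin_fun; mtn.
- by move=> x _; rewrite lee_fin /cabs2 lerDl sqr_ge0.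
- by move=> x _; rewrite lee_fin sqr_ge0.
- by apply: measurable_EFin_fun; mtn.
- by move=> x _; rewrite lee_fin /cabs2 lerDr sqr_ge0.
Qed.

Let integrable_parts (h : R -> R[i]) m n : L2 h ->
  [/\ mu.-integrable setT (fun t => (Re (h t) * AR m n t)%:E),
      mu.-integrable setT (fun t => (Im (h t) * AI m n t)%:E),
      mu.-integrable setT (fun t => (Im (h t) * AR m n t)%:E) &
      mu.-integrable setT (fun t => (Re (h t) * AI m n t)%:E)].
Proof.
move=> Lh; have [h1 h2] := L2_parts _ Lh; have [s1 s2] := L2_sq h Lh.
have [G G0 HG] := atom_sq; have [g1 g2] := HG m n.
have m1 := continuous_measurable_fun (cAR m n); have m2 := continuous_measurable_fun (cAI m n).
split.
- by have [] := cauchy_young _ _ _ _ 1 ltr01 h1 m1 s1 g1.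
- by have [] := cauchy_young _ _ _ _ 1 ltr01 h2 m2 s2 g2.
- by have [] := cauchy_young _ _ _ _ 1 ltr01 h2 m1 s2 g1.
- by have [] := cauchy_young _ _ _ _ 1 ltr01 h1 m2 s1 g2.
Qed.

(** Continuity of the coefficients at [0], uniform in [m] and [n]. Real and imaginary parts are each
    a combination of two integrals, contributing [4] apiece to the factor [8]. *)
Let inner_bound : exists2 G : R, 0 <= G & forall (h : R -> R[i]) m n (H l : R), L2 h ->
  (L2norm2 h <= H%:E)%E -> 0 < l -> cabs2 (inner h (atom m n)) <= 8 * (l * H + l^-1 * G) ^+ 2.
Proof.
have [G G0 HG] := atom_sq; exists G => // h m n H l Lh hH l0.
have [h1 h2] := L2_parts _ Lh; have [s1 s2] := L2_sq h Lh.
have hH' : ((fine (L2norm2 h))%:E <= H%:E)%E by rewrite fineK// L2norm2_fin.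
have {}s1 := le_trans s1 hH'; have {}s2 := le_trans s2 hH'.
have [g1 g2] := HG m n.
have m1 := continuous_measurable_fun (cAR m n); have m2 := continuous_measurable_fun (cAI m n).
have [i1 b1] := cauchy_young _ _ _ _ l l0 h1 m1 s1 g1.
have [i2 b2] := cauchy_young _ _ _ _ l l0 h2 m2 s2 g2.
have [i3 b3] := cauchy_young _ _ _ _ l l0 h2 m1 s2 g1.
have [i4 b4] := cauchy_young _ _ _ _ l l0 h1 m2 s1 g2.
rewrite innerE /cabs2/= RintegralD// RintegralB//.
move: b1 b2 b3 b4; set X := l * H + l^-1 * G.
move: (Rintegral _ _ _) (Rintegral _ _ _) (Rintegral _ _ _) (Rintegral _ _ _) => x1 x2 x3 x4 b1 b2 b3 b4.
have sq y z : `|y| <= X -> `|z| <= X -> (y + z) ^+ 2 <= 4 * X ^+ 2.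
  move=> yX zX; have : `|y + z| <= 2 * X.
    by rewrite (le_trans (ler_normD _ _))//; lra.
  have X0 := le_trans (normr_ge0 _) yX.
  move=> h3; rewrite -real_normK ?num_real//.
  have -> : 4 * X ^+ 2 = (2 * X) ^+ 2 by ring.
  by rewrite ler_sqr ?nnegrE// mulr_ge0.
have h3 := sq _ _ b1 b2.
move: b4; rewrite -normrN => b4; have h4 := sq _ _ b3 b4.
lra.
Qed.

Let innerD (h k : R -> R[i]) m n : L2 h -> L2 k ->
  inner (fun t => h t + k t) (atom m n) = inner h (atom m n) + inner k (atom m n).
Proof.
move=> Lh Lk.
have [i1 i2 i3 i4] := integrable_parts h m n Lh.
have [j1 j2 j3 j4] := integrable_parts k m n Lk.
have s1 := integrableD measurableT i1 i2; have t1 := integrableD measurableT j1 j2.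
have s2 := integrableB measurableT i3 i4; have t2 := integrableB measurableT j3 j4.
rewrite !innerE; apply/eqP; rewrite eq_complex/=; apply/andP; split; apply/eqP.
- rewrite -RintegralD//; apply: eq_Rintegral => t _; rewrite ReD ImD; ring.
- rewrite -RintegralD//; apply: eq_Rintegral => t _; rewrite ReD ImD; ring.
Qed.

Lemma gaborS_ge0 h : (0 <= S h)%E.
Proof. by apply: esum_ge0 => mn _; rewrite lee_fin cabs2_ge0. Qed.

Lemma gaborS_addle (h k : R -> R[i]) : L2 h -> L2 k ->
  (S (fun t => (h t + k t)%R) <= S h + S h + (S k + S k))%E.
Proof.
move=> Lh Lk; rewrite /gaborS -!esumD; try by move=> mn _; rewrite ?adde_ge0// lee_fin cabs2_ge0.
apply: le_esum => mn _; rewrite -!EFinD lee_fin innerD//.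
by apply: (le_trans (cabs2D_le _ _)); lra.
Qed.

(** Only finite sums over [s] are compared. For a given [s], a remainder of small enough norm is
    negligible by [inner_bound]; how small depends on [s], but the constant does not. The factor [4]
    comes from two uses of [|x + y|^2 <= 2 |x|^2 + 2 |y|^2]. *)
Theorem gaborS_upper : exists2 C : R, 0 <= C & forall h, L2 h ->
  (S h <= C%:E * L2norm2 h)%E.
Proof.
have [C C0 HC] := gaborS_cut_upper N a w alpha beta w0 alpha0 beta0.
have [G G0 HG] := inner_bound.
exists (4 * C); first by rewrite mulr_ge0.
move=> h Lh; have fh := L2norm2_fin h Lh.
rewrite -(fineK fh); set n2 := fine (L2norm2 h).
rewrite -EFinM; apply: esum_le_seq => s us.
apply/ler_addgt0Pr => e e0.
pose L : R := (size s)%:R.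
have L0 : 0 <= L by exact: ler0n.
(* With [l X = 2 (G + 1)] and [l dt <= X / 2], each coefficient of the remainder
   [r] is at most [8 X^2]. *)
pose X : R := Num.min 1 (e / (32 * (L + 1))).
have X0 : 0 < X by rewrite lt_min ltr01/= divr_gt0// mulr_gt0// ltr_wpDl.
pose l := 2 * (G + 1) / X.
have l0 : 0 < l by rewrite divr_gt0// mulr_gt0// ltr_wpDl.
pose dt := Num.min (X / (2 * l)) (e / (8 * (C + 1))).
have dt0 : 0 < dt.
  by rewrite lt_min !divr_gt0// mulr_gt0// ltr_wpDl.
have [c [d [f [g [cd cf cg Hk]]]]] := cutoff_dense h dt Lh dt0.
pose k := cutoff c d f g; pose r t := h t - k t.
have Lk : L2 k by exact: L2_cutoff.
have Lr : L2 r by exact: L2D h (fun t => - k t) Lh (L2N _ Lk).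
have hkr : h = fun t => k t + r t by apply/funext => t; rewrite /r addrC subrK.
have nk : (L2norm2 k <= (2 * n2 + 2 * dt)%:E)%E.
  have -> : k = fun t => h t + - r t by apply/funext => t; rewrite /r opprB addrC subrK.
  apply: (le_trans (L2norm2D_le _ _ Lh (L2N _ Lr))).
  rewrite -(fineK fh) -/n2 -EFinM [leRHS]EFinD; apply: leeD => //.
  rewrite [leRHS]EFinM; apply: lee_wpmul2l; first by rewrite lee_fin.
  apply: le_trans (ltW Hk); rewrite le_eqVlt; apply/orP; left; apply/eqP.
  by apply: eq_integral => x _; rewrite /cabs2 ReN ImN !sqrrN.
have Sk : \sum_(mn <- s) cabs2 (inner k (atom mn.1 mn.2)) <= C * (2 * n2 + 2 * dt).
  rewrite -lee_fin EFinM.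
  apply: (@le_trans _ _ (S k)); first exact: esum_ge_seq (fun mn => cabs2 (inner k (atom mn.1 mn.2))) s us.
  by apply: (le_trans (HC c d f g cd cf cg)); apply: lee_wpmul2l; rewrite ?lee_fin.
have Sr : \sum_(mn <- s) cabs2 (inner r (atom mn.1 mn.2)) <= L * (8 * X).
  have -> : L * (8 * X) = \sum_(mn <- s) 8 * X.
    by rewrite big_const_seq count_predT iter_addr_0 /L mulr_natl.
  apply: ler_sum => mn _.
  apply: (le_trans (HG r mn.1 mn.2 dt l Lr (ltW Hk) l0)).
  rewrite ler_pM2l//.
  have H1 : l * dt <= X / 2.
    have : dt <= X / (2 * l) by rewrite ge_min lexx.
    rewrite -(ler_pM2l l0) => /le_trans; apply.
    by rewrite le_eqVlt; apply/orP; left; apply/eqP; field; rewrite gt_eqF.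
  have H2 : l^-1 * G <= X / 2.
    have G1 : 0 < G + 1 by rewrite ltr_wpDl.
    have -> : l^-1 * G = X / 2 * (G / (G + 1)).
      by rewrite /l; field; rewrite !gt_eqF.
    rewrite ler_piMr ?divr_ge0 ?(ltW X0)// ler_pdivrMr// mul1r lerDl//.
  have H0 : 0 <= l * dt + l^-1 * G by rewrite addr_ge0// mulr_ge0// ?invr_ge0 ltW.
  apply: (@le_trans _ _ (X ^+ 2)); first by rewrite ler_sqr ?nnegrE// ?(ltW X0)//; lra.
  by rewrite expr2 ler_piMl// ?(ltW X0)// ge_min lexx.
apply: (@le_trans _ _ (\sum_(mn <- s) (2 * cabs2 (inner k (atom mn.1 mn.2)) +
   2 * cabs2 (inner r (atom mn.1 mn.2))))).
  by apply: ler_sum => mn _; rewrite {1}hkr innerD// cabs2D_le.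
rewrite big_split/= -!mulr_sumr.
(* The errors are [16 L X] and [4 C dt], each at most [e / 2]. *)
have H1 : L * X <= e / 32.
  have : X <= e / (32 * (L + 1)) by rewrite ge_min lexx orbT.
  have LL : 0 < L + 1 by rewrite ltr_wpDl.
  move=> XL; apply: (@le_trans _ _ ((L + 1) * (e / (32 * (L + 1))))).
    by rewrite ler_pM// ?(ltW X0)// lerDl.
  by rewrite le_eqVlt; apply/orP; left; apply/eqP; field; rewrite gt_eqF.
have H2 : C * dt <= e / 8.
  have : dt <= e / (8 * (C + 1)) by rewrite ge_min lexx orbT.
  have CC : 0 < C + 1 by rewrite ltr_wpDl.
  move=> XL; apply: (@le_trans _ _ ((C + 1) * (e / (8 * (C + 1))))).
    by rewrite ler_pM// ?(ltW dt0)// lerDl.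
  by rewrite le_eqVlt; apply/orP; left; apply/eqP; field; rewrite gt_eqF.
lra.
Qed.

(** Since the upper bound holds on all of [L2], the frame sum of the remainder is controlled as a
    whole, and the lower bound passes from truncated functions to their limits. *)
Theorem gaborS_lower : alpha * beta <= 1 -> exists2 C : R, 0 <= C & forall h, L2 h ->
  (L2norm2 h <= C%:E * S h)%E.
Proof.
move=> ab1.
have [C1 C10 H1] := gaborS_cut_lower N a w alpha beta a0 w0 alpha0 beta0 N0 ab1.
have [C C0 HC] := gaborS_upper.
exists (4 * C1); first by rewrite mulr_ge0.
move=> h Lh; have fh := L2norm2_fin h Lh.
have fS : S h \is a fin_num.
  rewrite ge0_fin_numE ?gaborS_ge0//; apply: le_lt_trans (HC h Lh) _.
  by rewrite -(fineK fh) -EFinM ltry.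
rewrite -(fineK fS) -EFinM; apply/lee_addgt0Pr => e e0.
(* The total error is [K dt]: [2 dt] from the norm of the remainder and [4 C1 C dt] from its frame
   sum. *)
pose K := 4 * C1 * C + 2.
have K0 : 0 < K by rewrite ltr_wpDl// !mulr_ge0.
have eK0 : 0 < e / K by rewrite divr_gt0.
have [c [d [f [g [cd cf cg Hk]]]]] := cutoff_dense h _ Lh eK0.
set dt := e / K in eK0 Hk.
pose k := cutoff c d f g; pose r t := h t - k t.
have Lk : L2 k by exact: L2_cutoff.
have Lr : L2 r by exact: L2D h (fun t => - k t) Lh (L2N _ Lk).
have nr : L2norm2 (fun t => - r t) = L2norm2 r.
  by apply: eq_integral => x _; rewrite /cabs2 ReN ImN !sqrrN.
have E1 : (L2norm2 h <= 2%:E * L2norm2 k + 2%:E * L2norm2 r)%E.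
  have {1}-> : h = fun t => k t + r t by apply/funext => t; rewrite /r addrC subrK.
  exact: L2norm2D_le.
have E2 : (S k <= S h + S h + (S (fun t => (- r t)%R) + S (fun t => (- r t)%R)))%E.
  have {1}-> : k = fun t => h t + - r t by apply/funext => t; rewrite /r opprB addrC subrK.
  exact: gaborS_addle (L2N _ Lr).
have E3 := HC _ (L2N _ Lr); rewrite nr in E3.
have E4 := H1 c d f g cd cf cg.
have E5 : (L2norm2 r <= dt%:E)%E by exact: ltW.
have fk := L2norm2_fin k Lk; have fr := L2norm2_fin r Lr.
have fSk : S k \is a fin_num.
  rewrite ge0_fin_numE ?gaborS_ge0//; apply: le_lt_trans (HC k Lk) _.
  by rewrite -(fineK fk) -EFinM ltry.
have fSr : S (fun t => - r t) \is a fin_num.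
  rewrite ge0_fin_numE ?gaborS_ge0//; apply: le_lt_trans E3 _.
  by rewrite -(fineK fr) -EFinM ltry.
rewrite -/k in E4.
move: E1 E2 E3 E4 E5.
rewrite -(fineK fh) -(fineK fk) -(fineK fr) -(fineK fS) -(fineK fSk) -(fineK fSr).
rewrite -!EFinM -!EFinD !lee_fin.
set nh := fine (L2norm2 h); set nk := fine _; set nr' := fine _; set sk := fine _; set sh := fine _; set sr := fine _.
move=> E1 E2 E3 E4 E5.
have F1 : C * nr' <= C * dt by rewrite ler_wpM2l.
have F2 : nk <= C1 * (2 * sh + 2 * (C * dt)).
  by apply: (le_trans E4); rewrite ler_wpM2l//; lra.
have F3 : K * dt = e by rewrite /dt; field; rewrite gt_eqF.
move: F3; rewrite /K => F3.
have F4 : C1 * (2 * sh + 2 * (C * dt)) = 2 * (C1 * sh) + 2 * (C1 * C * dt) by ring.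
have F5 : 4 * C1 * C * dt + 2 * dt = e by rewrite -F3; ring.
move: F2; rewrite F4 => F2 /=.
lra.
Qed.

End Extension.

(** * Failure of the lower bound when alpha beta > 1 *)

Section NullResolvent.
Context {R : realType} (N : nat) (A om : 'I_N -> R) (p beta : R).
Notation mu := (@lebesgue_measure R).
Hypotheses (A0 : forall k, 0 < A k) (om0 : forall k, 0 < om k).
Hypotheses (p0 : 0 < p) (N0 : (0 < N)%N) (pb : p < beta).

Let q k := expR (- (om k * p)).
Let dd (z : R) : R := z - beta * (Num.floor (z / beta))%:~R.
(* Truncating at [p] keeps the ratio of the weights at [z] and [z + p] controlled
   where [dd] exceeds [p]. *)
Let dl z := Num.min (dd z) p.
(** The bound [beta] keeps the support of [ind] where [dd z = z >= p], out of sight of the frame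
    sum; the bound [2 p] makes [ind (z + p)] vanish for [z >= p], so that the source is [ind] itself
    there. *)
Let e := Num.min beta (2 * p).
Let ind (z : R) : R := if (p <= z) && (z < e) then 1 else 0.
Let W (y : R) := \sum_(l < N) A l * expR (- om l * y).

(** The correction is the same for every [k], as a common source requires: it subtracts the weighted
    mean of the values coming from [z + p], which annihilates the output. *)
Let step (v : 'I_N -> R -> R) (k : 'I_N) (z : R) : R :=
  if p <= z then ind z else
  q k * v k (z + p) +
  (if dd z < p then
     - ((W (dl z))^-1 * \sum_(l < N) A l * expR (- om l * dl z) * (q l * v l (z + p)))
   else 0).

(* The iterates are stationary at each [z] once [j] steps of length [p] bring
   [z] beyond [p]. *)
Let U j := iter j step (fun _ => ind).

Let b0 : 0 < beta. Proof. exact: lt_trans pb. Qed.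

Let dl_p z : 0 <= dl z <= p.
Proof.
have [_ [h _]] := modulo_beta beta b0; have /andP[h1 h2] := h z.
by rewrite le_min ge_min lexx orbT (ltW p0) -/(dd z) h1.
Qed.

Let W_gt0 y : 0 < W y.
Proof.
rewrite /W (bigD1 (Ordinal N0))//= ltr_pwDl//; first by rewrite mulr_gt0// expR_gt0.
by apply: sumr_ge0 => k _; rewrite mulr_ge0 ?expR_ge0// ltW.
Qed.

Let mdd : measurable_fun setT dd.
Proof. by have [] := modulo_beta beta b0. Qed.

Let mdl : measurable_fun setT dl.
Proof.
have -> : dl = fun z => if dd z < p then dd z else p by apply/funext => z; rewrite /dl minEge; case: ltP.
apply: (measurable_fun_ifT (f := fun z => dd z < p)).
- by apply: measurable_fun_ltr => //; mtn.
- exact: mdd.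
- by mtn.
Qed.

Let mind : measurable_fun setT ind.
Proof.
apply: (measurable_fun_ifT (f := fun z => (p <= z) && (z < e))); [|by mtn|by mtn].
by apply: measurable_and; [apply: measurable_fun_ler|apply: measurable_fun_ltr] => //; mtn.
Qed.

Let mstep v : (forall k, measurable_fun setT (v k)) -> forall k, measurable_fun setT (step v k).
Proof.
move=> mv k.
have mvp l : measurable_fun setT (fun z : R => v l (z + p)).
  exact: (measurableT_comp (mv l) (measurable_shiftr p)).
have cV : continuous (fun y => (W y)^-1).
  by apply: continuous_invf; [move=> y; rewrite gt_eqF|rewrite /W; ctn].
have mV : measurable_fun setT (fun z => (W (dl z))^-1) by exact: (measurable_compf dl _ cV mdl).
apply: (measurable_fun_ifT (f := fun z => p <= z)); [|exact: mind|].
  by apply: measurable_fun_ler => //; mtn.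
apply: measurable_addf; first by mtn.
apply: (measurable_fun_ifT (f := fun z => dd z < p)); [|by mtn|by mtn].
by apply: measurable_fun_ltr => //; mtn.
Qed.

Let mU j k : measurable_fun setT (U j k).
Proof. by elim: j k => [|j IH] k; [exact: mind|exact: mstep IH k]. Qed.

Let stepE v v' z k : p <= z \/ (forall l, v l (z + p) = v' l (z + p)) ->
  step v k z = step v' k z.
Proof.
rewrite /step; case: ifP => // _ [//|H]; rewrite H; congr (_ + _).
by case: ifP => // _; congr (- (_ * _)); apply: eq_bigr => l _; rewrite H.
Qed.

Let U_succ j z k : p <= z + p * j%:R -> U j.+1 k z = U j k z.
Proof.
elim: j z k => [|j IH] z k.
  by rewrite mulr0 addr0 => h; rewrite /U/= /step h.
move=> h; apply: stepE; case: (leP p z) => pz; [by left|right => l].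
by apply: IH; move: h; rewrite -natr1; lra.
Qed.

Let U_add j i z k : p <= z + p * j%:R -> U (j + i) k z = U j k z.
Proof.
move=> h; elim: i => [|i IH]; first by rewrite addn0.
rewrite addnS U_succ ?IH// (le_trans h)// lerD2l ler_pM2l// ler_nat leq_addr//.
Qed.

(** One successor brings the count of steps above [|z| / p]; the second carries the point from [0]
    to [p]. *)
Let J (z : R) := (Num.truncn (`|z| / p)).+2.

Let J_ge z : p <= z + p * (J z)%:R.
Proof.
have : `|z| / p < (Num.truncn (`|z| / p)).+1%:R by exact: truncnS_gt.
rewrite ltr_pdivrMr// /J -[(_.+2)%:R]natr1 => h.
have : - z <= `|z| by rewrite -normrN ler_norm.
by move: (_.+1%:R) h => x h1 h2; lra.
Qed.

Let u k z := U (J z) k z.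

Let uE j z k : p <= z + p * j%:R -> U j k z = u k z.
Proof.
move=> h; rewrite /u; case: (leqP j (J z)) => [le|/ltnW le].
  by rewrite -(subnKC le) U_add.
by rewrite -(subnKC le) U_add// J_ge.
Qed.

Let mu_ k : measurable_fun setT (u k).
Proof.
apply: (@measurable_fun_cvg _ _ R setT (fun j => U j k)) => [j|z _]; first exact: mU.
apply: cvg_near_cst; exists (J z) => // j /= Jj.
by rewrite uE// (le_trans (J_ge z))// lerD2l ler_pM2l// ler_nat.
Qed.

Let u_step z k : u k z = step u k z.
Proof.
have h : p <= z + p * (J z).+1%:R.
  by rewrite (le_trans (J_ge z))// lerD2l ler_pM2l// ler_nat.
rewrite -(uE _ _ _ h); apply: (stepE (U (J z)) u); right => l.
by apply: (uE (J z)); move: h; rewrite -natr1; lra.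
Qed.

Let dd_id x : p <= x < beta -> dd x = x.
Proof.
move=> /andP[h1 h2]; have [_ [_ h]] := modulo_beta beta b0.
have /= := h 0 x; rewrite mulr0 subr0 -/(dd x); apply.
by rewrite h2 (le_trans (ltW p0)).
Qed.

(** For [z < p] the correction in [step] cancels the weighted sum. For [z >= p] the point is outside
    the support of [ind], since [dd z = z >= p] on [[p, e[]. *)
Let out0 z : dd z < p -> \sum_(l < N) A l * expR (- om l * dl z) * u l z = 0.
Proof.
move=> dz; case: (leP p z) => pz.
  rewrite big1// => l _; rewrite u_step /step pz /ind pz/=.
  case: ifP => [ze|]; last by rewrite mulr0.
  have : dd z = z by rewrite dd_id// pz/= (lt_le_trans ze)// ge_min lexx.
  by lra.
rewrite (eq_bigr (fun l => A l * expR (- om l * dl z) * (q l * u l (z + p)) -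
   A l * expR (- om l * dl z) * ((W (dl z))^-1 * \sum_(l < N) A l * expR (- om l * dl z) * (q l * u l (z + p))))).
  rewrite sumrB -mulr_suml -/(W (dl z)) mulrA divff ?mul1r ?subrr// gt_eqF//.
by move=> l _; rewrite {1}u_step /step leNgt pz/= dz mulrDr mulrN.
Qed.

(** Read off from one index; [u_rec] shows that every index yields the same source. *)
Let F z : R := u (Ordinal N0) z - q (Ordinal N0) * u (Ordinal N0) (z + p).

Let u_rec k z : u k z = q k * u k (z + p) + F z.
Proof.
rewrite /F; case: (leP p z) => pz.
  have H l : u l z = ind z by rewrite u_step /step pz.
  have H2 l : u l (z + p) = 0.
    have pz2 : p <= z + p by move: p0; lra.
    rewrite u_step /step pz2 /ind pz2/=; case: ifP => // /lt_le_trans h.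
    by have := h (2 * p); rewrite ge_min lexx orbT => /(_ isT); lra.
  by rewrite !H !H2 !mulr0 add0r subr0.
rewrite [u k z]u_step [u (Ordinal N0) z]u_step /step leNgt pz/=.
by rewrite [X in _ = _ + X]addrAC subrr add0r.
Qed.

Let E := energy N A om dl u.

Let E0 z : 0 <= E z.
Proof.
by apply: sumr_ge0 => l _; rewrite mulr_ge0 ?sqr_ge0// mulr_ge0 ?expR_ge0// ltW.
Qed.

Let As := \sum_(l < N) A l.

(** Three cases. For [z >= p] the energy is that of [ind]. For [z < p] and [dd z < p] the output
    vanishes and [energy_step] applies. For [z < p] and [dd z >= p] the source vanishes and
    [dl z = p], so the weights at [z] are the smallest possible and do not exceed those at
    [z + p]. *)
Let E_step : exists q1, [/\ 0 <= q1, q1 < 1 & forall z, E z <= q1 * E (z + p) + As * ind z].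
Proof.
have [q1 [q10 q11 qq]] := exists_rate N om p om0 p0.
exists q1; split => // z.
have ind0 y : 0 <= ind y <= 1 by rewrite /ind; case: ifP => _; apply/andP; split.
have As0 : 0 <= As by apply: sumr_ge0 => l _; exact: ltW.
case: (leP p z) => pz.
  apply: ler_wpDl; first by rewrite mulr_ge0.
  rewrite /As mulr_suml; apply: ler_sum => l _.
  have -> : u l z = ind z by rewrite u_step /step pz.
  have /andP[i0 i1] := ind0 z; rewrite -mulrA ler_pM2l//.
  rewrite -[leRHS]mul1r ler_pM ?expR_ge0 ?sqr_ge0//; last by rewrite expr2 ler_piMr.
  by rewrite expR_le1 mulNr oppr_le0 mulr_ge0//; [exact: ltW|case/andP: (dl_p z)].
apply: ler_wpDr; first by rewrite mulr_ge0//; case/andP: (ind0 z).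
case: (ltP (dd z) p) => dz.
  have H := energy_step N A om p A0 om0 N0 dl u (F z) q1 z dl_p qq (fun k => u_rec k z).
  by apply: (le_trans H); rewrite /output out0// expr0n/= mul0r addr0.
rewrite /E /energy mulr_sumr; apply: ler_sum => l _.
have -> : dl z = p by rewrite /dl min_r.
have pzF : (p <= z) = false by rewrite leNgt pz.
have dzF : (dd z < p) = false by rewrite ltNge dz.
rewrite u_step /step pzF dzF addr0 exprMn.
have H : A l * q l <= A l * expR (- om l * dl (z + p)).
  rewrite ler_pM2l// ler_expR mulNr lerN2 ler_pM2l//.
  by case/andP: (dl_p (z + p)).
have q0 : 0 <= q l by exact: expR_ge0.
have qle := qq l.
rewrite mulNr -/(q l) -/(q l) in qle *.
rewrite [leLHS]mulrA [leRHS]mulrA; apply: ler_wpM2r; first exact: sqr_ge0.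
rewrite mulrC; apply: ler_pM => //.
- exact: sqr_ge0.
- by rewrite mulr_ge0// ltW.
- apply: le_trans qle; rewrite expr2 ler_piMr//.
  by rewrite expR_le1 oppr_le0 mulr_ge0// ltW.
Qed.

(** Induction on the number of steps needed to pass [p]; beyond [p] the bound is direct, and before
    it the energy does not increase. It yields both the bound on the [u k] and the one required by
    [decay_integral]. *)
Let E_bounded z : E z <= As.
Proof.
have [q1 [q10 q11 H]] := E_step.
have As0 : 0 <= As by apply: sumr_ge0 => l _; exact: ltW.
suff {z} G n z : p <= z + p * n%:R -> E z <= As by exact: (G (J z)) (J_ge z).
elim: n z => [|n IH] z h.
  move: h; rewrite mulr0 addr0 => pz.
  rewrite /E /energy /As; apply: ler_sum => l _.
  rewrite u_step /step pz -mulrA ler_piMr ?(ltW (A0 l))//.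
  rewrite -[leRHS]mulr1; apply: ler_pM; rewrite ?expR_ge0 ?sqr_ge0//.
    by rewrite expR_le1 mulNr oppr_le0 mulr_ge0//; [exact: ltW|case/andP: (dl_p z)].
  by rewrite /ind; case: ifP => _; rewrite ?expr1n ?expr0n.
case: (leP p z) => pz; first by apply: (IH z); rewrite ler_wpDr// mulr_ge0// ltW.
apply: (le_trans (H z)); have -> : ind z = 0 by rewrite /ind leNgt pz.
rewrite mulr0 addr0 (le_trans _ (IH (z + p) _))//; last by move: h; rewrite -natr1; lra.
by rewrite ler_piMl// ltW.
Qed.

(** The decay inequality has the source [As ind], supported in a bounded interval, so the energy is
    integrable and [F] is in [L2] by [energy_controls]. On [[p, e[] the function [F] is [1], hence
    it is not null. *)
Theorem exists_null_resolvent : exists u F, [/\ resolvent_eq N om p u F,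
  (\int[mu]_z (F z ^+ 2)%:E < +oo)%E, (0 < \int[mu]_z (F z ^+ 2)%:E)%E &
  forall (n : int) x, 0 <= x < p ->
    \sum_(k < N) A k * (expR (- om k * x) * u k (x - beta * n%:~R)) = 0].
Proof.
have mup k : measurable_fun setT (fun z : R => u k (z + p)).
  exact: (measurableT_comp (mu_ k) (measurable_shiftr p)).
have mF : measurable_fun setT F by rewrite /F; mtn.
have As0 : 0 <= As by apply: sumr_ge0 => l _; exact: ltW.
have HR : resolvent_eq N om p u F.
  split; [exact: mu_|exact: mF| |exact: u_rec].
  exists (\sum_(k < N) (1 + As / (A k * q k))) => k z.
  have Aq l : 0 < A l * q l by rewrite mulr_gt0// expR_gt0.
  have H : u k z ^+ 2 <= As / (A k * q k).
    rewrite ler_pdivlMr// mulrC.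
    exact: le_trans (energy_ge N A om p A0 om0 dl u z k (dl_p z)) (E_bounded z).
  (* Uses [|x| <= 1 + x^2] to avoid a square root. *)
  apply: (@le_trans _ _ (1 + As / (A k * q k))).
    rewrite -real_normK ?num_real// in H.
    by have := sqr_ge0 (`|u k z| - 1); have := normr_ge0 (u k z); nra.
  rewrite (bigD1 k)//= lerDl; apply: sumr_ge0 => l _.
  by rewrite addr_ge0// divr_ge0// ltW.
exists u, F; split => //.
- have [C C0 HC] := energy_controls N A om p A0 om0 p0 N0.
  apply: (le_lt_trans (HC dl u F mdl dl_p HR)).
  have [q1 [q10 q11 H]] := E_step.
  have mE : measurable_fun setT E by rewrite /E /energy; mtn.
  have EB z : 0 <= E z <= As by rewrite E0 E_bounded.
  have ind0 z : 0 <= As * ind z by rewrite mulr_ge0// /ind; case: ifP.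
  have mi : measurable_fun setT (fun z => As * ind z) by mtn.
  have D := decay_integral E (fun z => As * ind z) p q1 As q10 q11 EB ind0 mE mi H.
  rewrite -/E; apply: (@le_lt_trans _ _ (C%:E * (((1 - q1)^-1)%:E * (As * (2 * p))%:E))%E).
    rewrite lee_wpmul2l ?lee_fin//; apply: (le_trans D).
    rewrite lee_wpmul2l ?lee_fin ?invr_ge0 ?subr_ge0 ?(ltW q11)//.
    apply: (@le_trans _ _ (\int[mu]_(z in `[0%R, (2 * p)%R]) As%:E)%E).
      rewrite [leRHS]integral_mkcond; apply: ge0_le_integral => //.
      + by move=> z _; rewrite lee_fin.
      + exact: measurable_EFin_fun.
      + by apply/(measurable_restrictT _ _).1.
      + move=> z _; rewrite /patch mem_setE in_itv/= /ind.
        case: ifPn => [/andP[h1 h2]|_]; last by rewrite mulr0; case: ifP.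
        have h3 : z <= 2 * p by apply: ltW; apply: lt_le_trans h2 _; rewrite ge_min lexx orbT.
        by rewrite h3 (le_trans (ltW p0) h1)/= mulr1.
    rewrite integral_cst//= [X in (_ * X)%E]lebesgue_measure_itv/= lte_fin.
    by rewrite mulr_gt0// -EFinB subr0 -EFinM.
  by rewrite -!EFinM ltry.
- have pe : p < e by rewrite lt_min pb; move: p0; lra.
  apply: (@lt_le_trans _ _ (\int[mu]_(z in `[p, e[) (1 : R)%:E)%E).
    rewrite integral_cst//= [X in (_ * X)%E]lebesgue_measure_itv/= lte_fin pe.
    by rewrite -EFinB -EFinM mul1r lte_fin subr_gt0.
  rewrite integral_mkcond; apply: ge0_le_integral => //.
  + by move=> z _; rewrite /patch; case: ifP => _; rewrite lee_fin.
  + by apply/(measurable_restrictT _ _).1.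
  + by apply: measurable_EFin_fun; mtn.
  + move=> z _; rewrite /patch mem_setE in_itv/=.
    case: ifPn => [/andP[h1 h2]|_]; last by rewrite lee_fin sqr_ge0.
    have : u (Ordinal N0) z = 1 by rewrite u_step /step h1 /ind h1 h2.
    have : u (Ordinal N0) (z + p) = 0.
      have h4 : p <= z + p by move: p0; lra.
      rewrite u_step /step h4 /ind h4/=; case: ifP => // /lt_le_trans h.
      by have := h (2 * p); rewrite ge_min lexx orbT => /(_ isT); lra.
    by rewrite /F => -> ->; rewrite mulr0 subr0 expr1n.
- move=> n x /andP[x0 xp].
  have [_ [_ h]] := modulo_beta beta b0.
  have dx : dd (x - beta * n%:~R) = x by apply: h; rewrite x0 (lt_trans xp).
  have dx' : dl (x - beta * n%:~R) = x by rewrite /dl dx min_l// ltW.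
  have := out0 (x - beta * n%:~R); rewrite dx' dx => /(_ xp) H.
  by rewrite -[RHS]H; apply: eq_bigr => l _; rewrite mulrA.
Qed.

(** Subtracting the null solution [v0] from [v] leaves [Sfun] unchanged, and the difference solves
    the recursion with source [G - F], to which the upper bound applies. A spectrum close to [F]
    thus has a small frame sum although its norm is not small. *)
Theorem Sfun_no_lower : exists F : R -> R, [/\ measurable_fun setT F,
  (\int[mu]_z (F z ^+ 2)%:E < +oo)%E, (0 < \int[mu]_z (F z ^+ 2)%:E)%E &
  exists2 C : R, 0 <= C & forall v G, resolvent_eq N om p v G ->
    (Sfun N A om p beta v <= C%:E * \int[mu]_z ((G z - F z) ^+ 2)%:E)%E].
Proof.
have [v0 [F0 [HR F2 Fpos H]]] := exists_null_resolvent.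
have [m1 m2 [B1 HB1] rec1] := HR.
exists F0; split => //.
have [C C0 HC] := Sfun_upper N A om p beta om0 p0 b0.
exists C => // v G [m3 m4 [B2 HB2] rec2].
have -> : Sfun N A om p beta v = Sfun N A om p beta (fun k z => v k z - v0 k z).
  apply: eq_esum => n _; congr (_ * _)%E; apply: eq_integral => x.
  rewrite inE/= in_itv/= => xp; congr (_ ^+ 2)%:E.
  rewrite -[LHS]subr0 -[X in _ - X](H n x xp) -sumrB; apply: eq_bigr => k _; ring.
apply: HC; split.
- by move=> k; have := m1 k; have := m3 k => ? ?; mtn.
- by mtn.
- by exists (B2 + B1) => k z; rewrite (le_trans (ler_normB _ _))// lerD.
- by move=> k z; rewrite rec1 rec2; ring.
Qed.

End NullResolvent.

(** * Approximation of real spectra by transforms of truncated functions *)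

Section FourierDense.
Context {R : realType}.
Notation mu := (@lebesgue_measure R).

Section Inversion.
Variables (a b : R) (psi : R -> R).
Hypotheses (ab : a < b) (cpsi : continuous psi).

Let zero : R -> R := fun=> 0.
(* [f + i g] is the inverse Fourier transform of [psi] restricted to [[a, b]]. *)
Let f := FTr a b psi zero.
Let g t := - FTi a b psi zero t.
Let S := \int[mu]_(z in `[a, b]) psi z ^+ 2.

Let czero : continuous zero. Proof. by rewrite /zero; ctn. Qed.
Let cf : continuous f. Proof. exact: continuous_FTr. Qed.
Let cg : continuous g.
Proof. by have c := continuous_FTi a b psi zero cpsi czero; rewrite /g; ctn. Qed.

Let norm_sqr (t : R) : 0 <= f t ^+ 2 + g t ^+ 2.
Proof. by rewrite addr_ge0// sqr_ge0. Qed.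

Let spectrum_sqr : (\int[mu]_t (f t ^+ 2 + g t ^+ 2)%:E = S%:E)%E.
Proof.
transitivity (\int[mu]_t (FTr a b psi zero t ^+ 2 + FTi a b psi zero t ^+ 2)%:E)%E.
  by apply: eq_integral => t _; rewrite /g sqrrN.
rewrite Plancherel//; congr EFin; apply: cint_eq => t _.
by rewrite /zero expr0n addr0.
Qed.

(** Fubini: integrating over [z] first turns [psi] back into its own transform, which is
    [f - i g]. *)
Let cross K : 0 < K -> \int[mu]_(z in `[a, b]) (psi z * FTr (- K) K f g z) =
  \int[mu]_(t in `[- K, K]) (f t ^+ 2 + g t ^+ 2).
Proof.
move=> K0.
transitivity (\int[mu]_(z in `[a, b]) \int[mu]_(t in `[- K, K])
   (psi z * (f t * cos (2 * pi * z * t) - g t * sin (2 * pi * z * t)))).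
  apply: cint_eq => z _; rewrite [RHS]cintZ//.
  by ctn.
have KK : - K <= K by lra.
have [B1 B10 H1] := continuous_bounded_segment a b psi cpsi.
have [B2 B20 H2] := continuous_bounded_segment (- K) K f cf.
have [B3 B30 H3] := continuous_bounded_segment (- K) K g cg.
rewrite (cint_swap (- K) K a b
   (fun z t => psi z * (f t * cos (2 * pi * z * t) - g t * sin (2 * pi * z * t)))
   (B1 * (B2 + B3)) KK (ltW ab)); last 2 first.
- by mtn.
- move=> z t zab tK; rewrite normrM ler_pM ?H1//.
  rewrite (le_trans (ler_normB _ _))// !normrM lerD//.
    by rewrite -[leRHS]mulr1 ler_pM// ?H2// ler_norml cos_geN1 cos_le1.
  by rewrite -[leRHS]mulr1 ler_pM// ?H3// ler_norml sin_geN1 sin_le1.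
apply: cint_eq => t _.
have -> : f t ^+ 2 + g t ^+ 2 = f t * FTr a b psi zero t + - g t * FTi a b psi zero t.
  by rewrite /g -/(f t); ring.
rewrite -!cintZ; [|by ctn..].
rewrite -cintD; [|by ctn..].
apply: cint_eq => z _; have -> : 2 * pi * z * t = 2 * pi * t * z by rewrite mulrAC.
by rewrite /zero; tring.
Qed.

(* By [cross], truncating the inverse transform to [[- K, K]] is an orthogonal
   projection. *)
Lemma Fourier_inversion_error K : 0 < K ->
  (\int[mu]_z ((FTr (- K) K f g z - (if a <= z <= b then psi z else 0)) ^+ 2
      + FTi (- K) K f g z ^+ 2)%:E =
   (S - \int[mu]_(t in `[- K, K]) (f t ^+ 2 + g t ^+ 2))%:E)%E.
Proof.
move=> K0; have KK : - K < K by lra.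
have cr := continuous_FTr (- K) K f g cf cg.
have ci := continuous_FTi (- K) K f g cf cg.
set r := FTr _ _ _ _ in cr *; set i := FTi _ _ _ _ in ci *.
set P := \int[mu]_(t in _) _.
have cV : continuous (fun z => 2 * (psi z * r z)) by ctn.
have cQ : continuous (fun z => psi z ^+ 2) by ctn.
pose V := (fun z => (2 * (psi z * r z))%:E) \_ `[a, b].
pose Q := (fun z => (psi z ^+ 2)%:E) \_ `[a, b].
have iV : mu.-integrable setT V by rewrite -integrable_mkcond//; exact: continuous_integrable.
have iQ : mu.-integrable setT Q by rewrite -integrable_mkcond//; exact: continuous_integrable.
have IV : (\int[mu]_z V z = (2 * P)%:E)%E.
  by rewrite -integral_mkcond -EFin_cint// cintZ//; [rewrite /P -cross|ctn].
have IQ : (\int[mu]_z Q z = S%:E)%E by rewrite -integral_mkcond -EFin_cint.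
pose U z := r z ^+ 2 + i z ^+ 2.
have U0 z : 0 <= U z by rewrite addr_ge0// sqr_ge0.
have IU : (\int[mu]_z (U z)%:E = P%:E)%E by exact: Plancherel.
have iU : mu.-integrable setT (fun z => (U z)%:E).
  apply/integrableP; split.
    by apply: measurable_EFin_fun; apply: continuous_measurable_fun; rewrite /U; ctn.
  by under eq_integral do rewrite gee0_abs ?lee_fin//; rewrite IU ltry.
transitivity (\int[mu]_z ((U z)%:E - V z + Q z))%E.
  apply: eq_integral => z _; rewrite /V /Q /patch mem_setE in_itv/=.
  case: ifP => _; last by rewrite subr0 -EFinB subr0 adde0.
  rewrite -EFinB -EFinD.
  by rewrite /U; congr EFin; ring.
rewrite integralD//; last exact: integrableB.
by rewrite integralB// IU IV IQ -EFinB -EFinD; congr EFin; ring.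
Qed.

(** By Plancherel [S] is the total energy of [f + i g], and the energies on [[-n, n]] increase to
    it. *)
Lemma Fourier_inversion_cvg e : 0 < e -> exists2 K, 0 < K &
  S - \int[mu]_(t in `[- K, K]) (f t ^+ 2 + g t ^+ 2) < e.
Proof.
move=> e0.
have cn : continuous (fun t => f t ^+ 2 + g t ^+ 2) by ctn.
pose F (n : nat) : set R := `[- n%:R, n%:R]%classic.
have H := @ge0_nondecreasing_set_cvg_integral _ (measurableTypeR R) R F
  (fun t => (f t ^+ 2 + g t ^+ 2)%:E) mu.
have FT : \bigcup_n F n = setT.
  apply/seteqP; split => // t _; exists (Num.truncn `|t|).+1 => //=.
  by rewrite /F/= in_itv/= -ler_norml ltW// truncnS_gt.
have := H _ _ _ _; rewrite FT spectrum_sqr => {}H.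
have {}H : ((\int[mu]_(t in F n) (f t ^+ 2 + g t ^+ 2)%:E)%E @[n --> \oo] --> S%:E).
  apply: H => //.
  - move=> m n mn; rewrite /F subsetEset => t /=; rewrite !in_itv/= -!ler_norml => h.
    by rewrite (le_trans h)// ler_nat.
  - by move=> n; exact: measurable_itv.
  - by move=> n; apply: measurable_funTS; apply: measurable_EFin_fun; exact: continuous_measurable_fun.
  - by move=> n t _; rewrite lee_fin.
move: H => /fine_cvgP[_ /cvgrPdist_lt/(_ _ e0)[n0 _ H]].
exists n0.+1%:R; first by rewrite ltr0n.
have /= := H n0.+1 (leqnSn n0); rewrite /F -EFin_cint//=.
by move=> h; apply: le_lt_trans h; exact: ler_norm.
Qed.

End Inversion.

(** The target spectrum is real, so the imaginary part of the transform must tend to zero as well.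
    [F] is first replaced by a truncated continuous [psi], whose truncated inverse transform is then
    taken back. *)
Theorem Fourier_cutoff_dense (F : R -> R) (e : R) : measurable_fun setT F ->
  (\int[mu]_z (F z ^+ 2)%:E < +oo)%E -> 0 < e ->
  exists K f g, [/\ 0 < K, continuous f, continuous g &
    (\int[mu]_z ((FTr (- K) K f g z - F z) ^+ 2)%:E +
     \int[mu]_z (FTi (- K) K f g z ^+ 2)%:E < e%:E)%E].
Proof.
move=> mF F2 e0; have e40 : 0 < e / 4 by rewrite divr_gt0.
have [n0 Hn] := continuous_window_dense F (e / 4) mF F2 e40.
have [psi cpsi Hpsi] := Hn n0.+1 (leqnSn n0).
set b : R := n0.+1%:R in Hpsi; have b0 : 0 < b by rewrite ltr0n.
have bb : - b < b by lra.
have [K K0 HK] := Fourier_inversion_cvg (- b) b psi bb cpsi _ e40.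
have HE := Fourier_inversion_error (- b) b psi bb cpsi K K0.
set f := FTr (- b) b _ _ in HK HE; set g := fun t => - FTi (- b) b _ _ t in HK HE.
have cz : continuous (fun _ : R => 0 : R) by ctn.
have cf : continuous f by exact: continuous_FTr.
have cg : continuous g by have c := continuous_FTi (- b) b psi _ cpsi cz; rewrite /g; ctn.
exists K, f, g; split => //.
have mr := continuous_measurable_fun (continuous_FTr (- K) K f g cf cg).
have mi := continuous_measurable_fun (continuous_FTi (- K) K f g cf cg).
set r := FTr _ _ _ _ in mr HE *; set i := FTi _ _ _ _ in mi HE *.
pose G z := if window n0.+1 z then psi z else 0.
have mG : measurable_fun setT G.
  by apply: measurable_if_window; [exact: continuous_measurable_fun|mtn].
rewrite -ge0_integralD//; last 4 first.
- by move=> x _; rewrite lee_fin sqr_ge0.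
- by apply: measurable_EFin_fun; mtn.
- by move=> x _; rewrite lee_fin sqr_ge0.
- by apply: measurable_EFin_fun; mtn.
apply: (@le_lt_trans _ _ (\int[mu]_z (2%:E * ((r z - G z) ^+ 2 + i z ^+ 2)%:E +
   2%:E * ((F z - G z) ^+ 2)%:E))%E).
  apply: ge0_le_integral => //.
  - by move=> x _; rewrite -EFinD lee_fin addr_ge0// sqr_ge0.
  - by under eq_fun do rewrite -EFinD; apply: measurable_EFin_fun; mtn.
  - by under eq_fun do rewrite -!EFinM -EFinD; apply: measurable_EFin_fun; mtn.
  - move=> z _; rewrite -!EFinM -!EFinD lee_fin.
    move: (r z) (G z) (F z) => x y v.
    by have := sqr_ge0 (x - y + (v - y)); have := sqr_ge0 (i z); lra.
rewrite ge0_integralD//; last 4 first.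
- by move=> x _; rewrite -EFinM lee_fin mulr_ge0// addr_ge0// sqr_ge0.
- by under eq_fun do rewrite -EFinM; apply: measurable_EFin_fun; mtn.
- by move=> x _; rewrite -EFinM lee_fin mulr_ge0// sqr_ge0.
- by under eq_fun do rewrite -EFinM; apply: measurable_EFin_fun; mtn.
rewrite !ge0_integralZl_EFin//; last 4 first.
- by move=> x _; rewrite lee_fin sqr_ge0.
- by apply: measurable_EFin_fun; mtn.
- by move=> x _; rewrite lee_fin addr_ge0// sqr_ge0.
- by apply: measurable_EFin_fun; mtn.
have -> : e = 2 * (e / 4) + 2 * (e / 4) by field.
rewrite [ltRHS]EFinD; apply: lteD; rewrite [ltRHS]EFinM lte_pmul2l//.
by rewrite HE lte_fin.
Qed.

End FourierDense.

(** The real part of the transform is taken close to [F], where [Sfun_no_lower] makes its frame sum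
    small; the imaginary part is close to [0] and is handled by the upper bound. *)
Lemma gaborS_no_lower {R : realType} (N : nat) (a w : 'I_N -> R) (alpha beta A : R) :
  (0 < N)%N -> (forall k, 0 < a k) -> (forall k, 0 < w k) -> 0 < alpha -> 0 < beta ->
  1 < alpha * beta -> 0 < A ->
  exists2 h, L2 h & (gaborS N a w alpha beta h < A%:E * L2norm2 h)%E.
Proof.
move=> N0 a0 w0 al0 b0 ab A0.
have p0 : 0 < alpha^-1 by rewrite invr_gt0.
have pb : alpha^-1 < beta by rewrite -[ltLHS]mul1r ltr_pdivrMr// mulrC.
have rate0 := rate_gt0 N w w0.
have [F [mF F2 Fpos [C1 C10 H1]]] := Sfun_no_lower N (ampl N a) (rate N w) alpha^-1 beta
  (ampl_gt0 N a a0) rate0 p0 N0 pb.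
have [C2 C20 H2] := Sfun_upper N (ampl N a) (rate N w) alpha^-1 beta rate0 p0 b0.
have fF : (\int[lebesgue_measure]_z (F z ^+ 2)%:E)%E \is a fin_num.
  by rewrite ge0_fin_numE// ltW.
rewrite -(fineK fF) lte_fin in Fpos.
set I := fine _ in Fpos.
have K0 : 0 < A + C1 + C2 by rewrite -addrA ltr_pwDl// addr_ge0.
(* With errors [X + Y < e], the frame sum is at most [C1 X + C2 Y], and the squared norm is at least
   [I / 2 - X + Y]. The choice makes [(A + C1 + C2) e] equal to [A I / 4], which is below
   [A I / 2]. *)
pose e := A * I / (4 * (A + C1 + C2)).
have e0 : 0 < e by rewrite divr_gt0 ?mulr_gt0.
have [K [f [g [KK cf cg He]]]] := Fourier_cutoff_dense F e mF F2 e0.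
have cd : - K < K by lra.
have Lh := L2_cutoff (- K) K f g cf cg cd.
exists (cutoff (- K) K f g) => //.
have HR := H1 _ _ (resolvent_eq_uR N w alpha w0 al0 (- K) K f g cf cg).
have HI := H2 _ _ (resolvent_eq_uI N w alpha w0 al0 (- K) K f g cf cg).
have fh := L2norm2_fin _ Lh.
rewrite gaborS_cut//; apply: (le_lt_trans (leeD HR HI)).
move: fh; rewrite L2norm2_cut_FT//.
have mr := continuous_measurable_fun (continuous_FTr (- K) K f g cf cg).
have mi := continuous_measurable_fun (continuous_FTi (- K) K f g cf cg).
set r := FTr _ _ _ _ in mr He *; set i := FTi _ _ _ _ in mi He *.
have sq0 (h : R -> R) : (0 <= \int[lebesgue_measure]_z (h z ^+ 2)%:E)%E.
  by apply: integral_ge0 => z _; rewrite lee_fin sqr_ge0.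
have HF : (\int[lebesgue_measure]_z (F z ^+ 2)%:E <=
    2%:E * \int[lebesgue_measure]_z (r z ^+ 2)%:E +
    2%:E * \int[lebesgue_measure]_z ((r z - F z) ^+ 2)%:E)%E.
  rewrite -!ge0_integralZl_EFin//; last 4 first.
  - by move=> x _; rewrite lee_fin sqr_ge0.
  - by apply: measurable_EFin_fun; mtn.
  - by move=> x _; rewrite lee_fin sqr_ge0.
  - by apply: measurable_EFin_fun; mtn.
  rewrite -ge0_integralD//; last 4 first.
  - by move=> x _; rewrite -EFinM lee_fin mulr_ge0// sqr_ge0.
  - by under eq_fun do rewrite -EFinM; apply: measurable_EFin_fun; mtn.
  - by move=> x _; rewrite -EFinM lee_fin mulr_ge0// sqr_ge0.
  - by under eq_fun do rewrite -EFinM; apply: measurable_EFin_fun; mtn.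
  apply: ge0_le_integral => //.
  - by move=> z _; rewrite lee_fin sqr_ge0.
  - by apply: measurable_EFin_fun; mtn.
  - by under eq_fun do rewrite -!EFinM -EFinD; apply: measurable_EFin_fun; mtn.
  - move=> z _; rewrite -!EFinM -EFinD lee_fin.
    move: (r z) (F z) => x y.
    by have := sqr_ge0 (x + (x - y)); lra.
have := sq0 r; have := sq0 i; have := sq0 (fun z => r z - F z).
rewrite -(fineK fF) -/I in HF; move: He HF.
move: (\int[lebesgue_measure]_z ((r z - F z) ^+ 2)%:E)%E => X; move: (\int[lebesgue_measure]_z (r z ^+ 2)%:E)%E => Rn.
move: (\int[lebesgue_measure]_z (i z ^+ 2)%:E)%E => Y.
case: X Y Rn => [X| |] [Y| |] [Rn| |]//.
rewrite -!EFinM -!EFinD -?EFinM !lee_fin !lte_fin => He HF X0 Y0 R0 _.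
have E1 : C1 * X <= C1 * e by rewrite ler_wpM2l//; lra.
have E2 : C2 * Y <= C2 * e by rewrite ler_wpM2l//; lra.
have E3 : A * X <= A * e by rewrite ler_pM2l//; lra.
have E4 : A * I <= 2 * (A * Rn) + 2 * (A * X).
  have : A * I <= A * (2 * Rn + 2 * X) by rewrite ler_pM2l.
  by rewrite mulrDr (mulrCA A) (mulrCA A 2).
have E5 : A * e + C1 * e + C2 * e = A * I / 4.
  by rewrite /e; field; rewrite gt_eqF.
have E6 : 0 < A * I by rewrite mulr_gt0.
have E7 : 0 <= A * Y by rewrite mulr_ge0// ltW.
rewrite mulrDr; lra.
Qed.

Theorem theorem1p1 (R : realType) (N : nat) (a w : 'I_N -> R) :
  (0 < N)%N ->
  (forall k, 0 < a k) -> (forall k, 0 < w k) ->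
  frame_set (rat_window a w) =
    [set ab : R * R | 0 < ab.1 /\ 0 < ab.2 /\ ab.1 * ab.2 <= 1].
Proof.
move=> N0 a0 w0; apply/seteqP; split => -[alpha beta] /= [al0 [b0 H]].
- do 2 split => //; rewrite leNgt; apply/negP => ab.
  have [A [B [A0 [_ HAB]]]] := H.
  have [h Lh] := gaborS_no_lower N a w alpha beta A N0 a0 w0 al0 b0 ab A0.
  by rewrite ltNge => /negP; apply; have [] := HAB h Lh.
- do 2 split => //.
  have [C C0 HC] := gaborS_upper N a w alpha beta w0 al0 b0.
  have [D D0 HD] := gaborS_lower N a w alpha beta a0 w0 al0 b0 N0 H.
  have D1 : 0 < D + 1 by rewrite ltr_wpDl.
  (* [D + 1] is invertible even if [D = 0], and adding its inverse to [C] orders the two bounds. *)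
  exists (D + 1)^-1, (C + (D + 1)^-1); split; first by rewrite invr_gt0.
  split; first by rewrite lerDr.
  move=> h Lh; have n0 := L2norm2_ge0 h; have fh := L2norm2_fin h Lh.
  have S0 := gaborS_ge0 N a w alpha beta h.
  split.
  + apply: (@le_trans _ _ (((D + 1)^-1)%:E * (D%:E * gaborS N a w alpha beta h))%E).
      by rewrite lee_wpmul2l ?lee_fin ?invr_ge0 ?(ltW D1)// HD.
    rewrite muleA -EFinM -[leRHS]mul1e lee_wpmul2r// lee_fin.
    by rewrite mulrC ler_pdivrMr// mul1r lerDl.
  + apply: (le_trans (HC h Lh)); rewrite lee_wpmul2r// lee_fin lerDl.
    by rewrite invr_ge0 ltW.
Qed.
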